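(* Let $n\ge 3$. (1) Suppose that $\phi: M^n\to\mathbb{H}^{n+1}$ is an immersed, complete, uniformly horospherically convex hypersurface with injective Gauss map $G:M^n\to\mathbb{S}^n$. Then it induces a complete conformal metric $e^{2\rho}g_{\mathbb{S}^n}$ on $G(M^n)\subset\mathbb{S}^n$ with bounded curvature, where $\rho=\tilde\rho\circ G^{-1}$ is the horospherical support function, and $$\partial_\infty\phi(M^n)=\partial G(M^n).$$ (2) On the other hand, suppose that $e^{2\rho}g_{\mathbb{S}^n}$ is a complete metric on a domain $\Omega$ in $\mathbb{S}^n$ with bounded curvature. Then it induces properly immersed, complete, uniformly horospherically convex hypersurfaces $$\phi_t=\frac{e^{\rho+t}}{2}\left(1+e^{-2\rho-2t}\left(1+|\nabla\rho|^2\right)\right)(1,x)+e^{-\rho-t}(0,-x+\nabla\rho):\Omega\to\mathbb{H}^{n+1}$$ and $$\partial_\infty\phi_t(\Omega)=\partial\Omega$$ for $t$ large enough.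
   Context: $\mathbb{R}^{1,n+1}$ is $\mathbb{R}^{n+2}$ with $\langle\bar x,\bar x\rangle=-x_0^2+\sum_{i=1}^{n+1}x_i^2$, and $\mathbb{H}^{n+1}=\{\bar x:\langle\bar x,\bar x\rangle=-1,\ x_0>0\}$. The ideal boundary of $\mathbb{H}^{n+1}$ is the unit sphere $\mathbb{S}^n\subset\mathbb{R}^{n+1}$ with round metric $g_{\mathbb{S}^n}$, where $x\in\mathbb{S}^n$ corresponds to the null ray through $(1,x)$. An immersed hypersurface $\phi:M^n\to\mathbb{H}^{n+1}$ is oriented by a unit normal field $\eta$, viewed as a map into $\{\bar x:\langle\bar x,\bar x\rangle=1\}$; its principal curvatures $\kappa_i$ are defined by $d\eta(e_i)=-\kappa_i\,d\phi(e_i)$ in an orthonormal basis of principal directions. ''Complete'' for a hypersurface means that the induced metric is complete. $\phi$ is uniformly horospherically convex if there is a number $\kappa_0<1$ such that all principal curvatures at all points are $\le\kappa_0$. The Gauss map $G:M^n\to\mathbb{S}^n$ sends $p$ to the point at infinity of the unique horosphere through $\phi(p)$ whose inner unit normal at $\phi(p)$ is $\eta(p)$. Equivalently $\phi+\eta=e^{\tilde\rho}(1,G)$, which defines $G$ and the horospherical support function $\tilde\rho$ on $M^n$. The horospherical metric on $M^n$ is $g_h=e^{2\tilde\rho}G^*g_{\mathbb{S}^n}$; when $G$ is injective the induced metric on $G(M^n)$ is $(G^{-1})^*g_h=e^{2\rho}g_{\mathbb{S}^n}$ with $\rho=\tilde\rho\circ G^{-1}$. Conversely, for a metric $e^{2\rho}g_{\mathbb{S}^n}$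 on $\Omega$, the map $\phi_t$ displayed in (2) is oriented by $\eta_t=e^{\rho+t}(1,x)-\phi_t$; here $\nabla\rho$ and $|\nabla\rho|$ are taken with respect to $g_{\mathbb{S}^n}$ and $\nabla\rho(x)\in T_x\mathbb{S}^n$ is regarded as a vector of $\mathbb{R}^{n+1}$. The boundary at infinity $\partial_\infty\phi(M^n)\subset\mathbb{S}^n$ is the set of $x\in\mathbb{S}^n$ that are limits, in the Euclidean topology of $\overline{\mathbb{B}^{n+1}}$, of sequences of points of the hypersurface in the Poincaré ball model $\mathbb{B}^{n+1}$. A conformal metric $g$ has bounded curvature if its curvature (equivalently, since it is locally conformally flat, its Schouten tensor $\frac{1}{n-2}(\mathrm{Ric}_g-\frac{S_g}{2(n-1)}g)$, with $S_g$ the scalar curvature) is bounded with respect to $g$. *)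

(* Defs.v *)
From HB Require Import structures.
From mathcomp Require Import all_boot all_order all_algebra.
From mathcomp Require Import all_classical all_reals all_analysis.
Import Order.TTheory GRing.Theory Num.Theory numFieldNormedType.Exports.

Set Implicit Arguments.
Unset Strict Implicit.
Unset Printing Implicit Defensive.

Local Open Scope classical_set_scope.
Local Open Scope ring_scope.

(* C^oo on U, meant for U open: every iterated directional derivative of f is
   Frechet differentiable at every point of U. *)
Definition smooth_on (R : realType) (V W : normedModType R) (U : set V)
    (f : V -> W) : Prop :=
  forall (s : seq V) (x : V), U x ->
    differentiable (foldr (fun v (h : V -> W) => (fun y => 'D_v h y)) f s) x.

Definition partial (R : realType) (n : nat) (W : normedModType R) (i : 'I_n)
    (f : 'rV[R]_n -> W) (y : 'rV[R]_n) : W :=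
  'D_(delta_mx 0 i) f y.

Definition dot (R : realType) (m : nat) (u v : 'rV[R]_m) : R :=
  \sum_i u 0 i * v 0 i.

(* Vectors of R^{1,m} are row_mx x0 x with x0 the time coordinate. *)
Definition lorentz (R : realType) (m : nat) (u v : 'rV[R]_(1 + m)) : R :=
  - dot (lsubmx u) (lsubmx v) + dot (rsubmx u) (rsubmx v).

Definition time (R : realType) (m : nat) (u : 'rV[R]_(1 + m)) : R :=
  u 0 (lshift m 0).

Definition vec (R : realType) (m : nat) (a : R) (x : 'rV[R]_m) :
    'rV[R]_(1 + m) :=
  row_mx a%:M x.

Definition hyperbolic (R : realType) (m : nat) : set 'rV[R]_(1 + m) :=
  [set u | lorentz u u = -1 /\ 0 < time u].

Definition sphere (R : realType) (n : nat) : set 'rV[R]_(1 + n) :=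
  [set x | dot x x = 1].
Arguments sphere : clear implicits.

(* A smooth structure is given by local parametrizations rather than charts,
   so that an n-manifold is carried by the union of their images: this treats
   alike an abstract manifold T and a domain Omega of the sphere
   (T = R^(n+1)), without a type of points of Omega. *)
Record lparam (R : realType) (n : nat) (T : Type) := LParam {
  lp_dom : set 'rV[R]_n ;
  lp_map :> 'rV[R]_n -> T
}.

Definition points (R : realType) (n : nat) (T : Type)
    (A : set (lparam R n T)) : set T :=
  [set p | exists2 c, A c & exists2 y, lp_dom c y & c y = p].

(* The parametrizations are homeomorphisms from open sets of R^n onto open
   sets of T, with smooth transition maps. *)
Definition smooth_manifold (R : realType) (n : nat) (T : topologicalType)
    (A : set (lparam R n T)) : Prop :=
  [/\ hausdorff_space T,
      @second_countable T,
      points A = [set: T],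
      forall c, A c ->
        [/\ open (lp_dom c),
            {in lp_dom c &, injective c},
            forall y, lp_dom c y -> {for y, continuous c} &
            forall V, open V -> V `<=` lp_dom c -> open (c @` V)] &
      forall c c', A c -> A c' ->
        let W := lp_dom c `&` c @^-1` (c' @` lp_dom c') in
        exists2 tau : 'rV[R]_n -> 'rV[R]_n,
          (forall y, W y -> lp_dom c' (tau y) /\ c' (tau y) = c y) &
          smooth_on W tau].

Definition smooth_map (R : realType) (n : nat) (T : Type)
    (A : set (lparam R n T)) (W : normedModType R) (f : T -> W) : Prop :=
  forall c, A c -> smooth_on (lp_dom c) (f \o c).

Definition immersion (R : realType) (n : nat) (T : Type)
    (A : set (lparam R n T)) (W : normedModType R) (f : T -> W) : Prop :=
  smooth_map A f /\
  forall c, A c -> forall y, lp_dom c y ->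
    forall v, 'D_v (f \o c) y = 0 -> v = 0.

(* The metric p |-> form_p (dmap, dmap), pulled back by a map into some R^m. *)
Record pmetric (R : realType) (T : Type) := PMetric {
  pm_dim : nat ;
  pm_map : T -> 'rV[R]_pm_dim ;
  pm_form : T -> 'rV[R]_pm_dim -> 'rV[R]_pm_dim -> R
}.
Arguments pm_map {R T} p _.
Arguments pm_form {R T} p _ _ _.

Definition induced_metric (R : realType) (m : nat) (T : Type)
    (phi : T -> 'rV[R]_(1 + m)) : pmetric R T :=
  PMetric phi (fun _ => @lorentz R m).

(* e^{2 rho} g_{S^n}, on subsets of the sphere. *)
Definition conformal_metric (R : realType) (n : nat)
    (rho : 'rV[R]_(1 + n) -> R) : pmetric R 'rV[R]_(1 + n) :=
  PMetric id (fun x u v => expR (2 * rho x) * dot u v).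

Definition C1_at (R : realType) (n : nat) (T : Type) (A : set (lparam R n T))
    (gam : R -> T) (t0 : R) : Prop :=
  exists2 c, A c & exists y : R -> 'rV[R]_n,
    \forall t \near t0,
      [/\ lp_dom c (y t), gam t = c (y t), derivable y t 1 &
          {for t, continuous (derive1 y)}].

(* A piecewise C^1 curve is a list of C^1 arcs parametrized by [0, 1]. *)
Fixpoint joins (R : realType) (n : nat) (T : Type) (A : set (lparam R n T))
    (s : seq (R -> T)) (p q : T) : Prop :=
  match s with
  | [::] => p = q
  | gam :: s' =>
      [/\ forall t, 0 <= t <= 1 -> C1_at A gam t, gam 0 = p
        & joins A s' (gam 1) q]
  end.

Definition speed (R : realType) (T : Type) (g : pmetric R T) (gam : R -> T)
    (t : R) : R :=
  let w := derive1 (pm_map g \o gam) t in Num.sqrt (pm_form g (gam t) w w).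

Definition curve_length (R : realType) (T : Type) (g : pmetric R T)
    (s : seq (R -> T)) : \bar R :=
  (\sum_(gam <- s)
     \int[@lebesgue_measure R]_(t in `[0%R, 1%R]) (speed g gam t)%:E)%E.

(* +oo between points of distinct components. *)
Definition riem_dist (R : realType) (n : nat) (T : Type)
    (A : set (lparam R n T)) (g : pmetric R T) (p q : T) : \bar R :=
  ereal_inf [set L | exists2 s, joins A s p q & L = curve_length g s].

Definition complete_metric (R : realType) (n : nat) (T : topologicalType)
    (A : set (lparam R n T)) (g : pmetric R T) : Prop :=
  forall u : nat -> T, (forall k, points A (u k)) ->
    (forall e : R, 0 < e -> exists N : nat, forall i j : nat,
       (N <= i)%N -> (N <= j)%N -> (riem_dist A g (u i) (u j) < e%:E)%E) ->
    exists2 p, points A p & u @ \oo --> p.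

Definition gram (R : realType) (n : nat) (T : Type) (g : pmetric R T)
    (c : lparam R n T) (y : 'rV[R]_n) : 'M[R]_n :=
  \matrix_(i, j) pm_form g (c y) (partial i (pm_map g \o c) y)
                                 (partial j (pm_map g \o c) y).

(* Gamma^l_{ij} of a metric given by its Gram matrix in coordinates *)
Definition christoffel (R : realType) (n : nat) (g : 'rV[R]_n -> 'M[R]_n)
    (l i j : 'I_n) (y : 'rV[R]_n) : R :=
  2^-1 * \sum_m invmx (g y) l m *
    (partial i (fun z => g z j m : R^o) y
     + partial j (fun z => g z i m : R^o) y
     - partial m (fun z => g z i j : R^o) y).

(* R(d_i, d_j) d_k = sum_l riem^l_{ijk} d_l *)
Definition riem (R : realType) (n : nat) (g : 'rV[R]_n -> 'M[R]_n)
    (l i j k : 'I_n) (y : 'rV[R]_n) : R :=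
  partial i (christoffel g l j k : 'rV[R]_n -> R^o) y
  - partial j (christoffel g l i k : 'rV[R]_n -> R^o) y
  + \sum_m (christoffel g l i m y * christoffel g m j k y
            - christoffel g l j m y * christoffel g m i k y).

(* g(R(u, v) w, z) *)
Definition riem4 (R : realType) (n : nat) (g : 'rV[R]_n -> 'M[R]_n)
    (y u v w z : 'rV[R]_n) : R :=
  \sum_i \sum_j \sum_k \sum_l \sum_m
    g y l m * riem g l i j k y * u 0 i * v 0 j * w 0 k * z 0 m.

Definition mx_norm2 (R : realType) (n : nat) (G : 'M[R]_n) (u : 'rV[R]_n) : R :=
  \sum_i \sum_j G i j * u 0 i * u 0 j.

Definition bounded_curvature (R : realType) (n : nat) (T : Type)
    (A : set (lparam R n T)) (g : pmetric R T) : Prop :=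
  exists C : R, forall c, A c -> forall y, lp_dom c y ->
    forall u v w z : 'rV[R]_n,
      let nrm a := Num.sqrt (mx_norm2 (gram g c y) a) in
      `|riem4 (gram g c) y u v w z| <= C * nrm u * nrm v * nrm w * nrm z.

(* Inverse stereographic projection from the pole (1, 0) for b = false,
   (-1, 0) for b = true. *)
Definition stereo (R : realType) (n : nat) (b : bool) (y : 'rV[R]_n) :
    'rV[R]_(1 + n) :=
  (1 + dot y y)^-1 *: vec ((-1) ^+ b * (dot y y - 1)) (2 *: y).

(* The smooth structure of an open subset Omega of the sphere. *)
Definition sphere_atlas (R : realType) (n : nat) (Omega : set 'rV[R]_(1 + n)) :
    set (lparam R n 'rV[R]_(1 + n)) :=
  [set c | exists b : bool,
     c = LParam (@stereo R n b @^-1` Omega) (@stereo R n b)].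

Definition open_in_sphere (R : realType) (n : nat)
    (Omega : set 'rV[R]_(1 + n)) : Prop :=
  exists2 W, open W & Omega = W `&` sphere R n.

Definition sphere_domain (R : realType) (n : nat)
    (Omega : set 'rV[R]_(1 + n)) : Prop :=
  [/\ open_in_sphere Omega, connected Omega & Omega !=set0].

(* The sphere being closed, closures in it are closures in R^(n+1). *)
Definition sphere_boundary (R : realType) (n : nat)
    (Omega : set 'rV[R]_(1 + n)) : set 'rV[R]_(1 + n) :=
  closure Omega `&` closure (sphere R n `\` Omega).

(* The gradient of rho for the round metric; only the values of rho on the
   sphere matter. *)
Definition sphere_grad (R : realType) (n : nat) (rho : 'rV[R]_(1 + n) -> R)
    (x : 'rV[R]_(1 + n)) : 'rV[R]_(1 + n) :=
  xget 0 [set V | dot V x = 0 /\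
    forall (b : bool) (y : 'rV[R]_n), stereo b y = x ->
      forall v, 'D_v ((rho : _ -> R^o) \o stereo b) y
                = dot V ('D_v (@stereo R n b) y)].

(* phi immersed into hyperbolic space, with unit normal field eta *)
Definition hypersurface (R : realType) (n : nat) (T : Type)
    (A : set (lparam R n T)) (phi eta : T -> 'rV[R]_(1 + (1 + n))) : Prop :=
  [/\ immersion A phi,
      smooth_map A eta,
      forall p, points A p ->
        [/\ hyperbolic (phi p), lorentz (eta p) (eta p) = 1 &
            lorentz (eta p) (phi p) = 0] &
      forall c, A c -> forall y, lp_dom c y ->
        forall v, lorentz (eta (c y)) ('D_v (phi \o c) y) = 0].

Definition principal_frame (R : realType) (n : nat) (T : Type)
    (phi eta : T -> 'rV[R]_(1 + (1 + n))) (c : lparam R n T) (y : 'rV[R]_n)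
    (e : 'I_n -> 'rV[R]_n) (kappa : 'I_n -> R) : Prop :=
  (forall i j,
     lorentz ('D_(e i) (phi \o c) y) ('D_(e j) (phi \o c) y) = (i == j)%:R) /\
  (forall i, 'D_(e i) (eta \o c) y = - kappa i *: 'D_(e i) (phi \o c) y).

(* Every point has a principal frame, the shape operator being self-adjoint. *)
Definition unif_horo_convex (R : realType) (n : nat) (T : Type)
    (A : set (lparam R n T)) (phi eta : T -> 'rV[R]_(1 + (1 + n))) : Prop :=
  exists2 kappa0 : R, kappa0 < 1 &
    forall c, A c -> forall y, lp_dom c y ->
      forall e kappa, principal_frame phi eta c y e kappa ->
        forall i, kappa i <= kappa0.

(* Properness as a map into hyperbolic space. *)
Definition proper_map (R : realType) (n m : nat) (T : topologicalType)
    (A : set (lparam R n T)) (phi : T -> 'rV[R]_(1 + m)) : Prop :=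
  forall K : set 'rV[R]_(1 + m), compact K -> K `<=` @hyperbolic R m ->
    compact (points A `&` phi @^-1` K).

(* Poincare ball model: projection from (-1, 0) *)
Definition to_ball (R : realType) (m : nat) (u : 'rV[R]_(1 + m)) : 'rV[R]_m :=
  (1 + time u)^-1 *: rsubmx u.

Definition boundary_at_infinity (R : realType) (n : nat)
    (S : set 'rV[R]_(1 + (1 + n))) : set 'rV[R]_(1 + n) :=
  [set x | sphere R n x /\
    exists2 u : nat -> 'rV[R]_(1 + (1 + n)), (forall k, S (u k)) &
      (fun k => to_ball (u k)) @ \oo --> x].

(* phi + eta = e^rhot (1, G) determines both the Gauss map G and the
   horospherical support function rhot. *)
Definition gauss_support (R : realType) (n : nat) (T : Type)
    (A : set (lparam R n T)) (phi eta : T -> 'rV[R]_(1 + (1 + n)))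
    (G : T -> 'rV[R]_(1 + n)) (rhot : T -> R) : Prop :=
  forall p, points A p -> phi p + eta p = expR (rhot p) *: vec 1 (G p).

Definition phi_of (R : realType) (n : nat) (rho : 'rV[R]_(1 + n) -> R) (t : R)
    (x : 'rV[R]_(1 + n)) : 'rV[R]_(1 + (1 + n)) :=
  let D := sphere_grad rho x in
  (expR (rho x + t) / 2 * (1 + expR (- 2 * rho x - 2 * t) * (1 + dot D D)))
    *: vec 1 x
  + expR (- rho x - t) *: vec 0 (- x + D).

Definition eta_of (R : realType) (n : nat) (rho : 'rV[R]_(1 + n) -> R) (t : R)
    (x : 'rV[R]_(1 + n)) : 'rV[R]_(1 + (1 + n)) :=
  expR (rho x + t) *: vec 1 x - phi_of rho t x.

(* Main.v *)
(* Put psi = phi + eta = e^rho (1, x).  In a stereographic chart psi = e^f Z with Z null and affine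
   in (y, |y|^2), so H = <dpsi, dpsi> = e^(2f) |dy|^2 is the horospherical metric, and differentiating
   <phi, dpsi> = 0 gives the key identity <dphi, dpsi> = H / 2 + T, with T minus the Schouten tensor
   of H.  As n >= 3, bounded curvature means |T| <= C H.
   (1) In a principal frame dpsi = (1 - kappa_i) dphi; hence 0 <= <dphi, dpsi> <= H / (1 - kappa0)
   bounds T, and <dphi, dphi> <= H / (1 - kappa0)^2 makes G an immersion and H complete.
   (2) Replacing rho by rho + t multiplies H by e^(2t) and preserves T, so for t large
   H / 4 <= <dphi, dpsi> <= 3 H / 4.  The upper bound forces kappa_i <= 0, and the Cauchy-Schwarz
   inequality on the spacelike space orthogonal to phi gives H <= 16 <dphi, dphi>, whence immersion
   and completeness.
   At infinity, |to_ball (phi x) - x|^2 = 2 e^(-rho x) / (1 + time (phi x)) and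
   time (phi x) >= e^(rho x) / 2, so it suffices that {rho <= L} is compact.  Put w = e^(-f): since
   w D_vD_v w >= - C |v|^2, near a boundary point at which w does not tend to 0 there is a straight
   segment leaving the chart domain along which w stays bounded below; it has finite length,
   contradicting completeness. *)
Require Import Defs.
From HB Require Import structures.
From mathcomp Require Import all_boot all_order all_algebra.
From mathcomp Require Import all_classical all_reals all_analysis.
From mathcomp Require Import ring lra.
Import Order.TTheory GRing.Theory Num.Theory numFieldNormedType.Exports.

Set Implicit Arguments.
Unset Strict Implicit.
Unset Printing Implicit Defensive.

Local Open Scope classical_set_scope.
Local Open Scope ring_scope.

(** The key identity uses only <phi, phi> = -1, <phi, psi> = -1 and <phi, dpsi> = 0, so one
    computation serves both directions; in (1) it is applied to phi composed with the inverse Gauss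
    map, whose smoothness comes from an inverse function theorem. The choice w = e^(-f) is dictated
    by T: the square (D_v f)^2 is absorbed in D_vD_v w, and the remaining term |df|^2 |v|^2 / 2 has
    the favourable sign, so a one-sided bound of T suffices. The obstacle at the boundary is that
    this controls second derivatives of w only, while its gradient may blow up near a boundary point
    y0. But steep ascent from a nearby point leads to large values of w at one of the finitely many
    points y0 +- r e_i, and since w is a total function these values are fixed numbers, which bound
    the gradient. Completeness means convergence of Cauchy sequences for the length distance, so
    both of its transfers reduce to a pointwise comparison of speeds; no geodesics occur. *)

(** * Calculus of smooth maps *)

(* k + 1 times Frechet differentiable on U. *)
Fixpoint Ck (R : realType) (V W : normedModType R) (k : nat) (U : set V)
    (f : V -> W) : Prop :=
  (forall x, U x -> differentiable f x) /\
  (if k is k'.+1 then forall v, Ck k' U (fun y => 'D_v f y) else True).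

Lemma Ck_diff (R : realType) (V W : normedModType R) k (U : set V) (f : V -> W) :
  Ck k U f -> forall x, U x -> differentiable f x.
Proof. by case: k => [|k] []. Qed.

Lemma Ck_derive (R : realType) (V W : normedModType R) k (U : set V) (f : V -> W) :
  Ck k.+1 U f -> forall v, Ck k U (fun y => 'D_v f y).
Proof. by case. Qed.

Lemma CkS (R : realType) (V W : normedModType R) k (U : set V) (f : V -> W) :
  Ck k.+1 U f -> Ck k U f.
Proof.
elim: k f => [|k IH] f [fd fv]; first by split.
by split=> // v; apply: IH; apply: fv.
Qed.

(** Closure properties need an induction on the order of differentiation, which [Ck] provides. [Ck]
    strips the innermost derivative first, whereas [foldr] exposes the outermost one; hence the
    passage through [rcons]. *)
Lemma smooth_onP (R : realType) (V W : normedModType R) (U : set V) (f : V -> W) :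
  smooth_on U f <-> forall k, Ck k U f.
Proof.
split=> [sf k|].
  elim: k f sf => [|k IH] f sf; split=> //; first exact: (sf [::]).
    exact: (sf [::]).
  move=> v; apply: IH => s x Ux.
  by have := sf (rcons s v) x Ux; rewrite foldr_rcons.
move=> + s; elim/last_ind: s f => [|s v IH] f cf x Ux.
  exact: Ck_diff (cf 0%N) _ Ux.
by rewrite foldr_rcons; apply: IH => // k; apply: Ck_derive (cf k.+1) v.
Qed.

Lemma smooth_derive (R : realType) (V W : normedModType R) (U : set V) (f : V -> W) v :
  smooth_on U f -> smooth_on U (fun y => 'D_v f y).
Proof. by move=> /smooth_onP cf; apply/smooth_onP => k; apply: Ck_derive (cf k.+1) v. Qed.

Lemma smooth_differentiable (R : realType) (V W : normedModType R) (U : set V)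
    (f : V -> W) x : smooth_on U f -> U x -> differentiable f x.
Proof. by move=> sf; apply: (sf [::]). Qed.

Lemma open_near_eq (R : realType) (V : normedModType R) (W : Type) (U : set V) (f g : V -> W) :
  open U -> (forall x, U x -> f x = g x) -> forall x, U x -> \near x, f x = g x.
Proof. by move=> oU fg x Ux; near=> y; apply: fg; near: y; exact: open_nbhs_nbhs. Unshelve. all: end_near. Qed.

Lemma diff_eps (R : realType) (V W : normedModType R) (f : V -> W) (x : V) :
  differentiable f x ->
  forall e : R, 0 < e ->
    \forall h \near (0 : V), `|f (h + x) - f x - 'd f x h| <= e * `|h|.
Proof.
move=> /diff_locally /eqaddoP de e e0; have := de e e0.
by apply: filterS => h; rewrite /= opprD addrA.
Qed.

Lemma diff_of_eps (R : realType) (V W : normedModType R) (f : V -> W)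
    (L : {linear V -> W}) (x : V) : continuous L ->
  (forall e : R, 0 < e ->
    \forall h \near (0 : V), `|f (h + x) - f x - L h| <= e * `|h|) ->
  differentiable f x /\ 'd f x = L :> (V -> W).
Proof.
move=> cL fe.
have e : f \o shift x = cst (f x) + L +o_ (0 : V) id.
  apply/eqaddoP => e e0; have := fe e e0.
  by apply: filterS => h; rewrite /= opprD addrA.
have dE := diff_unique cL e.
by split=> //; apply/diff_locallyP; rewrite dE.
Qed.

Lemma near_eq_differentiable (R : realType) (V W : normedModType R) (f g : V -> W) (x : V) :
  (\near x, f x = g x) -> differentiable f x -> differentiable g x.
Proof.
move=> fg df; have fgx : f x = g x by exact: nbhs_singleton fg.
have fg0 : \forall h \near (0 : V), f (h + x) = g (h + x).
  have : (fun h => h + x) @ (0 : V) --> 0 + x by apply: cvgD; [exact: cvg_id|exact: cvg_cst].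
  by rewrite add0r => /(_ _ fg).
apply: (proj1 (@diff_of_eps R V W g ('d f x) x _ _)); first exact: diff_continuous.
move=> e e0; near=> h.
rewrite -fgx -(near fg0 h) //; near: h; exact: diff_eps.
Unshelve. all: by end_near. Qed.

Lemma Ck_eq (R : realType) (V W : normedModType R) k (U : set V) (f g : V -> W) :
  open U -> (forall x, U x -> f x = g x) -> Ck k U f -> Ck k U g.
Proof.
move=> oU; elim: k f g => [|k IH] f g fg cf.
  split=> // x Ux; apply: near_eq_differentiable (Ck_diff cf Ux).
  exact: open_near_eq fg _ Ux.
split=> [x Ux|v].
  by apply: near_eq_differentiable (Ck_diff cf Ux); exact: open_near_eq fg _ Ux.
apply: IH (Ck_derive cf v) => x Ux.
by apply: near_eq_derive; exact: open_near_eq fg _ Ux.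
Qed.

Lemma CkD (R : realType) (V W : normedModType R) k (U : set V) (f g : V -> W) :
  open U -> Ck k U f -> Ck k U g -> Ck k U (fun x => f x + g x).
Proof.
move=> oU; elim: k f g => [|k IH] f g cf cg; split=> //.
- by move=> x Ux; apply: differentiableD; [exact: (Ck_diff cf Ux)|exact: (Ck_diff cg Ux)].
- by move=> x Ux; apply: differentiableD; [exact: (Ck_diff cf Ux)|exact: (Ck_diff cg Ux)].
- move=> v; apply: (Ck_eq oU _ (IH _ _ (Ck_derive cf v) (Ck_derive cg v))) => x Ux.
  rewrite deriveD //; apply: diff_derivable; first [exact: (Ck_diff cf Ux)|exact: (Ck_diff cg Ux)].
Qed.

Lemma Ck_cst (R : realType) (V W : normedModType R) k (U : set V) (a : W) :
  Ck k U (fun _ : V => a).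
Proof.
elim: k a => [|k IH] a; split=> //; try by move=> x _; exact: differentiable_cst.
move=> v.
have -> : (fun y => 'D_v (fun _ : V => a) y) = (fun _ => 0) by apply/funext => y; exact: derive_cst.
exact: IH.
Qed.

Lemma CkZ (R : realType) (V W : normedModType R) k (U : set V) (f : V -> R) (w : W) :
  open U -> Ck k U f -> Ck k U (fun x => f x *: w).
Proof.
move=> oU; elim: k f => [|k IH] f cf; split=> //.
- by move=> x Ux; apply: differentiableZl; exact: (Ck_diff cf Ux).
- by move=> x Ux; apply: differentiableZl; exact: (Ck_diff cf Ux).
- move=> v; apply: (Ck_eq oU _ (IH _ (Ck_derive cf v))) => x Ux.
  have df : differentiable f x by exact: (Ck_diff cf Ux).
  rewrite [RHS]deriveE; last exact: differentiableZl.
  by rewrite diffZl //= deriveE.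
Qed.

Lemma CkM (R : realType) (V : normedModType R) k (U : set V) (f g : V -> R) :
  open U -> Ck k U f -> Ck k U g -> Ck k U (fun x => f x * g x).
Proof.
move=> oU; elim: k f g => [|k IH] f g cf cg; split=> //.
- by move=> x Ux; apply: differentiableM; [exact: (Ck_diff cf Ux)|exact: (Ck_diff cg Ux)].
- by move=> x Ux; apply: differentiableM; [exact: (Ck_diff cf Ux)|exact: (Ck_diff cg Ux)].
- move=> v; have := CkD oU (IH _ _ (CkS cf) (Ck_derive cg v)) (IH _ _ (CkS cg) (Ck_derive cf v)).
  apply: Ck_eq => // x Ux.
  by rewrite deriveM //; apply: diff_derivable; first [exact: (Ck_diff cf Ux)|exact: (Ck_diff cg Ux)].
Qed.

Lemma Ck_sum (R : realType) (V W : normedModType R) k (U : set V) (I : Type) (r : seq I)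
    (f : I -> V -> W) :
  open U -> (forall i, Ck k U (f i)) -> Ck k U (fun x => \sum_(i <- r) f i x).
Proof.
move=> oU cf; elim: r => [|i r IH].
  rewrite (_ : (fun x => _) = fun _ => 0); first exact: Ck_cst.
  by apply/funext => x; rewrite big_nil.
rewrite (_ : (fun x => _) = fun x => f i x + \sum_(i <- r) f i x); first exact: CkD.
by apply/funext => x; rewrite big_cons.
Qed.

Lemma differentiable_entry (R : realType) (V : normedModType R) m n (f : V -> 'M[R]_(m, n)) i j x :
  differentiable f x -> differentiable (fun x => f x i j) x.
Proof.
move=> df; apply: (@differentiable_comp _ _ _ _ f (fun N : 'M[R]_(m, n) => N i j)) => //.
exact: differentiable_coord.
Qed.

Lemma derive_entry (R : realType) (V : normedModType R) m n (f : V -> 'M[R]_(m, n)) i j x v :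
  differentiable f x -> 'D_v (fun x => f x i j) x = 'D_v f x i j.
Proof. by move=> df; rewrite derive_mx ?mxE //; exact: diff_derivable. Qed.

Lemma Ck_coord (R : realType) (V : normedModType R) m n k (U : set V) (f : V -> 'M[R]_(m, n)) i j :
  open U -> Ck k U f -> Ck k U (fun x => f x i j).
Proof.
move=> oU; elim: k f => [|k IH] f cf.
  by split=> // x Ux; apply: differentiable_entry (Ck_diff cf Ux).
split=> [x Ux|v]; first exact: differentiable_entry (Ck_diff cf Ux).
apply: (Ck_eq oU _ (IH _ (Ck_derive cf v))) => x Ux.
by rewrite derive_entry //; exact: (Ck_diff cf Ux).
Qed.

Lemma Ck_mx (R : realType) (V : normedModType R) m n k (U : set V) (f : V -> 'M[R]_(m, n)) :
  open U -> (forall i j, Ck k U (fun x => f x i j)) -> Ck k U f.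
Proof.
move=> oU cf.
rewrite (_ : f = fun x => \sum_i \sum_j f x i j *: delta_mx i j).
  by apply: Ck_sum => // i; apply: Ck_sum => // j; apply: CkZ.
by apply/funext => x; rewrite [LHS]matrix_sum_delta.
Qed.

Lemma derive_comp (R : realType) (U V W : normedModType R) (g : U -> V) (f : V -> W) x v :
  differentiable g x -> differentiable f (g x) ->
  'D_v (f \o g) x = 'D_('D_v g x) f (g x).
Proof.
move=> dg df; rewrite !deriveE //; last exact: differentiable_comp.
by rewrite diff_comp.
Qed.

Lemma derive_linear (R : realType) (V W : normedModType R) (f : V -> W) x a u v :
  differentiable f x -> 'D_(a *: u + v) f x = a *: 'D_u f x + 'D_v f x.
Proof. by move=> df; rewrite !deriveE // linearP. Qed.

Lemma derive_coord (R : realType) (W : normedModType R) n (f : 'rV[R]_n -> W) x v :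
  differentiable f x -> 'D_v f x = \sum_i v 0 i *: partial i f x.
Proof.
move=> df; rewrite /partial deriveE // {1}[v]row_sum_delta linear_sum.
by apply: eq_bigr => i _; rewrite linearZ deriveE.
Qed.

(** In coordinates the chain rule writes a derivative of [f \o g] as a sum of products of a
    component of ['D_v g] with [partial i f \o g], and the induction on the order applies to each
    factor. *)
Lemma Ck_comp (R : realType) (V : normedModType R) m k (U : set V) (U' : set 'rV[R]_m)
    (g : V -> 'rV[R]_m) (f : 'rV[R]_m -> R) :
  open U -> (forall x, U x -> U' (g x)) -> Ck k U g -> Ck k U' f -> Ck k U (f \o g).
Proof.
move=> oU gU; elim: k f => [|k IH] f cg cf.
  split=> // x Ux; apply: (differentiable_comp (Ck_diff cg Ux)).
  exact: (Ck_diff cf (gU _ Ux)).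
split=> [x Ux|v].
  apply: (differentiable_comp (Ck_diff cg Ux)); exact: (Ck_diff cf (gU _ Ux)).
have : Ck k U (fun x => \sum_i 'D_v g x 0 i * (partial i f \o g) x).
  apply: Ck_sum => // i; apply: CkM => //.
    exact: (Ck_coord 0 i oU (Ck_derive cg v)).
  exact: IH (CkS cg) (Ck_derive cf _).
apply: Ck_eq => // x Ux.
have dg := Ck_diff cg Ux; have df := Ck_diff cf (gU _ Ux).
rewrite (derive_comp v dg df) (derive_coord _ df); apply: eq_bigr => i _.
by rewrite /partial /=.
Qed.

Lemma derive1_chain (R : realType) (V : normedModType R) (h : R -> R) (f : V -> R) x v a :
  differentiable f x -> is_derive (f x) 1 h a ->
  differentiable (h \o f) x /\ 'D_v (h \o f) x = a * 'D_v f x.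
Proof.
move=> df ha.
have dh : differentiable h (f x) by apply/derivable1_diffP; apply: ex_derive.
split; first exact: differentiable_comp.
rewrite derive_comp // deriveE // -[X in 'd h _ X]mulr1 -[_ * 1]/(_ *: _) linearZ -deriveE //.
by rewrite derive_val mulrC.
Qed.

Lemma derive_exp (R : realType) (V : normedModType R) (f : V -> R) x v :
  differentiable f x ->
  differentiable (fun x => expR (f x)) x /\
  'D_v (fun x => expR (f x)) x = expR (f x) * 'D_v f x.
Proof. by move=> df; apply: (derive1_chain _ df). Qed.

Lemma derive_ln (R : realType) (V : normedModType R) (f : V -> R) x v :
  differentiable f x -> 0 < f x ->
  differentiable (fun x => ln (f x)) x /\
  'D_v (fun x => ln (f x)) x = (f x)^-1 * 'D_v f x.
Proof. by move=> df f0; apply: (derive1_chain _ df); exact: is_derive1_ln. Qed.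

Lemma Ck_exp (R : realType) (V : normedModType R) k (U : set V) (f : V -> R) :
  open U -> Ck k U f -> Ck k U (fun x => expR (f x)).
Proof.
move=> oU; elim: k => [|k IH] cf.
  by split=> // x Ux; apply: (derive_exp 0 (Ck_diff cf Ux)).1.
split=> [x Ux|v]; first exact: (derive_exp 0 (Ck_diff cf Ux)).1.
apply: (Ck_eq oU _ (CkM oU (IH (CkS cf)) (Ck_derive cf v))) => x Ux.
by rewrite (derive_exp v (Ck_diff cf Ux)).2.
Qed.

Lemma Ck_inv (R : realType) (V : normedModType R) k (U : set V) (f : V -> R) :
  open U -> (forall x, U x -> f x != 0) -> Ck k U f -> Ck k U (fun x => (f x)^-1).
Proof.
move=> oU f0; elim: k => [|k IH] cf.
  by split=> // x Ux; apply: differentiableV; [exact: (Ck_diff cf Ux)|exact: f0].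
split=> [x Ux|v].
  by apply: differentiableV; [exact: (Ck_diff cf Ux)|exact: f0].
have c1 : Ck k U (fun _ : V => -1 : R) by exact: Ck_cst.
have := CkM oU c1 (CkM oU (CkM oU (IH (CkS cf)) (IH (CkS cf))) (Ck_derive cf v)).
apply: Ck_eq => // x Ux.
rewrite deriveV ?f0 //; last by apply: diff_derivable; exact: (Ck_diff cf Ux).
by rewrite /GRing.scale /= -exprVn expr2 mulN1r mulNr.
Qed.

Lemma Ck_ln (R : realType) (V : normedModType R) k (U : set V) (f : V -> R) :
  open U -> (forall x, U x -> 0 < f x) -> Ck k U f -> Ck k U (fun x => ln (f x)).
Proof.
move=> oU f0; case: k => [|k] cf.
  by split=> // x Ux; apply: (derive_ln 0 (Ck_diff cf Ux) (f0 _ Ux)).1.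
split=> [x Ux|v]; first exact: (derive_ln 0 (Ck_diff cf Ux) (f0 _ Ux)).1.
have f1 x : U x -> f x != 0 by move=> /f0; rewrite lt0r => /andP[].
apply: (Ck_eq oU _ (CkM oU (Ck_inv oU f1 (CkS cf)) (Ck_derive cf v))) => x Ux.
by rewrite (derive_ln v (Ck_diff cf Ux) (f0 _ Ux)).2.
Qed.

Lemma Ck_subset (R : realType) (V W : normedModType R) k (U U' : set V) (f : V -> W) :
  U' `<=` U -> Ck k U f -> Ck k U' f.
Proof.
move=> sU; elim: k f => [|k IH] f [df cf]; split=> //; try by move=> x /sU /df.
by move=> v; apply: IH; exact: cf.
Qed.

Lemma Ck_local (R : realType) (V W : normedModType R) k (U : set V) (f : V -> W) :
  (forall x, U x -> exists U' (g : V -> W), [/\ open U', U' x, Ck k U' g & forall y, U' y -> g y = f y]) ->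
  Ck k U f.
Proof.
move=> loc.
have {}loc x : U x -> exists2 U' : set V, U' x & Ck k U' f.
  by move=> /loc[U' [g [oU' U'x cg gf]]]; exists U' => //; exact: Ck_eq cg.
elim: k f loc => [|k IH] f loc; split=> //.
- by move=> x /loc[U' U'x cf]; exact: (Ck_diff cf U'x).
- by move=> x /loc[U' U'x cf]; exact: (Ck_diff cf U'x).
- move=> v; apply: IH => x /loc[U' U'x cf]; exists U' => //; exact: (Ck_derive cf v).
Qed.

Lemma Ck_id (R : realType) (V : normedModType R) k (U : set V) : Ck k U (@id V).
Proof.
case: k => [|k]; split=> // v.
rewrite (_ : 'D_v id = fun=> v); first exact: Ck_cst.
by apply/funext => x; exact: derive_id.
Qed.

Lemma smoothD (R : realType) (V W : normedModType R) (U : set V) (f g : V -> W) :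
  open U -> smooth_on U f -> smooth_on U g -> smooth_on U (fun x => f x + g x).
Proof.
by move=> oU /smooth_onP cf /smooth_onP cg; apply/smooth_onP => k; apply: CkD.
Qed.

Lemma smooth_cst (R : realType) (V W : normedModType R) (U : set V) (a : W) :
  smooth_on U (fun _ : V => a).
Proof. by apply/smooth_onP => k; apply: Ck_cst. Qed.

Lemma smoothM (R : realType) (V : normedModType R) (U : set V) (f g : V -> R) :
  open U -> smooth_on U f -> smooth_on U g -> smooth_on U (fun x => f x * g x).
Proof.
by move=> oU /smooth_onP cf /smooth_onP cg; apply/smooth_onP => k; apply: CkM.
Qed.

Lemma smooth_sum (R : realType) (V W : normedModType R) (U : set V) (I : Type) (r : seq I)
    (f : I -> V -> W) :
  open U -> (forall i, smooth_on U (f i)) -> smooth_on U (fun x => \sum_(i <- r) f i x).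
Proof.
move=> oU cf; apply/smooth_onP => k; apply: Ck_sum => // i.
by move: k; apply/smooth_onP.
Qed.

Lemma smooth_entry (R : realType) (V : normedModType R) m n (U : set V) (f : V -> 'M[R]_(m, n)) i j :
  open U -> smooth_on U f -> smooth_on U (fun x => f x i j).
Proof. by move=> oU /smooth_onP cf; apply/smooth_onP => k; apply: Ck_coord. Qed.

Lemma smooth_mx (R : realType) (V : normedModType R) m n (U : set V) (f : V -> 'M[R]_(m, n)) :
  open U -> (forall i j, smooth_on U (fun x => f x i j)) -> smooth_on U f.
Proof.
move=> oU cf; apply/smooth_onP => k; apply: Ck_mx => // i j.
by move: k; apply/smooth_onP.
Qed.

Lemma Ck_comp_mx (R : realType) (V : normedModType R) m p q k (U : set V) (U' : set 'rV[R]_m)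
    (g : V -> 'rV[R]_m) (f : 'rV[R]_m -> 'M[R]_(p, q)) :
  open U -> open U' -> (forall x, U x -> U' (g x)) -> Ck k U g -> Ck k U' f -> Ck k U (f \o g).
Proof.
move=> oU oU' gU cg cf; apply: Ck_mx => // i j.
exact: (Ck_comp oU gU cg (Ck_coord i j oU' cf)).
Qed.

Lemma smooth_comp (R : realType) (V : normedModType R) m (U : set V) (U' : set 'rV[R]_m)
    (g : V -> 'rV[R]_m) (f : 'rV[R]_m -> R) :
  open U -> (forall x, U x -> U' (g x)) -> smooth_on U g -> smooth_on U' f ->
  smooth_on U (f \o g).
Proof.
by move=> oU gU /smooth_onP cg /smooth_onP cf; apply/smooth_onP => k; apply: (Ck_comp oU gU).
Qed.

Lemma smooth_comp_mx (R : realType) (V : normedModType R) m p q (U : set V) (U' : set 'rV[R]_m)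
    (g : V -> 'rV[R]_m) (f : 'rV[R]_m -> 'M[R]_(p, q)) :
  open U -> open U' -> (forall x, U x -> U' (g x)) -> smooth_on U g -> smooth_on U' f ->
  smooth_on U (f \o g).
Proof.
by move=> oU oU' gU /smooth_onP cg /smooth_onP cf; apply/smooth_onP => k; apply: (Ck_comp_mx oU oU' gU).
Qed.

Lemma smooth_exp (R : realType) (V : normedModType R) (U : set V) (f : V -> R) :
  open U -> smooth_on U f -> smooth_on U (fun x => expR (f x)).
Proof. by move=> oU /smooth_onP cf; apply/smooth_onP => k; apply: Ck_exp. Qed.

Lemma smooth_inv (R : realType) (V : normedModType R) (U : set V) (f : V -> R) :
  open U -> (forall x, U x -> f x != 0) -> smooth_on U f -> smooth_on U (fun x => (f x)^-1).
Proof. by move=> oU f0 /smooth_onP cf; apply/smooth_onP => k; apply: Ck_inv. Qed.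

Lemma smooth_ln (R : realType) (V : normedModType R) (U : set V) (f : V -> R) :
  open U -> (forall x, U x -> 0 < f x) -> smooth_on U f -> smooth_on U (fun x => ln (f x)).
Proof. by move=> oU f0 /smooth_onP cf; apply/smooth_onP => k; apply: Ck_ln. Qed.

Lemma smooth_eq (R : realType) (V W : normedModType R) (U : set V) (f g : V -> W) :
  open U -> (forall x, U x -> f x = g x) -> smooth_on U f -> smooth_on U g.
Proof. by move=> oU fg /smooth_onP cf; apply/smooth_onP => k; apply: Ck_eq (cf k). Qed.

Lemma smooth_subset (R : realType) (V W : normedModType R) (U U' : set V) (f : V -> W) :
  U' `<=` U -> smooth_on U f -> smooth_on U' f.
Proof. by move=> sU /smooth_onP cf; apply/smooth_onP => k; apply: Ck_subset (cf k). Qed.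

Lemma smooth_local (R : realType) (V W : normedModType R) (U : set V) (f : V -> W) :
  (forall x, U x -> exists U' (g : V -> W),
     [/\ open U', U' x, smooth_on U' g & forall y, U' y -> g y = f y]) ->
  smooth_on U f.
Proof.
move=> loc; apply/smooth_onP => k; apply: Ck_local => x /loc[U' [g [oU' U'x /smooth_onP sg gf]]].
by exists U', g.
Qed.

Lemma smooth_id (R : realType) (V : normedModType R) (U : set V) : smooth_on U (@id V).
Proof. by apply/smooth_onP => k; apply: Ck_id. Qed.

Lemma smoothN (R : realType) (V : normedModType R) (U : set V) (f : V -> R) :
  open U -> smooth_on U f -> smooth_on U (fun x => - f x).
Proof.
move=> oU sf; have c1 : smooth_on U (fun _ : V => -1 : R) by exact: smooth_cst.
have := smoothM oU c1 sf.
by apply: smooth_eq => // x _; rewrite mulN1r.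
Qed.

(** * Inverse function theorem *)

Lemma is_derive_line (R : realType) (V W : normedModType R) (f : V -> W) (p u : V) (t : R) :
  differentiable f (p + t *: u) ->
  is_derive t 1 (fun s : R => f (p + s *: u)) ('D_u f (p + t *: u)).
Proof.
move=> df; pose g (s : R) := p + s *: u.
have [dg gE] : differentiable g t /\ 'D_1 g t = u.
  have dk : differentiable (fun s : R => s *: u) t.
    by apply: (@differentiableZl _ _ _ id).
  split; first by apply: differentiableD => //; exact: differentiable_cst.
  rewrite /g deriveD; [|exact: derivable_cst|exact: diff_derivable].
  rewrite derive_cst add0r deriveE // diffZl //=.
  by rewrite diff_val scale1r.
have E := derive_comp (1 : R) dg df.
rewrite gE in E; rewrite -[X in is_derive _ _ _ X]E.
by apply/derivableP/diff_derivable; exact: differentiable_comp.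
Qed.

Lemma near_shift0 (R : realType) (V : normedModType R) (x : V) (P : V -> Prop) :
  (\forall y \near x, P y) -> \forall h \near (0 : V), P (h + x).
Proof.
have : (fun h => h + x) @ (0 : V) --> 0 + x by apply: cvgD; [exact: cvg_id|exact: cvg_cst].
by rewrite add0r => cv /cv.
Qed.

Lemma near0_norm (R : realType) (V : normedModType R) (P : V -> Prop) :
  (\forall h \near (0 : V), P h) -> exists2 d : R, 0 < d & forall h, `|h| < d -> P h.
Proof.
move=> /nbhs_ballP[d /= d0 dP]; exists d => // h hd; apply: dP.
by rewrite -ball_normE /= sub0r normrN.
Qed.

(** The mean value theorem in the direction [u], applied to t |-> f (x + s v + t u) - f (x + t u),
    turns the second difference into a difference of two values of 'D_u f. Both are expanded at [x],
    so differentiability of 'D_u f at that single point suffices. *)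
Lemma second_difference (R : realType) (V : normedModType R) (U : set V) (f : V -> R)
    (x u v : V) (e : R) : open U -> U x -> Ck 1 U f -> 0 < e ->
  exists2 d, 0 < d & forall s, 0 < s < d ->
    `|f (x + s *: v + s *: u) - f (x + s *: u) - (f (x + s *: v) - f x)
      - s ^+ 2 * 'D_v (fun y => 'D_u f y) x| <= e * s ^+ 2.
Proof.
move=> oU Ux cf e0.
have dfu : differentiable (fun y => 'D_u f y) x by exact: (Ck_diff (Ck_derive cf u) Ux).
(* All points used lie within s K of x. Each of the two first-order expansions costs e' s K, and e'
   = e / (2 K) makes the total e s. *)
pose K := 1 + `|u| + `|v|.
have K0 : 0 < K by rewrite /K -addrA ltr_pwDl // addr_ge0.
pose e' := e / (2 * K).
have e'0 : 0 < e' by rewrite divr_gt0 // mulr_gt0.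
have U0 : \forall h \near (0 : V), U (h + x).
  by apply: near_shift0; exact: open_nbhs_nbhs.
have [d /= d0 dP] : exists2 d : R, 0 < d & forall h : V, `|h| < d ->
    U (h + x) /\ `|'D_u f (h + x) - 'D_u f x - 'd (fun y => 'D_u f y) x h| <= e' * `|h|.
  by have [d d0 dP] := near0_norm (filterI U0 (diff_eps dfu e'0)); exists d.
exists (d / K) => [|s /andP[s0 sd]]; first by rewrite divr_gt0.
rewrite ltr_pdivlMr // in sd.
have hs (a b : R) : 0 <= a <= s -> 0 <= b <= s -> `|a *: v + b *: u| <= s * K.
  move=> /andP[a0 als] /andP[b0 bs].
  rewrite (le_trans (ler_normD _ _)) // !normrZ !ger0_norm //.
  rewrite /K !mulrDr mulr1 -addrA [X in _ <= s + X]addrC.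
  rewrite -[X in X <= _]add0r; apply: lerD; first exact: ltW.
  by apply: lerD; apply: ler_wpM2r.
have hd a b (ha : 0 <= a <= s) (hb : 0 <= b <= s) : `|a *: v + b *: u| < d.
  exact: le_lt_trans (hs _ _ ha hb) sd.
have s00 : 0 <= s <= s by rewrite lexx ltW.
have z0 : (0 : R) <= 0 <= s by rewrite lexx ltW.
have UU a b : 0 <= a <= s -> 0 <= b <= s -> U (x + a *: v + b *: u).
  by move=> ha hb; rewrite -addrA addrC; apply: (dP _ (hd _ _ ha hb)).1.
pose g t := f (x + s *: v + t *: u) - f (x + t *: u).
pose dg t := 'D_u f (x + s *: v + t *: u) - 'D_u f (x + t *: u).
have gd t : 0 <= t <= s -> is_derive t 1 g (dg t).
  move=> ht; apply: is_deriveB; apply: is_derive_line; apply: (Ck_diff cf).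
    exact: UU.
  by have := UU 0 t z0 ht; rewrite scale0r addr0.
have cg : {within `[0, s], continuous g}.
  apply: derivable_within_continuous => t; rewrite in_itv /= => ht.
  by apply: ex_derive; exact: gd.
have gd' t : t \in `]0, s[ -> is_derive t 1 g (dg t).
  by rewrite in_itv /= => /andP[t0 ts]; apply: gd; rewrite !ltW.
have [c] := MVT s0 gd' cg.
rewrite in_itv /= => /andP[c0 cs] E.
have hc : 0 <= c <= s by rewrite !ltW.
have -> : f (x + s *: v + s *: u) - f (x + s *: u) - (f (x + s *: v) - f x) = g s - g 0.
  by rewrite /g scale0r !addr0.
rewrite E subr0.
have r1 := (dP _ (hd _ _ s00 hc)).2; have r2 := (dP _ (hd _ _ z0 hc)).2.
rewrite scale0r add0r in r2.
rewrite (addrC (s *: v + c *: u) x) addrA in r1; rewrite (addrC (c *: u) x) in r2.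
set L := 'd _ x in r1 r2.
have Lv : L (s *: v + c *: u) - L (c *: u) = s *: 'D_v (fun y => 'D_u f y) x.
  by rewrite linearD addrK linearZ /= deriveE.
have := le_trans (ler_normB _ _) (lerD r1 r2).
have -> : 'D_u f (x + s *: v + c *: u) - 'D_u f x - L (s *: v + c *: u) -
  ('D_u f (x + c *: u) - 'D_u f x - L (c *: u)) =
   dg c - s * 'D_v (fun y => 'D_u f y) x.
  by rewrite -[s * _]Lv /dg; ring.
move=> H; rewrite [dg c * s]mulrC expr2 -mulrA -mulrBr normrM (ger0_norm (ltW s0)).
rewrite [e * _]mulrCA ler_pM2l // (le_trans H) //.
have h1 := hs _ _ s00 hc; have := hs _ _ z0 hc; rewrite scale0r add0r => h2.
rewrite -mulrDr (le_trans (ler_wpM2l (ltW e'0) (lerD h1 h2))) //.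
rewrite le_eqVlt; apply/orP; left; apply/eqP; rewrite /e'; field.
by rewrite gt_eqF.
Qed.

(** Both mixed derivatives approximate the same second difference, which is symmetric in [u] and
    [v]. *)
Lemma derive_sym (R : realType) (V : normedModType R) (U : set V) (f : V -> R) x u v :
  open U -> Ck 1 U f -> U x ->
  'D_v (fun y => 'D_u f y) x = 'D_u (fun y => 'D_v f y) x.
Proof.
move=> oU cf Ux; apply/eqP; rewrite -subr_eq0 -normr_le0; apply/ler_addgt0Pl => e e0.
rewrite addr0.
have e20 : 0 < e / 4 by rewrite divr_gt0.
have [d1 d10 h1] := second_difference u v oU Ux cf e20.
have [d2 d20 h2] := second_difference v u oU Ux cf e20.
pose s := Num.min d1 d2 / 2.
have m0 : 0 < Num.min d1 d2 by rewrite lt_min d10.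
have s0 : 0 < s by rewrite divr_gt0.
have [sd1 sd2] : s < d1 /\ s < d2.
  have : s < Num.min d1 d2 by rewrite /s ltr_pdivrMr // mulr_natr mulr2n ltrDl.
  by rewrite lt_min => /andP.
have {}h1 : _ := h1 s; rewrite s0 sd1 in h1; have {}h1 := h1 isT.
have {}h2 : _ := h2 s; rewrite s0 sd2 in h2; have {}h2 := h2 isT.
rewrite -(@ler_pM2r _ (s ^+ 2)) ?exprn_gt0 //.
rewrite -[s ^+ 2 in X in X <= _]ger0_norm ?exprn_ge0 ?ltW // -normrM mulrBl.
move: h1 h2; rewrite [x + s *: u + s *: v]addrAC.
set A := f _; set B := f _; set C := f _; set D := f _ => h1 h2.
set a := 'D_v _ _ in h1 *; set b := 'D_u _ _ in h2 *.
have -> : a * s ^+ 2 - b * s ^+ 2 =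
   (A - C - (B - D) - s ^+ 2 * b) - (A - B - (C - D) - s ^+ 2 * a) by ring.
apply: le_lt_trans (ler_normB _ _) _; apply: le_lt_trans (lerD h2 h1) _.
rewrite -mulrDl ltr_pM2r ?exprn_gt0 //.
by clear -e0; lra.
Qed.

Lemma smooth_continuous (R : realType) (V W : normedModType R) (U : set V) (f : V -> W) x :
  smooth_on U f -> U x -> {for x, continuous f}.
Proof. by move=> sf Ux; apply: differentiable_continuous; apply: smooth_differentiable sf Ux. Qed.

Lemma smooth_coord (R : realType) m (U : set 'rV[R]_m) i j :
  smooth_on U (fun x : 'rV[R]_m => x i j).
Proof.
apply: (@smooth_subset _ _ _ setT) => //; apply: smooth_entry; first exact: openT.
exact: smooth_id.
Qed.

Lemma smooth_dot (R : realType) (V : normedModType R) m (U : set V) (f g : V -> 'rV[R]_m) :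
  open U -> smooth_on U f -> smooth_on U g -> smooth_on U (fun x => dot (f x) (g x)).
Proof.
by move=> oU sf sg; apply: smooth_sum => // i; apply: smoothM => //; apply: smooth_entry.
Qed.

Lemma smooth_mulmxr (R : realType) (V : normedModType R) m n p (U : set V)
    (f : V -> 'M[R]_(m, n)) (A : 'M[R]_(n, p)) :
  open U -> smooth_on U f -> smooth_on U (fun x => f x *m A).
Proof.
move=> oU sf; apply: smooth_mx => // i j.
rewrite (_ : (fun x => _) = fun x => \sum_k f x i k * A k j).
  apply: smooth_sum => // k; apply: smoothM => //; first exact: smooth_entry.
  exact: smooth_cst.
by apply/funext => x; rewrite mxE.
Qed.

Lemma smooth_prod (R : realType) (V : normedModType R) (U : set V) (I : Type) (r : seq I)
    (f : I -> V -> R) :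
  open U -> (forall i, smooth_on U (f i)) -> smooth_on U (fun x => \prod_(i <- r) f i x).
Proof.
move=> oU cf; elim: r => [|i r IH].
  rewrite (_ : (fun x => _) = fun _ => 1); first exact: smooth_cst.
  by apply/funext => x; rewrite big_nil.
rewrite (_ : (fun x => _) = fun x => f i x * \prod_(i <- r) f i x); first exact: smoothM.
by apply/funext => x; rewrite big_cons.
Qed.

Lemma smooth_det (R : realType) (V : normedModType R) m (U : set V) (A : V -> 'M[R]_m) :
  open U -> (forall i j, smooth_on U (fun x => A x i j)) -> smooth_on U (fun x => \det (A x)).
Proof.
move=> oU sA; rewrite /determinant.
apply: smooth_sum => // s; apply: smoothM => //; first exact: smooth_cst.
exact: smooth_prod.
Qed.

Lemma smooth_invmx (R : realType) (V : normedModType R) m (U : set V) (A : V -> 'M[R]_m) :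
  open U -> (forall x, U x -> A x \in unitmx) -> (forall i j, smooth_on U (fun x => A x i j)) ->
  forall i j, smooth_on U (fun x => invmx (A x) i j).
Proof.
move=> oU uA sA i j.
have : smooth_on U (fun x => (\det (A x))^-1 * ((-1) ^+ (j + i) * \det (row' j (col' i (A x))))).
  apply: smoothM => //.
    apply: smooth_inv => //; last exact: smooth_det.
    by move=> x /uA; rewrite unitmxE unitfE.
  apply: smoothM => //; first exact: smooth_cst.
  apply: smooth_det => // k l.
  rewrite (_ : (fun x => _) = fun x => A x (lift j k) (lift i l)) //.
  by apply/funext => x; rewrite !mxE.
by apply: smooth_eq => // x /uA uAx; rewrite /invmx uAx !mxE.
Qed.

Lemma compact_normball (R : realType) n (a : 'rV[R]_n) (r : R) :
  compact [set x : 'rV[R]_n | `|x - a| <= r].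
Proof.
apply: bounded_closed_compact.
  exists (r + `|a|); split; first exact: num_real.
  move=> M rM x /= xr; rewrite (le_trans _ (ltW rM)) //.
  by rewrite -[x](subrK a) (le_trans (ler_normD _ _)) // lerD2r.
have -> : [set x : 'rV[R]_n | `|x - a| <= r] = (fun x : 'rV[R]_n => `|x - a|) @^-1` [set t | t <= r] by [].
apply: preimage_closed; last exact: closed_le.
move=> x _; apply: continuous_comp; last exact: norm_continuous.
by apply: differentiable_continuous; apply: differentiableB => //; exact: differentiable_cst.
Qed.

Lemma compact_normsphere (R : realType) n (a : 'rV[R]_n) (r : R) :
  compact [set x : 'rV[R]_n | `|x - a| = r].
Proof.
apply: (@subclosed_compact _ _ _ _ (@compact_normball R n a r)); last first.
  by move=> x /= ->.
have -> : [set x : 'rV[R]_n | `|x - a| = r] = (fun x : 'rV[R]_n => `|x - a|) @^-1` [set t | t = r] by [].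
apply: preimage_closed; last exact: closed_eq.
move=> x _; apply: continuous_comp; last exact: norm_continuous.
by apply: differentiable_continuous; apply: differentiableB => //; exact: differentiable_cst.
Qed.

Lemma dot_ge0 (R : realType) n (x : 'rV[R]_n) : 0 <= dot x x.
Proof. by apply: sumr_ge0 => i _; rewrite -expr2 sqr_ge0. Qed.

Lemma dot_eq0 (R : realType) n (x : 'rV[R]_n) : dot x x = 0 -> x = 0.
Proof.
move=> /eqP; rewrite psumr_eq0 => [/allP h|i _]; last by rewrite -expr2 sqr_ge0.
apply/rowP => i; rewrite mxE; apply/eqP.
by have := h i (mem_index_enum i); rewrite /= mulf_eq0 orbb.
Qed.

Lemma dotC (R : realType) n (x y : 'rV[R]_n) : dot x y = dot y x.
Proof. by apply: eq_bigr => i _; rewrite mulrC. Qed.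

Lemma dotDl (R : realType) n (x y z : 'rV[R]_n) : dot (x + y) z = dot x z + dot y z.
Proof. by rewrite /dot -big_split; apply: eq_bigr => i _; rewrite mxE mulrDl. Qed.

Lemma dotZl (R : realType) n a (x z : 'rV[R]_n) : dot (a *: x) z = a * dot x z.
Proof. by rewrite /dot mulr_sumr; apply: eq_bigr => i _; rewrite mxE mulrA. Qed.

Lemma dotDr (R : realType) n (x y z : 'rV[R]_n) : dot z (x + y) = dot z x + dot z y.
Proof. by rewrite dotC dotDl !(dotC z). Qed.

Lemma dotZr (R : realType) n a (x z : 'rV[R]_n) : dot z (a *: x) = a * dot z x.
Proof. by rewrite dotC dotZl (dotC z). Qed.

Lemma dotNl (R : realType) n (x z : 'rV[R]_n) : dot (- x) z = - dot x z.
Proof. by rewrite -scaleN1r dotZl mulN1r. Qed.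

Lemma dotNr (R : realType) n (x z : 'rV[R]_n) : dot z (- x) = - dot z x.
Proof. by rewrite dotC dotNl (dotC z). Qed.

(** Serves as a triangle inequality for squared distances, without square roots. *)
Lemma dot_parallelogram (R : realType) n (x y : 'rV[R]_n) :
  dot (x + y) (x + y) <= 2 * dot x x + 2 * dot y y.
Proof.
have := dot_ge0 (x - y); rewrite !dotDl !dotDr !dotNl !dotNr (dotC y x) => h.
by rewrite -subr_ge0; move: h; congr (_ <= _); ring.
Qed.

Lemma derive_dot (R : realType) (V : normedModType R) m (f g : V -> 'rV[R]_m) x v :
  differentiable f x -> differentiable g x ->
  differentiable (fun x => dot (f x) (g x)) x /\
  'D_v (fun x => dot (f x) (g x)) x = dot ('D_v f x) (g x) + dot (f x) ('D_v g x).
Proof.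
move=> df dg; have e : (fun x => dot (f x) (g x)) = \sum_i (fun x => f x 0 i * g x 0 i).
  by apply/funext => y; rewrite fct_sumE.
have de i : differentiable (fun x => f x 0 i * g x 0 i) x.
  by apply: differentiableM; exact: differentiable_entry.
rewrite e; split; first exact: differentiable_sum.
rewrite derive_sum => [|i]; last exact: diff_derivable.
rewrite /dot -big_split; apply: eq_bigr => i _ /=.
have [d1 d2] : derivable (fun x => f x 0 i) x v /\ derivable (fun x => g x 0 i) x v.
  by split; apply: diff_derivable; exact: differentiable_entry.
rewrite (deriveM d1 d2) (derive_entry 0 i v df) (derive_entry 0 i v dg) addrC.
by congr (_ + _); rewrite [LHS]mulrC.
Qed.

Lemma derive_mulmx_jacobian (R : realType) n m (F : 'rV[R]_n -> 'rV[R]_m) x v :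
  differentiable F x -> 'D_v F x = v *m jacobian F x.
Proof. exact: deriveEjacobian. Qed.

Lemma jacobian_entry (R : realType) n m (F : 'rV[R]_n -> 'rV[R]_m) x i j :
  differentiable F x -> jacobian F x i j = 'D_(delta_mx 0 i) F x 0 j.
Proof. by move=> dF; rewrite (derive_mulmx_jacobian (delta_mx 0 i) dF) -rowE [RHS]mxE. Qed.

Lemma jacobian_unit (R : realType) n (F : 'rV[R]_n -> 'rV[R]_n) x :
  differentiable F x -> (forall v, 'D_v F x = 0 -> v = 0) -> jacobian F x \in unitmx.
Proof.
move=> dF inj; rewrite -row_free_unit; apply: inj_row_free => v.
by rewrite -derive_mulmx_jacobian //; exact: inj.
Qed.

Lemma nbhs_ball_norm (R : realType) (V : normedModType R) (U : set V) a :
  open U -> U a -> exists2 r : R, 0 < r & forall x, `|x - a| < r -> U x.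
Proof.
move=> oU Ua; have /nbhs_ballP[r /= r0 h] : nbhs a U by exact: open_nbhs_nbhs.
by exists r => // x xr; apply: h; rewrite -ball_normE /= distrC.
Qed.

Lemma open_of_ball (R : realType) (V : normedModType R) (U : set V) :
  (forall a, U a -> exists2 r : R, 0 < r & forall x, `|x - a| < r -> U x) -> open U.
Proof.
move=> h; rewrite openE => a /h[r r0 hr]; apply/nbhs_ballP; exists r => //= x.
by rewrite -ball_normE /= distrC => /hr.
Qed.

(* Minimise |F - y|^2 on a small closed ball: the minimum is interior because
   F is injective, and there the surjectivity of dF forces F = y. *)
Lemma open_image (R : realType) n (U : set 'rV[R]_n) (F : 'rV[R]_n -> 'rV[R]_n) :
  open U -> smooth_on U F -> {in U &, injective F} ->
  (forall y v, U y -> 'D_v F y = 0 -> v = 0) -> open (F @` U).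
Proof.
move=> oU sF injF dF; rewrite openE => _ [a Ua <-].
have [r0 r00 rU0] := nbhs_ball_norm oU Ua.
pose r := r0 / 2; have r0' : 0 < r by rewrite divr_gt0.
have rU x : `|x - a| <= r -> U x.
  by move=> xr; apply: rU0; rewrite (le_lt_trans xr) // /r ltr_pdivrMr // mulr_natr mulr2n ltrDl.
pose q y x := dot (F x - y) (F x - y).
have dq y x : U x -> forall v, differentiable (q y) x /\ 'D_v (q y) x = 2 * dot ('D_v F x) (F x - y).
  move=> Ux v; have df : differentiable F x by exact: smooth_differentiable sF Ux.
  have dfy : differentiable (fun x => F x - y) x.
    by apply: differentiableB => //; exact: differentiable_cst.
  have [? ->] := derive_dot v dfy dfy; split=> //.
  have -> : 'D_v (fun x => F x - y) x = 'D_v F x.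
    rewrite deriveB; [|exact: diff_derivable|exact: derivable_cst].
    by rewrite derive_cst subr0.
  by rewrite [X in _ + X]dotC mulr_natl mulr2n.
have cq y x : U x -> {for x, continuous (q y)}.
  by move=> Ux; apply: differentiable_continuous; exact: (dq y x Ux 0).1.
have [eps eps0 hS] : exists2 eps : R, 0 < eps & forall x, `|x - a| = r -> eps <= q (F a) x.
  (* In dimension 0 the sphere of radius r is empty and any [eps] will do. *)
  have [S0|S0] := pselect ([set x : 'rV[R]_n | `|x - a| = r] !=set0); last first.
    by exists 1 => // x xr; case: S0; exists x.
  have [|m mS hm] := @EVT_min_rV R n (q (F a)) _ S0 (@compact_normsphere R n a r).
    by apply: continuous_in_subspaceT => x; rewrite inE /= => xr; apply: cq; apply: rU; rewrite xr.
  exists (q (F a) m) => [|x xr]; last by apply: hm; rewrite inE.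
  rewrite inE /= in mS; rewrite lt_neqAle dot_ge0 andbT eq_sym.
  apply/eqP => /dot_eq0 /subr0_eq /injF; rewrite !inE => /(_ (rU _ _) Ua).
  rewrite mS lexx => /(_ isT) ma; move: mS; rewrite ma subrr normr0 => rE.
  by rewrite -rE ltxx in r0'.
(* For such y the value of [q y] at the centre [a] is below eps / 4. At a point of the sphere a
   value below eps / 4 would give eps <= 2 (eps / 4) + 2 (eps / 4) with a strict inequality, by
   [dot_parallelogram]; so the minimum over the ball is interior. *)
have nb : \forall y \near F a, dot (F a - y) (F a - y) < eps / 4.
  have cd : (fun y => dot (F a - y) (F a - y)) @ F a --> dot (F a - F a) (F a - F a).
    apply: (@smooth_continuous _ _ _ setT (fun y => dot (F a - y) (F a - y))) => //.
    have sd : smooth_on setT (fun y : 'rV[R]_n => F a - y).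
      apply: smoothD; [exact: openT|exact: smooth_cst|].
      apply: smooth_mx => [|i j]; first exact: openT.
      have -> : (fun x : 'rV[R]_n => (- x) i j) = fun x => - x i j by apply/funext => x; rewrite mxE.
      by apply: smoothN; [exact: openT|exact: smooth_coord].
    by apply: smooth_dot => //; exact: openT.
  apply: (cvgr_lt _ cd); rewrite subrr /dot big1 ?divr_gt0 // => i _.
  by rewrite mxE mul0r.
apply: filterS nb => y hy.
have B0 : [set x : 'rV[R]_n | `|x - a| <= r] !=set0 by exists a; rewrite /= subrr normr0 ltW.
have [|m mB hm] := @EVT_min_rV R n (q y) _ B0 (@compact_normball R n a r).
  by apply: continuous_in_subspaceT => x; rewrite inE /= => xr; apply: cq; exact: rU.
rewrite inE /= in mB; have Um := rU _ mB.
have mr : `|m - a| < r.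
  rewrite lt_neqAle mB andbT; apply/eqP => mS.
  have h1 := hS _ mS; have h2 : q y m <= q y a by apply: hm; rewrite inE /= subrr normr0 ltW.
  have := dot_parallelogram (F m - y) (- (F a - y)).
  rewrite dotNl dotNr opprK opprB addrA subrK -/(q (F a) m) -/(q y m) => h3.
  have h4 : q y m < eps / 4 by exact: le_lt_trans h2 hy.
  move: h1 h3 h4 hy eps0; clear; lra.
exists m => //; apply: subr0_eq; apply: dot_eq0.
have dFm : differentiable F m by exact: smooth_differentiable sF Um.
have uJ : jacobian F m \in unitmx by apply: jacobian_unit => // v; exact: dF.
(* The Newton direction: along it the derivative of [q y] at m equals 2 |F m - y|^2, and it must
   vanish at an interior minimum. *)
pose v := (F m - y) *m invmx (jacobian F m).
have vE : 'D_v F m = F m - y by rewrite derive_mulmx_jacobian // /v mulmxKV.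
suff : 'D_v (q y) m = 0.
  rewrite (dq y m Um v).2 vE => /eqP; rewrite mulf_eq0 pnatr_eq0 /= => /eqP; exact.
pose K := `|v| + 1; have K0 : 0 < K by rewrite ltr_wpDl.
pose d := (r - `|m - a|) / K.
have d0 : 0 < d by rewrite divr_gt0 // subr_gt0.
have inB s : s \in `]-d, d[ -> `|m + s *: v - a| <= r.
  rewrite in_itv /= -ltr_norml => sd.
  rewrite addrAC (le_trans (ler_normD _ _)) // -lerBrDl normrZ.
  rewrite (@le_trans _ _ (`|s| * K)) // ?ler_wpM2l ?lerDl //.
  by rewrite -ler_pdivlMr // ltW.
have dline s : `|m + s *: v - a| <= r ->
    is_derive s 1 (fun s => q y (m + s *: v)) ('D_v (q y) (m + s *: v)).
  by move=> /rU Us; apply: is_derive_line; exact: (dq y _ Us 0).1.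
have d0' : - d < d by rewrite gtrN.
have h0 : 0 \in `]-d, d[ by rewrite in_itv /= oppr_lt0 d0.
have := @derive1_at_min _ (fun s => q y (m + s *: v)) (-d) d 0 (ltW d0') _ h0 _.
case.
- by move=> s /inB /dline ?; apply: ex_derive.
- by move=> s /inB sB; rewrite scale0r addr0; apply: hm; rewrite inE.
move=> _ E; have D0 := dline 0; rewrite scale0r addr0 in D0.
by case: (D0 mB) => _ <-; exact: E.
Qed.

Lemma half_absorb (R : realFieldType) (x y z w t : R) :
  x <= y -> y <= 1 / 2 * t -> z <= w -> t <= x + z -> t <= 2 * w.
Proof. lra. Qed.

Section InverseFunction.
Context (R : realType) (n : nat) (U : set 'rV[R]_n) (F : 'rV[R]_n -> 'rV[R]_n).
Hypotheses (oU : open U) (sF : smooth_on U F) (injF : {in U &, injective F})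
  (dF : forall y v, U y -> 'D_v F y = 0 -> v = 0).

Let J x := jacobian F x.

Let dFx x (Ux : U x) : differentiable F x := smooth_differentiable sF Ux.

Let uJ x (Ux : U x) : J x \in unitmx.
Proof. by apply: jacobian_unit => [|v]; [exact: dFx|exact: dF]. Qed.

Let Fi (y : 'rV[R]_n) : 'rV[R]_n := xget 0 [set x | U x /\ F x = y].

Let FiK x : U x -> Fi (F x) = x.
Proof.
move=> Ux; rewrite /Fi; case: xgetP => [z _ [Uz zE]|h]; last by case: (h x).
by apply: injF => //; rewrite inE.
Qed.

Let oFU : open (F @` U). Proof. exact: open_image. Qed.

(** Continuity of the inverse is openness of F on the part of U within distance e of a, again by
    [open_image]. *)
Let Fi_cont b : (F @` U) b -> forall e : R, 0 < e ->
  \forall k \near (0 : 'rV[R]_n), (F @` U) (k + b) /\ `|Fi (k + b) - Fi b| < e.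
Proof.
move=> [a Ua <-] e e0; rewrite FiK //.
pose B := U `&` [set x | `|x - a| < e].
have oB : open B.
  apply: openI => //.
  apply: open_of_ball => x /= xa; exists (e - `|x - a|); first by rewrite subr_gt0.
  move=> y yx; rewrite -(subrK x y) -addrA (le_lt_trans (ler_normD _ _)) //.
  by rewrite -ltrBrDr.
have oFB : open (F @` B).
  apply: open_image => //.
  - by apply: smooth_subset sF => x [].
  - by move=> x y /[!inE] -[Ux _] [Uy _]; apply: injF; rewrite inE.
  - by move=> y v [Uy _]; exact: dF.
have : nbhs (F a) (F @` B).
  apply: open_nbhs_nbhs; split => //; exists a => //; split => //=.
  by rewrite subrr normr0.
move=> /near_shift0; apply: filterS => k [x [Ux xe] xE].
by rewrite -xE FiK //; split => //; exists x.
Qed.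

Let Fi_diff b v : (F @` U) b ->
  differentiable Fi b /\ 'D_v Fi b = v *m invmx (J (Fi b)).
Proof.
move=> Fb; have [a Ua aE] := Fb; have bE : Fi b = a by rewrite -aE FiK.
rewrite bE; pose Ji := invmx (J a).
have cmul (A : 'M[R]_n) : continuous (mulmxr A : 'rV[R]_n -> 'rV[R]_n).
  move=> x; apply: (@smooth_continuous _ _ _ setT) => //.
  by apply: smooth_mulmxr; [exact: openT|exact: smooth_id].
have [C C0 hC] : exists2 C : R, 0 < C & forall x : 'rV[R]_n, `|x *m Ji| <= C * `|x|.
  by have [C C0 h] := linear_lipschitz (cmul Ji); exists C.
have [] := @diff_of_eps _ _ _ Fi (mulmxr Ji : {linear 'rV[R]_n -> 'rV[R]_n}) b (cmul _).
  move=> e e0.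
  (* The first bound gives C eta <= 1/2, which lets the remainder be absorbed to yield |h| <= 2 C
     |k|. The second gives C eta (2 C) <= e, the final error. *)
  pose eta := Num.min (1 / (2 * C)) (e / (2 * C * C)).
  have eta0 : 0 < eta by rewrite lt_min !divr_gt0 ?mulr_gt0.
  have [d d0 hd] := near0_norm (diff_eps (dFx Ua) eta0).
  apply: filterS (Fi_cont Fb d0) => k [[x Ux xE]]; rewrite bE -xE FiK // => xd.
  pose h := x - a; have hE : h + a = x by rewrite subrK.
  have := hd h xd; rewrite hE -deriveE; last exact: dFx.
  rewrite derive_mulmx_jacobian; last exact: dFx.
  have -> : F x - F a = k by rewrite xE aE addrK.
  rewrite -/(J a) /=; set r := k - h *m J a => hr.
  have hr' : h - k *m Ji = - (r *m Ji).
    by rewrite /r mulmxBl opprB mulmxK // uJ.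
  rewrite hr' normrN.
  have h1 : `|r *m Ji| <= C * eta * `|h|.
    by rewrite (le_trans (hC _)) // -mulrA ler_wpM2l // ltW.
  have Ceta : C * eta <= 1 / 2.
    rewrite (@le_trans _ _ (C * (1 / (2 * C)))) //.
      by apply: (ler_wpM2l (ltW C0)); rewrite ge_min lexx.
    by rewrite le_eqVlt; apply/orP; left; apply/eqP; field; rewrite gt_eqF.
  have Ceta' : C * eta * (2 * C) <= e.
    rewrite mulrAC (@le_trans _ _ (C * (2 * C) * (e / (2 * C * C)))) //.
      apply: ler_wpM2l; last by rewrite ge_min lexx orbT.
      by rewrite !mulr_ge0 // ltW.
    by rewrite le_eqVlt; apply/orP; left; apply/eqP; field; rewrite gt_eqF.
  have h2 : `|h| <= 2 * C * `|k|.
    have := ler_normD (h - k *m Ji) (k *m Ji); rewrite subrK hr' normrN.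
    have h3 : C * eta * `|h| <= 1 / 2 * `|h| by rewrite ler_wpM2r.
    by rewrite -mulrA; exact: half_absorb h1 h3 (hC k).
  apply: (le_trans h1); apply: (@le_trans _ _ (C * eta * (2 * C * `|k|))).
    by rewrite ler_wpM2l // mulr_ge0 // ltW.
  by rewrite mulrA ler_wpM2r.
by move=> dFi E; split=> //; rewrite deriveE // E.
Qed.

(** Bootstrapping: ['D_v Fi] is the smooth map x |-> v J(x)^-1 composed with [Fi], so k derivatives
    of the inverse yield k + 1. As F is injective on all of U, the inverse lives on the whole
    image. *)
Lemma inverse_function :
  open (F @` U) /\ exists2 G : 'rV[R]_n -> 'rV[R]_n,
    (forall x, U x -> G (F x) = x) & smooth_on (F @` U) G.
Proof.
split => //; exists Fi => //.
have sJ i j : smooth_on U (fun x => J x i j).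
  have := smooth_entry 0 j oU (smooth_derive (delta_mx 0 i) sF).
  by apply: smooth_eq => // x Ux; rewrite /J jacobian_entry //; exact: dFx.
have sK v : smooth_on U (fun x => v *m invmx (J x)).
  apply: smooth_mx => // i j.
  rewrite (_ : (fun x => _) = fun x => \sum_k v i k * invmx (J x) k j); last first.
    by apply/funext => x; rewrite mxE.
  apply: smooth_sum => // k; apply: smoothM => //; first exact: smooth_cst.
  exact: smooth_invmx.
apply/smooth_onP; elim=> [|k IH].
  by split=> // b Fb; exact: (Fi_diff 0 Fb).1.
split=> [b Fb|v]; first exact: (Fi_diff 0 Fb).1.
have cK : Ck k U (fun x => v *m invmx (J x)) by move: k {IH}; apply/smooth_onP.
have FiU b : (F @` U) b -> U (Fi b) by move=> [x Ux <-]; rewrite FiK.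
apply: (Ck_eq oFU _ (Ck_comp_mx oFU oU FiU IH cK)) => b Fb.
by rewrite (Fi_diff v Fb).2.
Qed.

End InverseFunction.

(** * Minkowski vectors *)

Lemma differentiable_mx (R : realType) (V : normedModType R) m n (f : V -> 'M[R]_(m, n)) x :
  (forall i j, differentiable (fun x => f x i j) x) -> differentiable f x.
Proof.
move=> df.
have -> : f = \sum_i \sum_j (fun x => f x i j *: delta_mx i j).
  apply/funext => y; rewrite [LHS]matrix_sum_delta fct_sumE.
  by apply: eq_bigr => i _; rewrite fct_sumE.
apply: differentiable_sum => i; apply: differentiable_sum => j.
exact: differentiableZl.
Qed.

Lemma derive_mx_eq (R : realType) (V : normedModType R) m n (f : V -> 'M[R]_(m, n)) x v
    (A : 'M[R]_(m, n)) :
  (forall i j, differentiable (fun x => f x i j) x /\ 'D_v (fun x => f x i j) x = A i j) ->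
  differentiable f x /\ 'D_v f x = A.
Proof.
move=> df; have d : differentiable f x by apply: differentiable_mx => i j; exact: (df i j).1.
split=> //; apply/matrixP => i j; rewrite -derive_entry //; exact: (df i j).2.
Qed.

Lemma derive_mulf (R : realType) (V : normedModType R) (a b : V -> R) x v :
  differentiable a x -> differentiable b x ->
  differentiable (fun x => a x * b x) x /\
  'D_v (fun x => a x * b x) x = 'D_v a x * b x + a x * 'D_v b x.
Proof.
move=> da db; split; first exact: differentiableM.
rewrite deriveM; [|exact: diff_derivable..].
by rewrite addrC [X in X + _]mulrC.
Qed.

Lemma derive_scale (R : realType) (V : normedModType R) m n (a : V -> R)
    (f : V -> 'M[R]_(m, n)) x v :
  differentiable a x -> differentiable f x ->
  differentiable (fun x => a x *: f x) x /\
  'D_v (fun x => a x *: f x) x = 'D_v a x *: f x + a x *: 'D_v f x.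
Proof.
move=> da df; apply: derive_mx_eq => i j.
rewrite (_ : (fun x => _) = fun x => a x * f x i j); last by apply/funext => y; rewrite mxE.
have [? ->] := derive_mulf v da (differentiable_entry i j df).
by split=> //; rewrite derive_entry // !mxE.
Qed.

Lemma derive_addf (R : realType) (V W : normedModType R) (a b : V -> W) x v :
  differentiable a x -> differentiable b x ->
  differentiable (fun x => a x + b x) x /\
  'D_v (fun x => a x + b x) x = 'D_v a x + 'D_v b x.
Proof.
move=> da db; split; first exact: differentiableD.
by rewrite deriveD //; exact: diff_derivable.
Qed.

Lemma smooth_scale (R : realType) (V : normedModType R) m n (U : set V) (a : V -> R)
    (f : V -> 'M[R]_(m, n)) :
  open U -> smooth_on U a -> smooth_on U f -> smooth_on U (fun x => a x *: f x).
Proof.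
move=> oU sa sf; apply: smooth_mx => // i j.
rewrite (_ : (fun x => _) = fun x => a x * f x i j); last by apply/funext => y; rewrite mxE.
by apply: smoothM => //; exact: smooth_entry.
Qed.

Lemma vecE0 (R : realType) m (a : R) (x : 'rV[R]_m) : time (vec a x) = a.
Proof. by rewrite /time /vec row_mxEl mxE mulr1n. Qed.

Lemma vecEr (R : realType) m (a : R) (x : 'rV[R]_m) : rsubmx (vec a x) = x.
Proof. exact: row_mxKr. Qed.

Lemma vec_eta (R : realType) m (u : 'rV[R]_(1 + m)) : u = vec (time u) (rsubmx u).
Proof.
rewrite -[LHS]hsubmxK /vec; congr row_mx.
by apply/rowP => i; rewrite !mxE ord1 mulr1n; congr (u _ _); apply/val_inj.
Qed.

Lemma vecD (R : realType) m (a b : R) (x y : 'rV[R]_m) : vec a x + vec b y = vec (a + b) (x + y).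
Proof. by rewrite /vec add_row_mx raddfD. Qed.

Lemma vecZ (R : realType) m (a b : R) (x : 'rV[R]_m) : a *: vec b x = vec (a * b) (a *: x).
Proof. by rewrite /vec scale_row_mx scale_scalar_mx. Qed.

Lemma dot_vec (R : realType) m (a b : R) (x y : 'rV[R]_m) :
  dot (vec a x) (vec b y) = a * b + dot x y.
Proof.
rewrite /dot big_split_ord big_ord1; congr (_ + _).
  by rewrite -[LHS]/(time (vec a x) * time (vec b y)) !vecE0.
by apply: eq_bigr => i _; rewrite /vec !row_mxEr.
Qed.

Lemma dot1 (R : realType) (x y : 'rV[R]_1) : dot x y = x 0 0 * y 0 0.
Proof. by rewrite /dot big_ord1. Qed.

Lemma lorentz_vec (R : realType) m (a b : R) (x y : 'rV[R]_m) :
  lorentz (vec a x) (vec b y) = - (a * b) + dot x y.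
Proof. by rewrite /lorentz /vec !row_mxKl !row_mxKr dot1 !mxE !mulr1n. Qed.

Lemma lorentzE (R : realType) m (u v : 'rV[R]_(1 + m)) :
  lorentz u v = dot u v - 2 * (time u * time v).
Proof. by rewrite [u in LHS]vec_eta [v in LHS]vec_eta lorentz_vec [u in RHS]vec_eta [v in RHS]vec_eta dot_vec !vecE0; ring. Qed.

Lemma timeD (R : realType) m (u v : 'rV[R]_(1 + m)) : time (u + v) = time u + time v.
Proof. by rewrite /time mxE. Qed.

Lemma timeZ (R : realType) m a (u : 'rV[R]_(1 + m)) : time (a *: u) = a * time u.
Proof. by rewrite /time mxE. Qed.

Lemma lorentzC (R : realType) m (u v : 'rV[R]_(1 + m)) : lorentz u v = lorentz v u.
Proof. by rewrite /lorentz dotC [X in _ + X]dotC. Qed.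

Lemma lorentzDl (R : realType) m (u v w : 'rV[R]_(1 + m)) :
  lorentz (u + v) w = lorentz u w + lorentz v w.
Proof. by rewrite !lorentzE dotDl timeD; ring. Qed.

Lemma lorentzZl (R : realType) m a (u w : 'rV[R]_(1 + m)) :
  lorentz (a *: u) w = a * lorentz u w.
Proof. by rewrite !lorentzE dotZl timeZ; ring. Qed.

Lemma lorentzDr (R : realType) m (u v w : 'rV[R]_(1 + m)) :
  lorentz w (u + v) = lorentz w u + lorentz w v.
Proof. by rewrite lorentzC lorentzDl !(lorentzC w). Qed.

Lemma lorentzZr (R : realType) m a (u w : 'rV[R]_(1 + m)) :
  lorentz w (a *: u) = a * lorentz w u.
Proof. by rewrite lorentzC lorentzZl (lorentzC w). Qed.

Lemma lorentz0l (R : realType) m (w : 'rV[R]_(1 + m)) : lorentz 0 w = 0.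
Proof. by rewrite -[X in lorentz X](scale0r w) lorentzZl mul0r. Qed.

Lemma lorentzNl (R : realType) m (u w : 'rV[R]_(1 + m)) : lorentz (- u) w = - lorentz u w.
Proof. by rewrite -scaleN1r lorentzZl mulN1r. Qed.

Lemma lorentzNr (R : realType) m (u w : 'rV[R]_(1 + m)) : lorentz w (- u) = - lorentz w u.
Proof. by rewrite lorentzC lorentzNl lorentzC. Qed.

Definition lorentz_lin := (lorentzDl, lorentzDr, lorentzZl, lorentzZr).

Lemma derive_lorentz (R : realType) (V : normedModType R) m (f g : V -> 'rV[R]_(1 + m)) x v :
  differentiable f x -> differentiable g x ->
  differentiable (fun x => lorentz (f x) (g x)) x /\
  'D_v (fun x => lorentz (f x) (g x)) x = lorentz ('D_v f x) (g x) + lorentz (f x) ('D_v g x).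
Proof.
move=> df dg; have -> : (fun x => lorentz (f x) (g x)) =
    fun x => dot (f x) (g x) + (-2) * (f x 0 (lshift m 0) * g x 0 (lshift m 0)).
  by apply/funext => y; rewrite lorentzE /time; ring.
have dfi := differentiable_entry 0 (lshift m 0) df.
have dgi := differentiable_entry 0 (lshift m 0) dg.
have [d1 e1] := derive_dot v df dg.
have [d2 e2] := derive_mulf v dfi dgi.
have d0 : differentiable (fun _ : V => -2 : R) x by exact: differentiable_cst.
have [d3 e3] := derive_mulf v d0 d2.
have [d4 ->] := derive_addf v d1 d3; split=> //.
rewrite e1 e3 derive_cst e2 !derive_entry // !lorentzE /time; ring.
Qed.

Lemma smooth_vec (R : realType) (V : normedModType R) m (U : set V) (a : V -> R)
    (f : V -> 'rV[R]_m) :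
  open U -> smooth_on U a -> smooth_on U f -> smooth_on U (fun x => vec (a x) (f x)).
Proof.
move=> oU sa sf; apply: smooth_mx => // i j; rewrite ord1.
case: (splitP j) => k jk.
  rewrite (_ : (fun x => _) = a) //; apply/funext => x.
  have -> : j = lshift m 0 by apply/val_inj; rewrite /= jk ord1.
  exact: vecE0.
rewrite (_ : (fun x => _) = fun x => f x 0 k); first exact: smooth_entry.
have -> : j = rshift 1 k by apply/val_inj.
by apply/funext => x; rewrite /vec row_mxEr.
Qed.

Lemma derive_vec (R : realType) (V : normedModType R) m (a : V -> R) (f : V -> 'rV[R]_m) x v :
  differentiable a x -> differentiable f x ->
  differentiable (fun x => vec (a x) (f x)) x /\
  'D_v (fun x => vec (a x) (f x)) x = vec ('D_v a x) ('D_v f x).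
Proof.
move=> da df; apply: derive_mx_eq => i j; rewrite ord1.
case: (splitP j) => k jk.
  have -> : j = lshift m 0 by apply/val_inj; rewrite /= jk ord1.
  rewrite (_ : (fun x => _) = a); last by apply/funext => y; exact: vecE0.
  by rewrite -[vec _ _ _ _]/(time (vec _ _)) vecE0.
have -> : j = rshift 1 k by apply/val_inj.
rewrite (_ : (fun x => _) = fun x => f x 0 k); last by apply/funext => y; rewrite /vec row_mxEr.
by rewrite derive_entry // /vec row_mxEr; split=> //; exact: differentiable_entry.
Qed.

Lemma smooth_rsubmx (R : realType) (V : normedModType R) m (U : set V) (f : V -> 'rV[R]_(1 + m)) :
  open U -> smooth_on U f -> smooth_on U (fun x => rsubmx (f x)).
Proof.
move=> oU sf; apply: smooth_mx => // i j.
rewrite (_ : (fun x => _) = fun x => f x i (rshift 1 j)); first exact: smooth_entry.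
by apply/funext => x; rewrite mxE.
Qed.

Lemma smooth_time (R : realType) (V : normedModType R) m (U : set V) (f : V -> 'rV[R]_(1 + m)) :
  open U -> smooth_on U f -> smooth_on U (fun x => time (f x)).
Proof. by move=> oU sf; exact: smooth_entry. Qed.

(** * Null lifts of stereographic charts *)

Lemma vec00 (R : realType) m : vec (0 : R) (0 : 'rV[R]_m) = 0.
Proof. by rewrite /vec raddf0 row_mx0. Qed.

(* stereo b pulls the round metric back to lam^2 |dy|^2. *)
Definition lam (R : realType) n (y : 'rV[R]_n) : R := 2 / (1 + dot y y).

Definition chart_sign (R : realType) (b : bool) : R := (-1) ^+ b.

(* The future null vector (1, stereo b y) / lam y, affine in y and |y|^2. *)
Definition null_lift (R : realType) n (b : bool) (y : 'rV[R]_n) : 'rV[R]_(1 + (1 + n)) :=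
  vec ((1 + dot y y) / 2) (vec (chart_sign R b * ((dot y y - 1) / 2)) y).

(** The null vector over the pole of the projection. [null_lift b] is quadratic in y, and its second
    derivative along u and v is [dot u v] times this constant vector. *)
Definition null_pole (R : realType) n (b : bool) : 'rV[R]_(1 + (1 + n)) :=
  vec 1 (vec (chart_sign R b) 0).

(** The derivative of [null_lift b] at y along v. *)
Definition null_tangent (R : realType) n (b : bool) (y v : 'rV[R]_n) : 'rV[R]_(1 + (1 + n)) :=
  vec (dot y v) (vec (chart_sign R b * dot y v) v).

Lemma chart_sign2 (R : realType) b : chart_sign R b * chart_sign R b = 1.
Proof. by rewrite /chart_sign -expr2 sqrr_sign. Qed.

Lemma lam_den (R : realType) n (y : 'rV[R]_n) : 0 < 1 + dot y y.
Proof. by rewrite ltr_wpDr // dot_ge0. Qed.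

Lemma lam_gt0 (R : realType) n (y : 'rV[R]_n) : 0 < lam y.
Proof. by rewrite divr_gt0 // lam_den. Qed.

Lemma dot0l (R : realType) n (y : 'rV[R]_n) : dot 0 y = 0.
Proof. by rewrite /dot big1 // => i _; rewrite mxE mul0r. Qed.

Lemma dot0r (R : realType) n (y : 'rV[R]_n) : dot y 0 = 0.
Proof. by rewrite dotC dot0l. Qed.

Lemma stereo_lift (R : realType) n b (y : 'rV[R]_n) :
  vec 1 (stereo b y) = lam y *: null_lift b y.
Proof.
rewrite /stereo /null_lift !vecZ /lam /chart_sign.
have h : 1 + dot y y != 0 by rewrite gt_eqF // lam_den.
by congr vec; [|congr vec]; [field|field|rewrite scalerA; congr (_ *: _); ring].
Qed.

Lemma lorentz_lift (R : realType) n b (y : 'rV[R]_n) :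
  lorentz (null_lift b y) (null_lift b y) = 0.
Proof.
rewrite /null_lift lorentz_vec dot_vec; have := chart_sign2 R b.
by set s := chart_sign R b => s2; rewrite [s * _ * (s * _)]mulrACA s2; field.
Qed.

Lemma lorentz_lift_tangent (R : realType) n b (y v : 'rV[R]_n) :
  lorentz (null_lift b y) (null_tangent b y v) = 0.
Proof.
rewrite lorentz_vec dot_vec; have := chart_sign2 R b.
by set s := chart_sign R b => s2; rewrite [s * _ * (s * _)]mulrACA s2; field.
Qed.

Lemma lorentz_tangent (R : realType) n b (y u v : 'rV[R]_n) :
  lorentz (null_tangent b y u) (null_tangent b y v) = dot u v.
Proof.
rewrite lorentz_vec dot_vec; have := chart_sign2 R b.
by set s := chart_sign R b => s2; rewrite [s * _ * (s * _)]mulrACA s2; ring.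
Qed.

(* null_lift, null_pole and the null_tangents form a null frame of R^{1,n+1}. *)
Lemma lorentz_null_frame (R : realType) n b (y : 'rV[R]_n) (u : 'rV[R]_(1 + (1 + n))) :
  lorentz u u = - 2 * lorentz u (null_pole R n b) * lorentz u (null_lift b y)
    + \sum_i lorentz u (null_tangent b y (delta_mx 0 i)) ^+ 2.
Proof.
set s := chart_sign R b; have s2 := chart_sign2 R b; rewrite -/s in s2.
set p := time u; set q := time (rsubmx u); set w := rsubmx (rsubmx u).
have uE : u = vec p (vec q w) by rewrite [LHS]vec_eta [X in vec _ X]vec_eta.
have cE i : lorentz u (null_tangent b y (delta_mx 0 i)) = w 0 i + (s * q - p) * y 0 i.
  have dy (z : 'rV[R]_n) : dot z (delta_mx 0 i) = z 0 i.
    rewrite /dot (bigD1 i) //= big1 ?addr0 => [|j ji]; rewrite mxE !eqxx /= ?mulr1 //.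
    by rewrite (negbTE ji) mulr0.
  by rewrite uE lorentz_vec dot_vec !dy -/s; ring.
have -> : \sum_i lorentz u (null_tangent b y (delta_mx 0 i)) ^+ 2 =
    dot w w + 2 * (s * q - p) * dot w y + (s * q - p) ^+ 2 * dot y y.
  rewrite /dot !mulr_sumr -!big_split; apply: eq_bigr => i _ /=.
  by rewrite cE; ring.
have -> : lorentz u (null_pole R n b) = s * q - p.
  by rewrite uE lorentz_vec dot_vec dot0r -/s; ring.
have -> : lorentz u (null_lift b y) =
    - (p * ((1 + dot y y) / 2)) + (q * (s * ((dot y y - 1) / 2)) + dot w y).
  by rewrite uE lorentz_vec dot_vec -/s.
have -> : lorentz u u = - p ^+ 2 + s * s * q ^+ 2 + dot w w.
  by rewrite uE lorentz_vec dot_vec s2; ring.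
by field.
Qed.

Lemma derive_dot_self (R : realType) n (y v : 'rV[R]_n) :
  differentiable (fun y : 'rV[R]_n => dot y y) y /\
  'D_v (fun y : 'rV[R]_n => dot y y) y = 2 * dot y v.
Proof.
have di : differentiable (fun y : 'rV[R]_n => y) y by [].
have [? ->] := derive_dot v di di; split=> //.
by rewrite (derive_id y v) dotC -mulr2n mulr_natl.
Qed.

Lemma differentiable_lin (R : realType) n (a b : R) (y v : 'rV[R]_n) (f : 'rV[R]_n -> R) :
  differentiable f y ->
  differentiable (fun y => a * f y + b) y /\ 'D_v (fun y => a * f y + b) y = a * 'D_v f y.
Proof.
move=> df.
have ca : differentiable (fun _ : 'rV[R]_n => a) y by exact: differentiable_cst.
have cb : differentiable (fun _ : 'rV[R]_n => b) y by exact: differentiable_cst.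
have [d1 e1] := derive_mulf v ca df; have [d2 ->] := derive_addf v d1 cb.
by split=> //; rewrite e1 !derive_cst mul0r add0r addr0.
Qed.

Lemma derive_lift (R : realType) n b (y v : 'rV[R]_n) :
  differentiable (null_lift b) y /\ 'D_v (null_lift b) y = null_tangent b y v.
Proof.
have [d0 e0] := derive_dot_self y v.
have [d1 e1] := differentiable_lin 2^-1 2^-1 v d0.
have [d2 e2] := differentiable_lin (chart_sign R b / 2) (- (chart_sign R b / 2)) v d0.
have di : differentiable (fun y : 'rV[R]_n => y) y by [].
have [d3 e3] := derive_vec v d2 di; have [d4 e4] := derive_vec v d1 d3.
rewrite e3 e1 e2 e0 (derive_id y v) in e4.
have -> : null_lift b = fun y : 'rV[R]_n => vec (2^-1 * dot y y + 2^-1)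
    (vec (chart_sign R b / 2 * dot y y + - (chart_sign R b / 2)) y).
  by apply/funext => z; rewrite /null_lift; congr vec; [field|congr vec; field].
by split=> //; rewrite e4 /null_tangent; congr vec; [field|congr vec; field].
Qed.

Lemma derive_tangent (R : realType) n b (y u v : 'rV[R]_n) :
  differentiable (fun y => null_tangent b y u) y /\
  'D_v (fun y => null_tangent b y u) y = dot u v *: null_pole R n b.
Proof.
have di : differentiable (fun y : 'rV[R]_n => y) y by [].
have cu : differentiable (fun _ : 'rV[R]_n => u) y by exact: differentiable_cst.
have [d0 e0] := derive_dot v di cu.
rewrite (derive_id y v) derive_cst dot0r addr0 dotC in e0.
have [d2 e2] := differentiable_lin (chart_sign R b) 0 v d0.
have [d3 e3] := derive_vec v d2 cu; have [d4 e4] := derive_vec v d0 d3.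
rewrite e3 e2 e0 derive_cst in e4.
have -> : (fun y => null_tangent b y u) = fun y : 'rV[R]_n => vec (dot y u)
    (vec (chart_sign R b * dot y u + 0) u).
  by apply/funext => z; rewrite /null_tangent addr0.
split=> //; rewrite e4 /null_pole !vecZ scaler0 mulr1; congr vec; congr vec; ring.
Qed.

Lemma smooth_lam (R : realType) n (U : set 'rV[R]_n) : open U -> smooth_on U (@lam R n).
Proof.
move=> oU; have sd : smooth_on U (fun y : 'rV[R]_n => 1 + dot y y).
  apply: smoothD => //; first exact: smooth_cst.
  by apply: smooth_dot => //; exact: smooth_id.
apply: smoothM => //; first exact: smooth_cst.
by apply: smooth_inv => // y _; rewrite gt_eqF // lam_den.
Qed.

Lemma smooth_stereo (R : realType) n b (U : set 'rV[R]_n) : open U -> smooth_on U (@stereo R n b).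
Proof.
move=> oU; have sd : smooth_on U (fun y : 'rV[R]_n => dot y y).
  by apply: smooth_dot => //; exact: smooth_id.
apply: smooth_scale => //.
  apply: smooth_inv => //; first by move=> y _; rewrite gt_eqF // lam_den.
  by apply: smoothD => //; exact: smooth_cst.
apply: smooth_vec => //; last first.
  by apply: smooth_scale => //; [exact: smooth_cst|exact: smooth_id].
apply: smoothM => //; first exact: smooth_cst.
by apply: smoothD => //; exact: smooth_cst.
Qed.

Lemma smooth_null_lift (R : realType) n b (U : set 'rV[R]_n) : open U -> smooth_on U (@null_lift R n b).
Proof.
move=> oU; have sd : smooth_on U (fun y : 'rV[R]_n => dot y y).
  by apply: smooth_dot => //; exact: smooth_id.
apply: smooth_vec => //.
  apply: smoothM => //; last exact: smooth_cst.
  by apply: smoothD => //; exact: smooth_cst.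
apply: smooth_vec => //; last exact: smooth_id.
apply: smoothM => //; first exact: smooth_cst.
apply: smoothM => //; last exact: smooth_cst.
by apply: smoothD => //; exact: smooth_cst.
Qed.

Lemma stereo_sphere (R : realType) n b (y : 'rV[R]_n) : dot (stereo b y) (stereo b y) = 1.
Proof.
have := lorentz_lift b y; have e := stereo_lift b y.
have : lorentz (vec 1 (stereo b y)) (vec 1 (stereo b y)) = 0.
  by rewrite e !lorentz_lin lorentz_lift !mulr0.
by rewrite lorentz_vec mulr1 => /eqP; rewrite addrC subr_eq0 => /eqP.
Qed.

Lemma diff_stereo (R : realType) n b (y : 'rV[R]_n) : differentiable (stereo b) y.
Proof. by apply: (smooth_differentiable (U := setT)) => //; apply: smooth_stereo; exact: openT. Qed.

Lemma diff_lam (R : realType) n (y : 'rV[R]_n) : differentiable (@lam R n) y.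
Proof. by apply: (smooth_differentiable (U := setT)) => //; apply: smooth_lam; exact: openT. Qed.

(** * The horospherical lift and the key identity *)

Section HoroLift.
Local Opaque vec dot lorentz null_lift null_tangent null_pole lam stereo derive.

Lemma derive_stereo_lift (R : realType) n b (y v : 'rV[R]_n) :
  vec 0 ('D_v (stereo b) y) = 'D_v (@lam R n) y *: null_lift b y + lam y *: null_tangent b y v.
Proof.
have c1 : differentiable (fun _ : 'rV[R]_n => 1 : R) y by exact: differentiable_cst.
have [_ e1] := derive_vec v c1 (diff_stereo b y); rewrite derive_cst in e1.
have [dz ez] := derive_lift b y v.
have [_ e2] := derive_scale v (diff_lam y) dz.
rewrite ez in e2; apply: etrans (esym e1) (etrans _ e2).
have E : (fun z : 'rV[R]_n => vec 1 (stereo b z)) = (fun z : 'rV[R]_n => lam z *: null_lift b z).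
  by apply/funext => z; exact: stereo_lift.
exact: (congr1 (fun g => 'D_v g y) E).
Qed.

(** The components of both differentials along [null_lift b y] contribute nothing, this vector being
    null and orthogonal to the tangents. What remains is lam^2 times the flat product: stereographic
    projection is conformal. *)
Lemma dot_derive_stereo (R : realType) n b (y u v : 'rV[R]_n) :
  dot ('D_u (stereo b) y) ('D_v (stereo b) y) = lam y ^+ 2 * dot u v.
Proof.
have : lorentz (vec 0 ('D_u (stereo b) y)) (vec 0 ('D_v (stereo b) y)) = lam y ^+ 2 * dot u v.
  apply: etrans (congr2 (@lorentz R _) (derive_stereo_lift b y u) (derive_stereo_lift b y v)) _.
  have := lorentz_tangent b y u v; have := lorentz_lift_tangent b y u.
  have := lorentz_lift_tangent b y v; have := lorentz_lift b y.
  set Z := null_lift b y; set Zu := null_tangent b y u; set Zv := null_tangent b y v.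
  set c := 'D_u _ _; set d := 'D_v _ _; set l := lam y; clearbody Z Zu Zv c d l.
  move=> h1 h2 h3 h4.
  rewrite (lorentzDl (c *: Z)). rewrite !lorentzDr. rewrite !lorentzZl.
  rewrite !lorentzZr.
  rewrite (lorentzC Zu Z) h1 h2 h3 h4; ring.
by rewrite lorentz_vec mul0r oppr0 add0r.
Qed.

Lemma dot_stereo_derive (R : realType) n b (y v : 'rV[R]_n) :
  dot (stereo b y) ('D_v (stereo b) y) = 0.
Proof.
have [_ e] := derive_dot v (diff_stereo b y) (diff_stereo b y).
have : 'D_v (fun x : 'rV[R]_n => dot (stereo b x) (stereo b x)) y = 0.
  rewrite (_ : (fun x => _) = fun _ => 1) ?derive_cst //.
  by apply/funext => z; exact: stereo_sphere.
rewrite e dotC => /eqP; rewrite -mulr2n mulrn_eq0 /= => /eqP ->.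
by [].
Qed.

Definition horo_lift (R : realType) n b (f : 'rV[R]_n -> R) (y : 'rV[R]_n) :=
  expR (f y) *: null_lift b y.

(* Minus the Schouten tensor of the flat conformal metric e^{2f} |dy|^2. *)
Definition schouten (R : realType) n (f : 'rV[R]_n -> R) (y v : 'rV[R]_n) : R :=
  'D_v (fun z => 'D_v f z) y - ('D_v f y) ^+ 2
  + 2^-1 * (\sum_i (partial i f y) ^+ 2) * dot v v.

Lemma derive_horo_lift (R : realType) n b (f : 'rV[R]_n -> R) (y v : 'rV[R]_n) :
  differentiable f y ->
  differentiable (horo_lift b f) y /\
  'D_v (horo_lift b f) y = expR (f y) *: ('D_v f y *: null_lift b y + null_tangent b y v).
Proof.
move=> df; have [de ee] := derive_exp v df; have [dz ez] := derive_lift b y v.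
have [d e] := derive_scale v de dz; split; first exact: d.
apply: (etrans e); rewrite ee ez.
set E := expR _; set Z := null_lift _ _; set W := null_tangent _ _ _; set a := 'D_v f y.
by rewrite scalerDr scalerA.
Qed.

Lemma derive2_horo_lift (R : realType) n b (U : set 'rV[R]_n) (f : 'rV[R]_n -> R)
    (y v : 'rV[R]_n) :
  open U -> smooth_on U f -> U y ->
  differentiable (fun z => 'D_v (horo_lift b f) z) y /\
  'D_v (fun z => 'D_v (horo_lift b f) z) y =
  expR (f y) *: (('D_v (fun z => 'D_v f z) y + ('D_v f y) ^+ 2) *: null_lift b y
     + (2 * 'D_v f y) *: null_tangent b y v + dot v v *: null_pole R n b).
Proof.
move=> oU sf Uy; have df := smooth_differentiable sf Uy.
have ddf := smooth_differentiable (smooth_derive v sf) Uy.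
have [de ee] := derive_exp v df; have [dz ez] := derive_lift b y v.
have [dt et] := derive_tangent b y v v.
have [d1 e1] := derive_scale v ddf dz; have [d2 e2] := derive_addf v d1 dt.
have [d3 e3] := derive_scale v de d2.
have E : \forall z \near y,
    expR (f z) *: ('D_v f z *: null_lift b z + null_tangent b z v) = 'D_v (horo_lift b f) z.
  near=> z; apply/esym; apply: (derive_horo_lift b v _).2.
  by apply: (smooth_differentiable sf); near: z; exact: open_nbhs_nbhs.
split; first exact: near_eq_differentiable E d3.
apply: (etrans (esym (near_eq_derive v E))); apply: (etrans e3).
rewrite ee e2 e1 ez et.
set F := expR _; set Z := null_lift _ _; set W := null_tangent _ _ _; set a := 'D_v f y.
set c := 'D_v _ y; set N := null_pole _ _ _; set q := dot _ _; clearbody F Z W a c N q.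
by apply/rowP => j; rewrite !mxE; ring.
Unshelve. all: by end_near. Qed.

Lemma lorentz_horo_lift (R : realType) n b (f : 'rV[R]_n -> R) (y u v : 'rV[R]_n) :
  differentiable f y ->
  lorentz ('D_u (horo_lift b f) y) ('D_v (horo_lift b f) y) = expR (2 * f y) * dot u v.
Proof.
move=> df; have [_ eu] := derive_horo_lift b u df; have [_ ev] := derive_horo_lift b v df.
apply: (etrans (congr2 (@lorentz R _) eu ev)).
have := lorentz_tangent b y u v; have := lorentz_lift_tangent b y u.
have := lorentz_lift_tangent b y v; have := lorentz_lift b y.
set Z := null_lift b y; set Zu := null_tangent b y u; set Zv := null_tangent b y v.
set c := 'D_u _ _; set d := 'D_v _ _; clearbody Z Zu Zv c d.
move=> h1 h2 h3 h4.
rewrite lorentzZl lorentzZr (lorentzDl (c *: Z)) !lorentzDr !lorentzZl !lorentzZr.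
rewrite (lorentzC Zu Z) h1 h2 h3 h4 mulr_natl mulr2n expRD; ring.
Qed.

(** Differentiating <phi, D_v psi> = 0 gives <D_v phi, D_v psi> = - <phi, D_vD_v psi>, so phi is
    differentiated only once and the second derivative falls on the explicit [horo_lift]. That
    derivative is a combination of the lift, a tangent and the pole: the pairing of phi with the
    lift comes from <phi, psi> = -1, with the tangents from <phi, dpsi> = 0, and with the pole from
    <phi, phi> = -1 expanded in the null frame. *)
Lemma fundamental_identity (R : realType) n b (U : set 'rV[R]_n) (f : 'rV[R]_n -> R)
    (phi : 'rV[R]_n -> 'rV[R]_(1 + (1 + n))) :
  open U -> smooth_on U f -> (forall y, U y -> differentiable phi y) ->
  (forall y, U y -> lorentz (phi y) (phi y) = -1) ->
  (forall y, U y -> lorentz (phi y) (horo_lift b f y) = -1) ->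
  (forall y v, U y -> lorentz (phi y) ('D_v (horo_lift b f) y) = 0) ->
  forall y v, U y -> lorentz ('D_v phi y) ('D_v (horo_lift b f) y) =
    2^-1 * (expR (2 * f y) * dot v v) + schouten f y v.
Proof.
move=> oU sf dphi h1 h2 h3 y v Uy; have df := smooth_differentiable sf Uy.
have [dp2 e2] := derive2_horo_lift b v oU sf Uy.
have [_ e0] := derive_lorentz v (dphi y Uy) dp2.
have z0 : 'D_v (fun x => lorentz (phi x) ('D_v (horo_lift b f) x)) y = 0.
  rewrite -[RHS](derive_cst (0 : R) y v); apply: near_eq_derive.
  near=> z; rewrite h3 //; near: z; exact: open_nbhs_nbhs.
rewrite z0 in e0; move/esym/eqP: e0; rewrite addr_eq0 => /eqP ->.
have hZ : expR (f y) * lorentz (phi y) (null_lift b y) = -1.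
  by rewrite -lorentzZr; exact: h2.
have hW w : lorentz (phi y) (null_tangent b y w) = - 'D_w f y * lorentz (phi y) (null_lift b y).
  have := h3 y w Uy; have [_ ->] := derive_horo_lift b w df.
  set Z := null_lift _ _; set W := null_tangent _ _ _; set a := 'D_w f y.
  rewrite lorentzZr lorentzDr lorentzZr => /eqP; rewrite mulf_eq0 gt_eqF ?expR_gt0 //=.
  by rewrite addrC addr_eq0 mulNr => /eqP.
(* The sum over the tangents becomes |df|^2 <phi, Z>^2, with Z the null lift; this is where the
   gradient term of the Schouten tensor originates. *)
have hN := lorentz_null_frame b y (phi y); rewrite h1 // in hN.
have {}hN : -1 = - 2 * lorentz (phi y) (null_pole R n b) * lorentz (phi y) (null_lift b y) +
    (\sum_i (partial i f y) ^+ 2) * lorentz (phi y) (null_lift b y) ^+ 2.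
  rewrite hN; congr (_ + _); rewrite mulr_suml; apply: eq_bigr => i _.
  by rewrite hW exprMn sqrrN.
apply: (etrans (congr1 (fun w => - lorentz (phi y) w) e2)).
rewrite /schouten.
move: hZ hN (hW v); set Z := null_lift _ _; set W := null_tangent _ _ _; set a := 'D_v f y.
set c := 'D_v _ y; set N := null_pole _ _ _; set q := dot _ _; set E := expR (f y).
set S := \sum_i _; set p := phi y.
have E0 : E != 0 by rewrite gt_eqF // expR_gt0.
have -> : expR (2 * f y) = E * E by rewrite mulr_natl mulr2n expRD.
rewrite lorentzZr !lorentzDr !lorentzZr.
move: (lorentz p Z) (lorentz p N) (lorentz p W) E0; clearbody E S q a c.
move=> z nn w E0 hZ hN ->.
have zE : z = - E^-1 by apply: (mulfI E0); rewrite hZ mulrN divff.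
have nE : nn = - 2^-1 * (E + S * E^-1).
  move: hN; rewrite zE sqrrN => hN.
  have E2 : 2 * E^-1 != 0 by rewrite mulf_neq0 ?invr_eq0 // pnatr_eq0.
  apply: (mulfI E2); transitivity (-1 - S * E^-1 ^+ 2); last by field.
  by rewrite hN; ring.
by rewrite zE nE; field.
Unshelve. all: by end_near. Qed.

(* u |-> <phi, u> = 0 is a spacelike hyperplane. *)
Lemma lorentz_spacelike (R : realType) m (p u : 'rV[R]_(1 + m)) :
  lorentz p p = -1 -> lorentz u p = 0 ->
  dot (rsubmx u) (rsubmx u) <= time p ^+ 2 * lorentz u u.
Proof.
rewrite [p]vec_eta [u]vec_eta !vecE0 !vecEr !lorentz_vec.
move: (time p) (time u) (rsubmx p) (rsubmx u) => p0 u0 p' u' hp hu.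
have cs : dot u' p' ^+ 2 <= dot u' u' * dot p' p'.
  have := dot_ge0 (dot p' p' *: u' - dot u' p' *: p').
  rewrite !(dotDl, dotDr, dotNl, dotNr, dotZl, dotZr) (dotC p' u').
  have [p'0|p'0] := eqVneq (dot p' p') 0.
    by move=> _; rewrite (dot_eq0 p'0) !dot0r expr0n /= mulr0.
  have pp : 0 < dot p' p' by rewrite lt0r p'0 dot_ge0.
  move=> h; rewrite -subr_ge0 -(pmulr_rge0 _ pp).
  by move: h; congr (_ <= _); ring.
have e1 : dot p' p' = p0 ^+ 2 - 1 by rewrite expr2; move: hp; lra.
have e2 : dot u' p' = u0 * p0 by move: hu; lra.
rewrite e1 e2 exprMn in cs.
rewrite -subr_ge0; have -> : p0 ^+ 2 * (- (u0 * u0) + dot u' u') - dot u' u' =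
  dot u' u' * (p0 ^+ 2 - 1) - u0 ^+ 2 * p0 ^+ 2 by ring.
by rewrite subr_ge0.
Qed.

Lemma lorentz_tangent_ge0 (R : realType) m (p u : 'rV[R]_(1 + m)) :
  lorentz p p = -1 -> lorentz u p = 0 -> 0 <= lorentz u u.
Proof.
move=> hp hu; have h := lorentz_spacelike hp hu.
have p0 : 0 < time p ^+ 2.
  have := dot_ge0 (rsubmx p); move: hp; rewrite [p]vec_eta lorentz_vec vecE0 vecEr expr2; lra.
by rewrite -(pmulr_rge0 _ p0) (le_trans _ h) // dot_ge0.
Qed.

Lemma lorentz_tangent_eq0 (R : realType) m (p u : 'rV[R]_(1 + m)) :
  lorentz p p = -1 -> lorentz u p = 0 -> lorentz u u = 0 -> u = 0.
Proof.
move=> hp hu hu0; have := lorentz_spacelike hp hu; rewrite hu0 mulr0 => h.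
have u'0 : rsubmx u = 0 by apply: dot_eq0; apply/eqP; rewrite eq_le h dot_ge0.
move: hu0; rewrite [u]vec_eta lorentz_vec u'0 dot0r addr0 => /eqP.
by rewrite oppr_eq0 mulf_eq0 orbb => /eqP ->; exact: vec00.
Qed.

Lemma lorentz_cauchy_schwarz (R : realType) m (p u v : 'rV[R]_(1 + m)) :
  lorentz p p = -1 -> lorentz u p = 0 -> lorentz v p = 0 ->
  lorentz u v ^+ 2 <= lorentz u u * lorentz v v.
Proof.
move=> hp hu hv.
have [v0|v0] := eqVneq (lorentz v v) 0.
  have -> : v = 0 by exact: lorentz_tangent_eq0 hp hv v0.
  by rewrite lorentzC lorentz0l expr0n /= lorentz0l mulr0.
have vv : 0 < lorentz v v by rewrite lt0r v0 (lorentz_tangent_ge0 hp hv).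
pose w := lorentz v v *: u - lorentz u v *: v.
have hw : lorentz w p = 0 by rewrite /w lorentzDl lorentzNl !lorentzZl hu hv !mulr0 subr0.
have := lorentz_tangent_ge0 hp hw.
rewrite /w !(lorentzDl, lorentzNl, lorentzZl) !(lorentzDr, lorentzNr, lorentzZr) (lorentzC v u).
move=> h; rewrite -subr_ge0 -(pmulr_rge0 _ vv).
by move: h; congr (_ <= _); ring.
Qed.

End HoroLift.

(** * Curvature of conformally flat metrics *)

Lemma sum_delta (R : realType) n (l : 'I_n) (F : 'I_n -> R) :
  \sum_m (m == l)%:R * F m = F l.
Proof.
rewrite (bigD1 l) //= eqxx mul1r big1 ?addr0 // => m /negbTE ->.
by rewrite mul0r.
Qed.

Lemma sum_delta' (R : realType) n (l : 'I_n) (F : 'I_n -> R) :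
  \sum_m (l == m)%:R * F m = F l.
Proof. by rewrite -[RHS](sum_delta l); apply: eq_bigr => m _; rewrite eq_sym. Qed.

Definition hess (R : realType) n (f : 'rV[R]_n -> R) (i j : 'I_n) (y : 'rV[R]_n) : R :=
  partial i (fun z => partial j f z) y.

Definition grad2 (R : realType) n (f : 'rV[R]_n -> R) (y : 'rV[R]_n) : R :=
  \sum_i (partial i f y) ^+ 2.

Definition schouten_mx (R : realType) n (f : 'rV[R]_n -> R) (i j : 'I_n) (y : 'rV[R]_n) : R :=
  hess f i j y - partial i f y * partial j f y + (i == j)%:R * (2^-1 * grad2 f y).

Definition conf_mx (R : realType) n (f : 'rV[R]_n -> R) (y : 'rV[R]_n) : 'M[R]_n :=
  (expR (2 * f y))%:M.

Lemma expR2 (R : realType) (x : R) : expR (2 * x) = expR x * expR x.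
Proof. by rewrite mulr_natl mulr2n expRD. Qed.

Lemma sum_const_ord (R : realType) n (c : R) : \sum_(i < n) c = n%:R * c.
Proof. by rewrite sumr_const card_ord mulr_natl. Qed.

Lemma abs_mul_le (R : realType) (x y : R) : `|x * y| <= 2^-1 * (x * x + y * y).
Proof.
have h1 := sqr_ge0 (x - y); have h2 := sqr_ge0 (x + y).
by rewrite !expr2 in h1 h2; rewrite ler_norml; apply/andP; split; lra.
Qed.

Lemma conf_mxE (R : realType) n (f : 'rV[R]_n -> R) y i j :
  conf_mx f y i j = (i == j)%:R * expR (2 * f y).
Proof. by rewrite mxE [RHS]mulr_natl. Qed.

Lemma partial_conf_mx (R : realType) n (f : 'rV[R]_n -> R) i j m y :
  differentiable f y ->
  partial i (fun z => conf_mx f z j m) y = 2 * partial i f y * expR (2 * f y) * (j == m)%:R.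
Proof.
move=> df; have [d1 e1] := differentiable_lin 2 0 (delta_mx 0 i) df.
have E : (fun z => conf_mx f z j m) = fun z => (j == m)%:R * expR (2 * f z + 0) + 0.
  by apply/funext => z; rewrite conf_mxE !addr0.
have [d2 e2] := derive_exp (delta_mx 0 i) d1.
have [d3 e3] := differentiable_lin (j == m)%:R 0 (delta_mx 0 i) d2.
rewrite /partial E e3 e2 e1 addr0; ring.
Qed.

Lemma christoffel_conf (R : realType) n (f : 'rV[R]_n -> R) l i j y :
  differentiable f y ->
  christoffel (conf_mx f) l i j y =
  (j == l)%:R * partial i f y + (i == l)%:R * partial j f y - (i == j)%:R * partial l f y.
Proof.
move=> df; rewrite /christoffel.
have inv : invmx (conf_mx f y) = (expR (2 * f y))^-1%:M by rewrite /conf_mx invmx_scalar.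
have H (a a' b b' c c' d d' : R) : d = d' -> a = a' -> b = b' -> c = c' ->
    d * (a + b - c) = d' * (a' + b' - c') by move=> -> -> -> ->.
pose E := expR (2 * f y); have E0 : E != 0 by rewrite gt_eqF // expR_gt0.
apply: (@etrans _ _ (2^-1 * \sum_m (l == m)%:R * (E^-1 *
  (2 * partial i f y * E * (j == m)%:R + 2 * partial j f y * E * (i == m)%:R
   - 2 * partial m f y * E * (i == j)%:R)))).
  apply: (congr1 (fun s => 2^-1 * s)); apply: eq_bigr => m _; rewrite [RHS]mulrA.
  apply: H; [by rewrite inv mxE [RHS]mulr_natl|exact: partial_conf_mx..].
rewrite sum_delta'; move: (partial i f y) (partial j f y) (partial l f y) E0.
by clearbody E => a b c E0; field.
Qed.

Lemma sum_christoffel_l (R : realType) n (l i : 'I_n) (a b : R) (h F : 'I_n -> R) :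
  \sum_m ((m == l)%:R * a + (i == l)%:R * h m - (i == m)%:R * b) * F m =
  a * F l + (i == l)%:R * (\sum_m h m * F m) - b * F i.
Proof.
rewrite -(sum_delta l F) -(sum_delta' i F) !mulr_sumr -big_split -sumrB.
by apply: eq_bigr => m _ /=; ring.
Qed.

Lemma sum_christoffel_r (R : realType) n (j k : 'I_n) (h : 'I_n -> R) :
  \sum_m h m * ((k == m)%:R * h j + (j == m)%:R * h k - (j == k)%:R * h m) =
  2 * (h j * h k) - (j == k)%:R * \sum_m h m ^+ 2.
Proof.
have -> : 2 * (h j * h k) = h k * h j + h j * h k by ring.
rewrite -(sum_delta' k (fun m => h m * h j)) -(sum_delta' j (fun m => h m * h k)).
rewrite mulr_sumr -big_split -sumrB.
by apply: eq_bigr => m _ /=; ring.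
Qed.

Lemma hess_sym (R : realType) n (U : set 'rV[R]_n) (f : 'rV[R]_n -> R) i j y :
  open U -> smooth_on U f -> U y -> hess f i j y = hess f j i y.
Proof. by move=> oU /smooth_onP sf Uy; exact: (derive_sym _ _ oU (sf 1%N) Uy). Qed.

Lemma derive_comb3 (R : realType) (V : normedModType R) (a b c : R) (p q r : V -> R) x v :
  differentiable p x -> differentiable q x -> differentiable r x ->
  'D_v (fun z => a * p z + b * q z - c * r z) x = a * 'D_v p x + b * 'D_v q x - c * 'D_v r x.
Proof.
have cst t : differentiable (fun _ : V => t : R) x by exact: differentiable_cst.
have cE t : 'D_v (fun _ : V => t : R) x = 0 by exact: derive_cst.
move=> dp dq dr; have [d1 e1] := derive_mulf v (cst a) dp; have [d2 e2] := derive_mulf v (cst b) dq.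
have [d3 e3] := derive_mulf v (cst (- c)) dr; have [d4 e4] := derive_addf v d1 d2.
have [d5 e5] := derive_addf v d4 d3.
have -> : (fun z => a * p z + b * q z - c * r z) = fun z => a * p z + b * q z + (- c) * r z.
  by apply/funext => z; rewrite mulNr.
by rewrite e5 e4 e1 e2 e3 !cE !mul0r !add0r mulNr.
Qed.

Lemma partial_christoffel (R : realType) n (U : set 'rV[R]_n) (f : 'rV[R]_n -> R) l i j k y :
  open U -> smooth_on U f -> U y ->
  partial i (christoffel (conf_mx f) l j k : _ -> R^o) y =
  (k == l)%:R * hess f i j y + (j == l)%:R * hess f i k y - (j == k)%:R * hess f i l y.
Proof.
move=> oU sf Uy.
have dp m : differentiable (fun z => partial m f z) y.
  exact: (smooth_differentiable (smooth_derive _ sf) Uy).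
apply: (etrans _ (derive_comb3 (k == l)%:R (j == l)%:R (j == k)%:R (delta_mx 0 i) (dp j) (dp k) (dp l))).
apply: near_eq_derive; near=> z; apply: christoffel_conf.
by apply: (smooth_differentiable sf); near: z; exact: open_nbhs_nbhs.
Unshelve. all: by end_near. Qed.

(** The products of Christoffel symbols complete the Hessians to [schouten_mx], and the terms with
    delta_kl cancel by symmetry of the Hessian. The result is a Kulkarni-Nomizu product of the
    metric with the Schouten tensor: there is no Weyl part. *)
Lemma riem_conf (R : realType) n (U : set 'rV[R]_n) (f : 'rV[R]_n -> R) l i j k y :
  open U -> smooth_on U f -> U y ->
  riem (conf_mx f) l i j k y =
  (j == l)%:R * schouten_mx f i k y - (j == k)%:R * schouten_mx f i l y
  - (i == l)%:R * schouten_mx f j k y + (i == k)%:R * schouten_mx f j l y.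
Proof.
move=> oU sf Uy; have df := smooth_differentiable sf Uy.
rewrite /riem !(partial_christoffel _ _ _ _ oU sf Uy) sumrB.
have sumE a b : \sum_m christoffel (conf_mx f) l a m y * christoffel (conf_mx f) m b k y =
   partial a f y * ((k == l)%:R * partial b f y + (b == l)%:R * partial k f y
      - (b == k)%:R * partial l f y)
   + (a == l)%:R * (2 * (partial b f y * partial k f y) - (b == k)%:R * grad2 f y)
   - partial l f y * ((k == a)%:R * partial b f y + (b == a)%:R * partial k f y
      - (b == k)%:R * partial a f y).
  under eq_bigr => m _ do rewrite !christoffel_conf //.
  by rewrite sum_christoffel_l sum_christoffel_r.
rewrite !sumE /schouten_mx (hess_sym j i oU sf Uy) (eq_sym k i) (eq_sym k j) (eq_sym j i).
move: (hess f i j y) (hess f i k y) (hess f i l y) (hess f j k y) (hess f j l y) (grad2 f y).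
move: (partial i f y) (partial j f y) (partial k f y) (partial l f y) => a b c d h1 h2 h3 h4 h5 s.
move: (i == j)%:R (i == k)%:R (i == l)%:R (j == k)%:R (j == l)%:R (k == l)%:R => x1 x2 x3 x4 x5 x6.
by field.
Qed.

Definition schouten_bil (R : realType) n (f : 'rV[R]_n -> R) (y u v : 'rV[R]_n) : R :=
  \sum_i \sum_j schouten_mx f i j y * u 0 i * v 0 j.

Lemma riem4_conf (R : realType) n (U : set 'rV[R]_n) (f : 'rV[R]_n -> R) y u v w z :
  open U -> smooth_on U f -> U y ->
  riem4 (conf_mx f) y u v w z = expR (2 * f y) *
   (dot v z * schouten_bil f y u w - dot v w * schouten_bil f y u z
    - dot u z * schouten_bil f y v w + dot u w * schouten_bil f y v z).
Proof.
move=> oU sf Uy; rewrite /riem4.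
set E := expR _; set T := fun i j => schouten_mx f i j y.
have step i j k l : \sum_m conf_mx f y l m * riem (conf_mx f) l i j k y * u 0 i * v 0 j * w 0 k * z 0 m
   = E * ((j == l)%:R * (T i k * u 0 i * v 0 j * w 0 k * z 0 l)
          - (j == k)%:R * (T i l * u 0 i * v 0 j * w 0 k * z 0 l)
          - (i == l)%:R * (T j k * u 0 i * v 0 j * w 0 k * z 0 l)
          + (i == k)%:R * (T j l * u 0 i * v 0 j * w 0 k * z 0 l)).
  rewrite (riem_conf _ _ _ _ oU sf Uy).
  under eq_bigr => m _ do rewrite conf_mxE -/E -!mulrA.
  by rewrite sum_delta' /T; ring.
under eq_bigr => i _ do under eq_bigr => j _ do under eq_bigr => k _ do
  under eq_bigr => l _ do rewrite step.
have -> : forall F : 'I_n -> 'I_n -> 'I_n -> 'I_n -> R,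
  \sum_i \sum_j \sum_k \sum_l E * F i j k l = E * \sum_i \sum_j \sum_k \sum_l F i j k l.
  move=> F; rewrite mulr_sumr; apply: eq_bigr => i _; rewrite mulr_sumr; apply: eq_bigr => j _.
  by rewrite mulr_sumr; apply: eq_bigr => k _; rewrite mulr_sumr; apply: eq_bigr.
congr (_ * _).
have split4 (A B C D : 'I_n -> 'I_n -> 'I_n -> 'I_n -> R) :
  \sum_i \sum_j \sum_k \sum_l (A i j k l - B i j k l - C i j k l + D i j k l) =
  \sum_i \sum_j \sum_k \sum_l A i j k l - \sum_i \sum_j \sum_k \sum_l B i j k l
  - \sum_i \sum_j \sum_k \sum_l C i j k l + \sum_i \sum_j \sum_k \sum_l D i j k l.
  rewrite -!sumrB -big_split; apply: eq_bigr => i _ /=.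
  rewrite -!sumrB -big_split; apply: eq_bigr => j _ /=.
  rewrite -!sumrB -big_split; apply: eq_bigr => k _ /=.
  by rewrite -!sumrB -big_split; apply: eq_bigr => l _.
rewrite split4; congr (_ - _ - _ + _).
- under eq_bigr => i _ do under eq_bigr => j _ do under eq_bigr => k _ do rewrite sum_delta'.
  rewrite /schouten_bil mulr_sumr; apply: eq_bigr => i _.
  rewrite exchange_big mulr_sumr; apply: eq_bigr => k _.
  by rewrite /dot mulr_suml; apply: eq_bigr => j _; rewrite /T; ring.
- under eq_bigr => i _ do under eq_bigr => j _ do under eq_bigr => k _ do rewrite -mulr_sumr.
  under eq_bigr => i _ do under eq_bigr => j _ do rewrite sum_delta'.
  rewrite /schouten_bil mulr_sumr; apply: eq_bigr => i _.
  rewrite exchange_big mulr_sumr; apply: eq_bigr => k _.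
  by rewrite /dot mulr_suml; apply: eq_bigr => j _; rewrite /T; ring.
- under eq_bigr => i _ do under eq_bigr => j _ do under eq_bigr => k _ do rewrite sum_delta'.
  rewrite exchange_big /schouten_bil mulr_sumr; apply: eq_bigr => j _.
  rewrite exchange_big mulr_sumr; apply: eq_bigr => k _.
  by rewrite /dot mulr_suml; apply: eq_bigr => i _; rewrite /T; ring.
- under eq_bigr => i _ do under eq_bigr => j _ do under eq_bigr => k _ do rewrite -mulr_sumr.
  under eq_bigr => i _ do under eq_bigr => j _ do rewrite sum_delta'.
  rewrite exchange_big /schouten_bil mulr_sumr; apply: eq_bigr => j _.
  rewrite exchange_big mulr_sumr; apply: eq_bigr => k _.
  by rewrite /dot mulr_suml; apply: eq_bigr => i _; rewrite /T; ring.
Qed.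

Section ConformalCurvature.
Local Opaque vec lorentz stereo.

Lemma gram_conformal (R : realType) n b (Om : set 'rV[R]_(1 + n)) (rho : 'rV[R]_(1 + n) -> R) y :
  gram (conformal_metric rho) (LParam (@stereo R n b @^-1` Om) (@stereo R n b)) y =
  conf_mx (fun z => rho (stereo b z) + ln (lam z)) y.
Proof.
apply/matrixP => i j; rewrite conf_mxE mxE.
have -> : expR (2 * (rho (stereo b y) + ln (lam y))) =
   expR (2 * rho (stereo b y)) * lam y ^+ 2.
  rewrite mulrDr expRD; congr (_ * _); rewrite mulr_natl mulr2n expRD.
  by rewrite lnK // posrE lam_gt0.
apply: etrans (congr1 (fun t => expR (2 * rho (stereo b y)) * t)
  (dot_derive_stereo b y (delta_mx 0 i) (delta_mx 0 j))) _.
have -> : dot (delta_mx 0 i) (delta_mx 0 j) = (i == j)%:R :> R.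
  rewrite /dot -(sum_delta i (fun m => (m == j)%:R)).
  by apply: eq_bigr => m _; rewrite !mxE eqxx.
ring.
Qed.

Lemma derive2_hess (R : realType) n (U : set 'rV[R]_n) (f : 'rV[R]_n -> R) y v :
  open U -> smooth_on U f -> U y ->
  'D_v (fun z => 'D_v f z) y = \sum_i \sum_j hess f i j y * v 0 i * v 0 j.
Proof.
move=> oU sf Uy.
have dp m : differentiable (fun z => partial m f z) y.
  exact: (smooth_differentiable (smooth_derive _ sf) Uy).
have dpv m : differentiable (fun z => v 0 m * partial m f z) y.
  have cv : differentiable (fun _ : 'rV[R]_n => v 0 m) y by exact: differentiable_cst.
  exact: (derive_mulf v cv (dp m)).1.
have E : \forall z \near y, 'D_v f z = (\sum_j (fun z => v 0 j * partial j f z)) z.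
  near=> z; rewrite fct_sumE; apply: derive_coord.
  by apply: (smooth_differentiable sf); near: z; exact: open_nbhs_nbhs.
rewrite (near_eq_derive _ E) derive_sum => [|j]; last exact: diff_derivable.
rewrite exchange_big; apply: eq_bigr => j _.
have cv : differentiable (fun _ : 'rV[R]_n => v 0 j) y by exact: differentiable_cst.
have cE : 'D_v (fun _ : 'rV[R]_n => v 0 j) y = 0 by exact: derive_cst.
apply: (etrans (derive_mulf v cv (dp j)).2); rewrite cE mul0r add0r.
rewrite [X in _ * X](derive_coord v (dp j)) mulr_sumr; apply: eq_bigr => i _.
by rewrite /hess [RHS]mulrC [hess _ _ _ _ * _]mulrC.
Unshelve. all: by end_near. Qed.

Lemma schouten_bilE (R : realType) n (U : set 'rV[R]_n) (f : 'rV[R]_n -> R) y v :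
  open U -> smooth_on U f -> U y -> schouten f y v = schouten_bil f y v v.
Proof.
move=> oU sf Uy; have df := smooth_differentiable sf Uy.
rewrite /schouten (derive2_hess v oU sf Uy) (derive_coord v df).
have -> : (\sum_i v 0 i *: partial i f y) ^+ 2 =
    \sum_i \sum_j partial i f y * partial j f y * v 0 i * v 0 j.
  rewrite expr2 mulr_suml; apply: eq_bigr => i _; rewrite mulr_sumr; apply: eq_bigr => j _.
  by rewrite /GRing.scale /=; ring.
have -> : 2^-1 * (\sum_i partial i f y ^+ 2) * dot v v =
    \sum_i \sum_j (i == j)%:R * (2^-1 * grad2 f y) * v 0 i * v 0 j.
  rewrite -/(grad2 f y) /dot mulr_sumr; apply: eq_bigr => i _.
  by rewrite -(sum_delta' i (fun j => _ * (v 0 i * v 0 j))); apply: eq_bigr => j _; ring.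
rewrite -sumrB -big_split; apply: eq_bigr => i _ /=.
by rewrite -sumrB -big_split; apply: eq_bigr => j _ /=; rewrite /schouten_mx; ring.
Qed.

Lemma dot_delta (R : realType) n (i j : 'I_n) : dot (delta_mx 0 i) (delta_mx 0 j) = (i == j)%:R :> R.
Proof.
rewrite /dot -(sum_delta i (fun m => (m == j)%:R)).
by apply: eq_bigr => m _; rewrite !mxE eqxx.
Qed.

Lemma schouten_bil_delta (R : realType) n (f : 'rV[R]_n -> R) y i j :
  schouten_bil f y (delta_mx 0 i) (delta_mx 0 j) = schouten_mx f i j y.
Proof.
rewrite /schouten_bil -(sum_delta i (fun a => schouten_mx f a j y)); apply: eq_bigr => a _.
rewrite -(sum_delta j (fun b => (a == i)%:R * schouten_mx f a b y)); apply: eq_bigr => b _.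
by rewrite !mxE eqxx /=; ring.
Qed.

Lemma conf_norm (R : realType) n (f : 'rV[R]_n -> R) y u :
  Num.sqrt (mx_norm2 (conf_mx f y) u) = expR (f y) * Num.sqrt (dot u u).
Proof.
have -> : mx_norm2 (conf_mx f y) u = expR (f y) ^+ 2 * dot u u.
  rewrite /mx_norm2 /dot mulr_sumr; apply: eq_bigr => i _.
  rewrite -(sum_delta' i (fun j => _ * (u 0 i * u 0 j))); apply: eq_bigr => j _.
  by rewrite conf_mxE expR2 expr2; ring.
by rewrite sqrtrM ?sqr_ge0 // sqrtr_sqr ger0_norm // expR_ge0.
Qed.

Lemma exists_third (n : nat) (hn : (3 <= n)%N) (i j : 'I_n) : exists k : 'I_n, (k != i) && (k != j).
Proof.
have : (0 < #|~: [set i; j]|)%N.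
  by rewrite cardsCs finset.setCK card_ord subn_gt0 (leq_trans _ hn) // ltnS cards2; case: eqP.
by move=> /card_gt0P[k]; rewrite !inE negb_or => h; exists k.
Qed.

Lemma sum_abs_le (R : realType) n (v : 'rV[R]_n) (a : 'I_n -> 'I_n -> R) (M : R) :
  (forall i j, `|a i j| <= M) ->
  `|\sum_i \sum_j a i j * v 0 i * v 0 j| <= n%:R * M * dot v v.
Proof.
move=> aM.
have M2 i j : `|a i j * v 0 i * v 0 j| <= M / 2 * (v 0 i ^+ 2) + M / 2 * (v 0 j ^+ 2).
  rewrite -mulrA normrM -mulrDr.
  have M0 : 0 <= M by rewrite (le_trans _ (aM i j)).
  rewrite -[M / 2 * _]mulrA !expr2; apply: ler_pM => //; exact: abs_mul_le.
rewrite (le_trans (ler_norm_sum _ _ _)) //.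
rewrite (@le_trans _ _ (\sum_i \sum_j (M / 2 * (v 0 i ^+ 2) + M / 2 * (v 0 j ^+ 2)))) //.
  apply: ler_sum => i _; rewrite (le_trans (ler_norm_sum _ _ _)) //.
  by apply: ler_sum => j _.
have dE : dot v v = \sum_i v 0 i ^+ 2 by apply: eq_bigr => i _; rewrite expr2.
under eq_bigr => i _ do rewrite big_split /= sum_const_ord -mulr_sumr -dE.
rewrite big_split /= sum_const_ord -!mulr_sumr -dE.
by rewrite le_eqVlt; apply/orP; left; apply/eqP; field.
Qed.

(** Evaluating the curvature on (e_i, e_k, e_j, e_k) with k different from i and j isolates T_ij +
    delta_ij T_kk, which settles the off-diagonal entries. For a diagonal one, three distinct
    indices are needed: 2 T_ii = (T_ii + T_kk) + (T_ii + T_ll) - (T_kk + T_ll), whence the factor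
    3/2. This is the role of n >= 3. *)
Lemma schouten_bound (R : realType) n (hn : (3 <= n)%N) (U : set 'rV[R]_n) (f : 'rV[R]_n -> R)
    (C : R) y : open U -> smooth_on U f -> U y ->
  (forall u v w z : 'rV[R]_n, let nrm a := Num.sqrt (mx_norm2 (conf_mx f y) a) in
     `|riem4 (conf_mx f) y u v w z| <= C * nrm u * nrm v * nrm w * nrm z) ->
  forall v, `|schouten f y v| <= n%:R * (3 / 2 * C) * (expR (2 * f y) * dot v v).
Proof.
move=> oU sf Uy hC v; rewrite (schouten_bilE v oU sf Uy).
set E := expR (2 * f y); have E0 : 0 < E by exact: expR_gt0.
have EE : E = expR (f y) * expR (f y) by rewrite -expRD -mulr2n -mulr_natl.
pose T i j := schouten_mx f i j y.
have key i j k : k != i -> k != j -> `|T i j + (i == j)%:R * T k k| <= C * E.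
  move=> ki kj; have := hC (delta_mx 0 i) (delta_mx 0 k) (delta_mx 0 j) (delta_mx 0 k).
  rewrite /= (riem4_conf _ _ _ _ oU sf Uy) !conf_norm !dot_delta !eqxx !schouten_bil_delta.
  rewrite (negbTE kj) (eq_sym i k) (negbTE ki) sqrtr1 !mulr1 -/E !mul0r !subr0 mul1r.
  rewrite normrM (gtr0_norm E0) -/(T i j) -/(T k k).
  have -> : C * expR (f y) * expR (f y) * expR (f y) * expR (f y) = E * (C * E) by rewrite EE; ring.
  by rewrite ler_pM2l.
have CE : 0 <= C * E.
  pose i0 : 'I_n := Ordinal (leq_trans (isT : 0 < 3)%N hn).
  have [k /andP[k1 k2]] := exists_third hn i0 i0.
  by apply: le_trans (key _ _ _ k1 k2).
have TM i j : `|T i j| <= 3 / 2 * C * E.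
  have [k /andP[ki kj]] := exists_third hn i j.
  have [ij|ij] := eqVneq i j; last first.
    have := key _ _ _ ki kj; rewrite (negbTE ij) mul0r addr0 => h; rewrite (le_trans h) //.
    by rewrite -mulrA ler_peMl //; lra.
  rewrite -ij in kj *; have [l /andP[li lk]] := exists_third hn i k.
  have h1 := key _ _ _ ki ki; have h2 := key _ _ _ li li; have h3 := key _ _ _ lk lk.
  rewrite !eqxx !mul1r !ler_norml in h1 h2 h3.
  rewrite -mulrA ler_norml; move: h1 h2 h3 => /andP[a1 a2] /andP[b1 b2] /andP[c1 c2].
  move: (C * E) (T i i) (T k k) (T l l) a1 a2 b1 b2 c1 c2 => e x y0 z a1 a2 b1 b2 c1 c2.
  by clear -a1 a2 b1 b2 c1 c2; apply/andP; split; lra.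
rewrite (le_trans (sum_abs_le v TM)) // le_eqVlt; apply/orP; left; apply/eqP; ring.
Qed.

Lemma abs_coord_le (R : realType) n (u : 'rV[R]_n) i : `|u 0 i| <= Num.sqrt (dot u u).
Proof.
rewrite -sqrtr_sqr ler_wsqrtr // /dot (bigD1 i) //= -expr2 lerDl.
by apply: sumr_ge0 => j _; rewrite -expr2 sqr_ge0.
Qed.

Lemma sum_abs_le2 (R : realType) n (u v : 'rV[R]_n) (a : 'I_n -> 'I_n -> R) (M : R) :
  (forall i j, `|a i j| <= M) ->
  `|\sum_i \sum_j a i j * u 0 i * v 0 j| <=
    n%:R ^+ 2 * M * (Num.sqrt (dot u u) * Num.sqrt (dot v v)).
Proof.
move=> aM; rewrite (le_trans (ler_norm_sum _ _ _)) //.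
rewrite (@le_trans _ _ (\sum_(i < n) \sum_(j < n) M * (Num.sqrt (dot u u) * Num.sqrt (dot v v)))) //.
  apply: ler_sum => i _; rewrite (le_trans (ler_norm_sum _ _ _)) //.
  apply: ler_sum => j _; rewrite !normrM -mulrA.
  by apply: ler_pM => //; rewrite ?mulr_ge0 //; apply: ler_pM => //; exact: abs_coord_le.
rewrite !sum_const_ord le_eqVlt; apply/orP; left; apply/eqP; ring.
Qed.

(** A crude form of Cauchy-Schwarz, adequate because only some constant depending on n matters. *)
Lemma dot_abs_le (R : realType) n (u v : 'rV[R]_n) :
  `|dot u v| <= n%:R ^+ 2 * (Num.sqrt (dot u u) * Num.sqrt (dot v v)).
Proof.
have := @sum_abs_le2 R n u v (fun i j => (i == j)%:R) 1.
rewrite mulr1; have -> : \sum_i \sum_j (i == j)%:R * u 0 i * v 0 j = dot u v.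
  apply: eq_bigr => i _; rewrite -(sum_delta' i (fun j => u 0 i * v 0 j)).
  by apply: eq_bigr => j _; rewrite mulrA.
by apply => i j; case: eqP => _ /=; rewrite ?normr1 ?normr0.
Qed.

(** Polarization on e_i + e_j and e_i - e_j bounds every coefficient of T by C e^(2f), and the
    curvature is a sum of four products of [dot] with the bilinear form of T, each costing n^4. *)
Lemma riem4_bound (R : realType) n (U : set 'rV[R]_n) (f : 'rV[R]_n -> R)
    (C : R) y : open U -> smooth_on U f -> U y ->
  (forall v, `|schouten f y v| <= C * (expR (2 * f y) * dot v v)) ->
  forall u v w z : 'rV[R]_n, let nrm a := Num.sqrt (mx_norm2 (conf_mx f y) a) in
     `|riem4 (conf_mx f) y u v w z| <=
       (4 * n%:R ^+ 4 * C) * nrm u * nrm v * nrm w * nrm z.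
Proof.
move=> oU sf Uy hC u v w z /=.
have Tsym i j : schouten_mx f i j y = schouten_mx f j i y.
  by rewrite /schouten_mx (hess_sym i j oU sf Uy) eq_sym; ring.
have E0 := expR_gt0 (2 * f y); set E := expR (2 * f y) in hC E0.
have EE : E = expR (f y) * expR (f y) by rewrite -expRD -mulr2n -mulr_natl.
have TM i j : `|schouten_mx f i j y| <= C * E.
  pose Q v := schouten_bil f y v v.
  have hQ v' : `|Q v'| <= C * (E * dot v' v') by rewrite /Q -(schouten_bilE v' oU sf Uy).
  have lin a b : Q (a + b) = Q a + Q b + schouten_bil f y a b + schouten_bil f y b a.
    rewrite /Q /schouten_bil -!big_split; apply: eq_bigr => k _ /=.
    by rewrite -!big_split; apply: eq_bigr => l _ /=; rewrite !mxE; ring.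
  have linN a b : Q (a - b) = Q a + Q b - schouten_bil f y a b - schouten_bil f y b a.
    rewrite /Q /schouten_bil -!big_split -!sumrB; apply: eq_bigr => k _ /=.
    by rewrite -!big_split -!sumrB; apply: eq_bigr => l _ /=; rewrite !mxE; ring.
  have h1 := hQ (delta_mx 0 i + delta_mx 0 j); have h2 := hQ (delta_mx 0 i - delta_mx 0 j).
  rewrite lin in h1; rewrite linN in h2.
  rewrite !schouten_bil_delta (Tsym j i) in h1 h2.
  rewrite !(dotDl, dotNl) !(dotDr, dotNr) !dot_delta !eqxx (eq_sym j i) in h1 h2.
  move: h1 h2; set q := Q _ + Q _; set T := schouten_mx _ _ _ _; set d := (i == j)%:R.
  have t1 : true%:R = 1 :> R by [].
  rewrite t1 !mulrDr !mulrN !mulrA !mulr1; move: (C * E) => e; rewrite !ler_norml.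
  clearbody q T d; clear => /andP[a1 a2] /andP[b1 b2]; apply/andP; split; lra.
(* The sign of C is read off a diagonal coefficient. In dimension 0 there is none, but all vectors
   vanish and both sides are 0. *)
have CE : 0 <= C * E \/ n = 0%N.
  have [n0|n0] := posnP n; [by right|left].
  by apply: le_trans (TM (Ordinal n0) (Ordinal n0)).
case: CE => [CE|n0]; last first.
  have n1 (a : 'rV[R]_n) : a = 0 by apply/rowP => i; suff : false by []; have := leq_ltn_trans (leq0n i) (ltn_ord i); rewrite n0.
  rewrite (riem4_conf _ _ _ _ oU sf Uy) (n1 u) (n1 v) (n1 w) (n1 z) !dot0l !mul0r !subr0 addr0 mulr0 normr0.
  by rewrite conf_norm dot0l sqrtr0 !mulr0.
have bT a b : `|schouten_bil f y a b| <= n%:R ^+ 2 * (C * E) * (Num.sqrt (dot a a) * Num.sqrt (dot b b)).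
  exact: sum_abs_le2.
rewrite (riem4_conf _ _ _ _ oU sf Uy) !conf_norm -/E normrM (gtr0_norm E0).
set nu := Num.sqrt (dot u u); set nv := Num.sqrt (dot v v); set nw := Num.sqrt (dot w w).
set nz := Num.sqrt (dot z z).
pose B := n%:R ^+ 4 * (C * E) * (nu * nv * nw * nz).
have bb (a b c d : 'rV[R]_n) : `|dot a b * schouten_bil f y c d| <= n%:R ^+ 4 * (C * E) *
   ((Num.sqrt (dot a a) * Num.sqrt (dot b b)) * (Num.sqrt (dot c c) * Num.sqrt (dot d d))).
  rewrite normrM (le_trans (ler_pM _ _ (dot_abs_le a b) (bT c d))) //.
  rewrite le_eqVlt; apply/orP; left; apply/eqP; ring.
have b1 := bb v z u w; have b2 := bb v w u z; have b3 := bb u z v w; have b4 := bb u w v z.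
rewrite -/nu -/nv -/nw -/nz in b1 b2 b3 b4.
have tot : `|dot v z * schouten_bil f y u w - dot v w * schouten_bil f y u z -
  dot u z * schouten_bil f y v w + dot u w * schouten_bil f y v z| <= 4 * B.
  rewrite (le_trans (ler_normD _ _)) // (le_trans (lerD (ler_normB _ _) (lexx _))) //.
  rewrite (le_trans (lerD (lerD (ler_normB _ _) (lexx _)) (lexx _))) //.
  rewrite (le_trans (lerD (lerD (lerD b1 b2) b3) b4)) // le_eqVlt; apply/orP; left; apply/eqP.
  by rewrite /B; ring.
rewrite (le_trans (ler_wpM2l (ltW E0) tot)) // le_eqVlt; apply/orP; left; apply/eqP.
by rewrite /B EE; ring.
Qed.

End ConformalCurvature.

(** * Extension along segments *)

(** The open-closed argument on [0, 1]: at the supremum T of the parameters up to which P holds, the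
    limit hypothesis gives P T, and if T < 1 the step hypothesis would extend P beyond T. *)
Lemma real_induction (R : realType) (P : R -> Prop) :
  P 0 ->
  (forall t, 0 < t <= 1 -> (forall s, 0 <= s < t -> P s) -> P t) ->
  (forall t, 0 <= t < 1 -> (forall s, 0 <= s <= t -> P s) ->
    exists2 e, 0 < e & forall s, t < s < t + e -> P s) ->
  forall t, 0 <= t <= 1 -> P t.
Proof.
move=> P0 Plim Pstep.
pose E : set R := [set t | 0 <= t <= 1 /\ forall s, 0 <= s <= t -> P s].
have E0 : E 0.
  by split=> [|s /andP[s0 s1]]; rewrite ?lexx ?ler01 // (_ : s = 0) //; apply/eqP; rewrite eq_le s1.
have ubE : ubound E 1 by move=> t [/andP[]].
have hE : has_sup E by split; [exists 0|exists 1].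
pose T := sup E.
have T0 : 0 <= T by exact: (sup_upper_bound hE).
have T1 : T <= 1 by apply: ge_sup => //; exists 0.
have below s : 0 <= s < T -> P s.
  move=> /andP[s0 sT]; have := @sup_adherent _ E (T - s).
  rewrite subr_gt0 => /(_ sT hE)[t [_ tP]]; rewrite subKr => st.
  by apply: tP; rewrite s0 ltW.
have PT : P T.
  have [T0'|T0'] := ltP 0 T; first by apply: Plim; rewrite ?T0'.
  by have -> : T = 0 by apply/eqP; rewrite eq_le T0' T0.
have upto s : 0 <= s <= T -> P s.
  by move=> /andP[s0]; rewrite le_eqVlt => /orP[/eqP-> //|sT]; apply: below; rewrite s0.
have [T1'|T1'] := ltP T 1; last first.
  by move=> t /andP[t0 t1]; apply: upto; rewrite t0 (le_trans t1).
have [|e e0 he] := Pstep T _ upto; first by rewrite T0.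
pose t := Num.min 1 (T + e / 2).
have e2 : 0 < e / 2 by rewrite divr_gt0.
have e2e : e / 2 < e by rewrite ltr_pdivrMr // mulr_natr mulr2n ltrDl.
have Tt : T < t by rewrite lt_min T1' ltrDl.
have Et : E t.
  split; first by rewrite (le_trans T0 (ltW Tt)) ge_min lexx.
  move=> s /andP[s0 st]; have [sT|sT] := leP s T; first by apply: upto; rewrite s0.
  apply: he; rewrite sT (le_lt_trans st) //.
  by rewrite (@le_lt_trans _ _ (T + e / 2)) ?ge_min ?lexx ?orbT // ltrD2l.
have := sup_upper_bound hE Et; rewrite -/T => tT.
by rewrite ltNge tT in Tt.
Qed.

(** The difference of [h] and the comparison parabola has derivative [dq], which is nonnegative by
    the mean value theorem for [h1]; a second application, to the difference itself, concludes. *)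
Lemma quadratic_lower_bound (R : realType) (h h1 h2 : R -> R) (t K : R) :
  0 <= t ->
  (forall s, 0 <= s <= t -> is_derive s 1 h (h1 s)) ->
  (forall s, 0 <= s <= t -> is_derive s 1 h1 (h2 s)) ->
  (forall s, 0 <= s <= t -> - K <= h2 s) ->
  h 0 + h1 0 * t - K / 2 * t ^+ 2 <= h t.
Proof.
rewrite le_eqVlt => /orP[/eqP <- _ _ _|t0 dh dh1 hK].
  by rewrite expr2 !mulr0 addr0 subr0.
pose q s := h s - (h1 0 * s - K / 2 * s ^+ 2).
pose dq s := h1 s - (h1 0 - K * s).
have qd s : 0 <= s <= t -> is_derive s 1 q (dq s).
  move=> hs; apply: is_deriveB; first exact: dh.
  have di : is_derive s 1 (@id R) 1 by exact: is_derive_id.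
  have d1 := is_deriveZ (h1 0) di; have d2 := is_deriveZ (K / 2) (is_deriveX 2 di).
  have d3 := is_deriveB d1 d2.
  apply: (is_derive_eq d3).
  by rewrite /= !/(_ *: _) /= mulr1 expr1 mulr1; field.
have cont (g dg : R -> R) : (forall s, 0 <= s <= t -> is_derive s 1 g (dg s)) ->
    forall u, 0 <= u <= t -> {within `[0, u], continuous g}.
  move=> gd u /andP[u0 ut]; apply: derivable_within_continuous => s; rewrite in_itv /= => /andP[s0 su].
  by apply: ex_derive; apply: gd; rewrite s0 (le_trans su).
have inner (g dg : R -> R) u : (forall s, 0 <= s <= t -> is_derive s 1 g (dg s)) -> u <= t ->
    forall s, s \in `]0, u[ -> is_derive s 1 g (dg s).
  move=> gd ut s; rewrite in_itv /= => /andP[s0 su]; apply: gd.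
  by rewrite (ltW s0) (le_trans (ltW su)).
have tt : 0 <= t <= t by rewrite lexx ltW.
have [c] := MVT t0 (inner _ _ _ qd (lexx t)) (cont _ _ qd t tt).
rewrite in_itv /= => /andP[c0 ct] E.
have cc : 0 <= c <= t by rewrite !ltW.
have [d] := MVT c0 (inner _ _ _ dh1 (ltW ct)) (cont _ _ dh1 c cc).
rewrite in_itv /= => /andP[d0 dc] E1.
have dq0 : 0 <= dq c.
  have hd : - K <= h2 d by apply: hK; rewrite (ltW d0) (le_trans (ltW dc)) // ltW.
  have : - K * c <= h2 d * c by rewrite ler_wpM2r // ltW.
  by rewrite /dq; rewrite subr0 in E1; move: E1; lra.
have : 0 <= q t - q 0 by rewrite E mulr_ge0 // subr0 ltW.
have -> : q 0 = h 0 by rewrite /q expr0n /= !mulr0 !subr0.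
by rewrite /q; lra.
Qed.

Lemma near_norm (R : realType) (V : normedModType R) (a : V) (P : V -> Prop) :
  (\forall x \near a, P x) -> exists2 d : R, 0 < d & forall x, `|x - a| < d -> P x.
Proof.
move=> /nbhs_ballP[d /= d0 dP]; exists d => // x xd; apply: dP.
by rewrite -ball_normE /= distrC.
Qed.

Lemma absorb_half (R : realFieldType) (r K a t : R) :
  - a <= t -> a <= r / 2 * K -> r / 2 * K <= r * K + t.
Proof.
move=> h1 h2; have -> : r * K + t = r / 2 * K + (r / 2 * K + t) by field.
by rewrite lerDl -lerBlDl sub0r (le_trans _ h1) // lerN2.
Qed.

Lemma pos_part_bound (R : realFieldType) (c D h S k : R) : 0 < c ->
  7 / 8 * c + D <= h -> k <= D -> h <= S -> k <= S.
Proof. lra. Qed.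

Section SegmentLemma.
Context (R : realType) (n : nat) (U : set 'rV[R]_n) (w : 'rV[R]_n -> R) (C : R).
Hypotheses (oU : open U) (sw : smooth_on U w) (C0 : 0 < C)
  (hess_w : forall y v, U y -> - (C * dot v v) <= w y * 'D_v (fun z => 'D_v w z) y)
  (compl : forall z v c, 0 < c ->
     (forall t, 0 <= t < 1 -> U (z + t *: v) /\ c <= w (z + t *: v)) -> U (z + v)).

(** A continuity argument. As long as w >= c / 2 on the segment, its second derivative there is at
    least - c / 4, hence w >= c - c / 4 - c / 8 > c / 2: the bound improves itself and cannot be
    lost. [compl] expresses completeness of the metric w^-2 |dy|^2 on segments: where w is bounded
    below the length is finite, so the segment cannot leave U. *)
Lemma segment_extension z v c : 0 < c -> U z -> c <= w z -> C * dot v v <= c ^+ 2 / 8 ->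
  - (c / 4) <= 'D_v w z -> U (z + v) /\ 7 / 8 * c + 'D_v w z <= w (z + v).
Proof.
move=> c0 Uz wz hv hD.
have c2 : 0 < c / 2 by rewrite divr_gt0.
pose P t := U (z + t *: v) /\ c / 2 <= w (z + t *: v).
have est t : 0 <= t <= 1 -> (forall s, 0 <= s <= t -> P s) ->
    w z + 'D_v w z * t - c / 8 * t ^+ 2 <= w (z + t *: v).
  move=> /andP[t0 t1] hP.
  have := @quadratic_lower_bound _ (fun s => w (z + s *: v)) (fun s => 'D_v w (z + s *: v))
    (fun s => 'D_v (fun y => 'D_v w y) (z + s *: v)) t (c / 4) t0.
  rewrite scale0r addr0 => H.
  have -> : c / 8 = c / 4 / 2 by field.
  apply: H.
  - by move=> s /hP[Us _]; apply: is_derive_line; exact: (smooth_differentiable sw).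
  - move=> s /hP[Us _]; apply: is_derive_line.
    exact: (smooth_differentiable (smooth_derive v sw)).
  - move=> s /hP[Us ws]; have H1 := hess_w v Us.
    have w0 : 0 < w (z + s *: v) by exact: lt_le_trans ws.
    rewrite -(ler_pM2l w0); apply: le_trans H1; rewrite mulrN lerN2.
    rewrite (le_trans hv) // (@le_trans _ _ (c / 2 * (c / 4))) //.
      by rewrite le_eqVlt; apply/orP; left; apply/eqP; field.
    by rewrite ler_wpM2r // divr_ge0 // ltW.
have est' t : 0 <= t <= 1 -> (forall s, 0 <= s <= t -> P s) -> c / 2 < w (z + t *: v).
  move=> t01 hP; apply: lt_le_trans (est t t01 hP); move/andP: t01 => [t0 t1].
  have a1 : - (c / 4) <= 'D_v w z * t.
    rewrite (@le_trans _ _ (- (c / 4) * t)) //; last by rewrite ler_wpM2r.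
    by rewrite mulNr lerN2 ler_piMr // divr_ge0 // ltW.
  have a2 : c / 8 * t ^+ 2 <= c / 8.
    by rewrite ler_piMr ?divr_ge0 ?(ltW c0) // exprn_ile1.
  by move: a1 a2 wz c0; lra.
have cw t : U (z + t *: v) -> {for t, continuous (fun s : R => w (z + s *: v))}.
  move=> Ut; apply: differentiable_continuous; apply/derivable1_diffP.
  by apply: ex_derive; apply: is_derive_line; exact: (smooth_differentiable sw).
have cl t : {for t, continuous (fun s : R => z + s *: v)}.
  apply: differentiable_continuous; apply/derivable1_diffP; apply: ex_derive.
  by apply: (@is_derive_line _ _ _ id).
have all_P t : 0 <= t <= 1 -> P t.
  apply: real_induction t.
  - by rewrite /P scale0r addr0; split=> //; rewrite (le_trans _ wz) // ler_pdivrMr // ler_peMr ?ltW // ltr1n.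
  (* Membership in U at the limit comes from [compl] for the shorter segment of direction t v; the
     lower bound on w then passes to the limit by continuity. *)
  - move=> t /andP[t0 t1] hP; have Ut : U (z + t *: v).
      apply: (@compl z (t *: v) (c / 2) c2) => s /andP[s0 s1]; rewrite scalerA.
      by apply: hP; rewrite mulr_ge0 ?(ltW t0) //= gtr_pMl.
    split=> //; rewrite leNgt; apply/negP => wt.
    have [e /= e0 he] : exists2 e : R, 0 < e & forall s, `|s - t| < e -> w (z + s *: v) < c / 2.
      have : \forall s \near t, w (z + s *: v) < c / 2 by apply: (cvgr_lt _ (cw t Ut)).
      by move=> /nbhs_ballP[e /= e0 he]; exists e => // s se; apply: he; rewrite -ball_normE /= distrC.
    pose s := Num.max 0 (t - e / 2).
    have st : s < t by rewrite gt_max t0 ltrBlDr ltrDl divr_gt0.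
    have s0t : 0 <= s < t by rewrite st le_max lexx.
    have [_] := hP s s0t.
    rewrite leNgt => /negP; apply; apply: he.
    rewrite ltr0_norm ?subr_lt0 // opprB ltrBlDr -ltrBlDl lt_max; apply/orP; right.
    by rewrite ltrD2l ltrN2 ltr_pdivrMr // mulr_natr mulr2n ltrDl.
  - move=> t /andP[t0 t1] hP.
    have tt : 0 <= t <= t by rewrite t0 lexx.
    have [Ut _] := hP t tt.
    have wt := est' t; rewrite t0 (ltW t1) in wt; have {}wt := wt isT hP.
    have : \forall s \near t, c / 2 < w (z + s *: v) by apply: (cvgr_gt _ (cw t Ut)).
    have : \forall s \near t, U (z + s *: v).
      by apply: (cl t); exact: open_nbhs_nbhs.
    move=> h1 h2; have [e e0 he] := near_norm (filterI h1 h2).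
    exists e => // s /andP[ts se]; have [|? ?] := he s; last by split=> //; exact: ltW.
    by rewrite gtr0_norm ?subr_gt0 // ltrBlDl.
have z1 : 0 <= (1 : R) <= 1 by rewrite ler01 lexx.
have P1 : forall s, 0 <= s <= 1 -> P s by [].
have [U1 _] := all_P 1 z1; have := est 1 z1 P1.
rewrite scale1r mulr1 expr1n mulr1 in U1 * => e1; split=> //.
by apply: le_trans e1; move: wz; lra.
Qed.

Lemma dot_norm_le (v : 'rV[R]_n) : dot v v <= n%:R * `|v| ^+ 2.
Proof.
rewrite -sum_const_ord; apply: ler_sum => i _; rewrite -expr2 -[v 0 i ^+ 2]ger0_norm ?sqr_ge0 //.
rewrite normrX lerXn2r ?nnegrE // [leRHS]/Num.Def.normr /= mx_normrE.
exact: (le_bigmax _ (fun ij => `|v ij.1 ij.2|) (0, i)).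
Qed.

Lemma coord_norm_le (v : 'rV[R]_n) i : `|v 0 i| <= `|v|.
Proof.
rewrite [leRHS]/Num.Def.normr /= mx_normrE.
exact: (le_bigmax _ (fun ij => `|v ij.1 ij.2|) (0, i)).
Qed.

(* The points y0 +- r e_i, reached from z by segments along which w increases,
   bound the gradient of w at z. *)
Lemma superlevel_closed (c : R) (y0 : 'rV[R]_n) : (0 < n)%N -> 0 < c ->
  (forall d : R, 0 < d -> exists z, [/\ U z, `|z - y0| < d & c <= w z]) -> U y0.
Proof.
move=> n0 c0 near_y0.
have nR : 1 <= n%:R :> R by rewrite ler1n.
have nR0 : 0 < n%:R :> R by rewrite ltr0n.
(* A makes every vector of norm at most 2 r admissible in [segment_extension]: C n (2 r)^2 <= c^2 /
   8. Taking r <= 1 gives r^2 <= r and avoids a square root. *)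
pose A := 32 * n%:R * C; have A0 : 0 < A by rewrite !mulr_gt0.
pose r := Num.min 1 (c ^+ 2 / A).
have r0 : 0 < r by rewrite lt_min ltr01 divr_gt0 ?exprn_gt0.
have hr (v : 'rV[R]_n) : `|v| <= 2 * r -> C * dot v v <= c ^+ 2 / 8.
  move=> vr; rewrite (@le_trans _ _ (C * (n%:R * (2 * r) ^+ 2))) //.
    rewrite ler_wpM2l ?(ltW C0) // (le_trans (dot_norm_le v)) // ler_wpM2l ?(ltW nR0) //.
    by rewrite lerXn2r ?nnegrE // mulr_ge0 // ltW.
  have rr : r ^+ 2 <= c ^+ 2 / A.
    rewrite expr2 (@le_trans _ _ (1 * r)) //.
      by rewrite ler_wpM2r ?(ltW r0) // ge_min lexx.
    by rewrite mul1r ge_min lexx orbT.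
  have -> : C * (n%:R * (2 * r) ^+ 2) = A / 8 * r ^+ 2 by rewrite /A; field.
  rewrite (@le_trans _ _ (A / 8 * (c ^+ 2 / A))) //.
    by rewrite ler_wpM2l // divr_ge0 // ltW.
  by rewrite le_eqVlt; apply/orP; left; apply/eqP; field; rewrite gt_eqF.
clearbody r; pose e (i : 'I_n) : 'rV[R]_n := delta_mx 0 i.
(* A candidate bound for the gradient that depends on y0 and r but not on z; the values of w make
   sense even though these points are not yet known to lie in U. *)
pose K0 := 2 / r * \sum_i (`|w (y0 + r *: e i)| + `|w (y0 + (- r) *: e i)|).
have K00 : 0 <= K0.
  by rewrite mulr_ge0 ?divr_ge0 ?(ltW r0) // sumr_ge0 // => i _; rewrite addr_ge0.
(* The first bound keeps the displacement y0 - z from spoiling more than half of the ascent r K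
   along e_i. The second limits the descent of w from z to y0 to c / 4; K0 + 1 prevents a division
   by zero. *)
pose d := Num.min (r / (2 * n%:R)) (c / (4 * n%:R * (K0 + 1))).
have K01 : 0 < K0 + 1 by rewrite ltr_wpDl.
have d0 : 0 < d by rewrite lt_min !divr_gt0 ?mulr_gt0.
have d1 : n%:R * d <= r / 2.
  rewrite (@le_trans _ _ (n%:R * (r / (2 * n%:R)))) //.
    by rewrite ler_wpM2l ?(ltW nR0) // ge_min lexx.
  by rewrite le_eqVlt; apply/orP; left; apply/eqP; field; rewrite gt_eqF.
have d2 : n%:R * d * K0 <= c / 4.
  rewrite (@le_trans _ _ (n%:R * (c / (4 * n%:R * (K0 + 1))) * (K0 + 1))) //.
    apply: ler_pM => //; rewrite ?mulr_ge0 ?(ltW nR0) ?(ltW d0) ?lerDl //.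
    by rewrite ler_wpM2l ?(ltW nR0) // ge_min lexx orbT.
  by rewrite le_eqVlt; apply/orP; left; apply/eqP; field; rewrite !gt_eqF.
have dr : d <= r.
  have : d <= n%:R * d by rewrite ler_peMl // ltW.
  by move: d1 r0; lra.
clearbody d; have [z [Uz zy wz]] := near_y0 d d0.
have dw := smooth_differentiable sw Uz.
pose i0 : 'I_n := Ordinal n0.
have [i _ imax] : exists2 i : 'I_n, true & forall j, `|partial j w z| <= `|partial i w z|.
  by case: (@Order.TotalTheory.arg_maxP _ _ _ i0 xpredT (fun j => `|partial j w z|)) => // i _ h; exists i => // j; apply: h.
set K := `|partial i w z| in imax.
have Kp : 0 <= K by exact: normr_ge0.
have KE : `|partial i w z| = K by [].
clearbody K.
have grad (v : 'rV[R]_n) : `|v| <= d -> `|'D_v w z| <= n%:R * d * K.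
  move=> vd; rewrite (derive_coord v dw) (le_trans (ler_norm_sum _ _ _)) //.
  rewrite -mulrA -sum_const_ord; apply: ler_sum => j _; rewrite normrM.
  by apply: ler_pM => //; exact: le_trans (coord_norm_le v j) vd.
have yz : `|y0 - z| <= d by rewrite distrC ltW.
have Kle : K <= K0.
  (* The segment from z to y0 + r s e_i, with s the sign of the largest partial derivative, has w
     ascending at rate at least r K / 2, so w at its end is at least that large. *)
  pose s : R := if 0 <= partial i w z then 1 else -1.
  have sK : s * partial i w z = K.
    by rewrite /s -KE; case: ifPn => [h|]; [rewrite mul1r ger0_norm|rewrite -ltNge => h; rewrite mulN1r ltr0_norm].
  have s1 : `|s| = 1 by rewrite /s; case: ifP => _; rewrite ?normrN normr1.
  pose v := (r * s) *: e i + (y0 - z).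
  have vr : `|v| <= 2 * r.
    rewrite (le_trans (ler_normD _ _)) // mulr_natl mulr2n lerD //; last exact: le_trans yz dr.
    rewrite normrZ normrM s1 mulr1 (gtr0_norm r0) ler_piMr ?(ltW r0) //.
    rewrite [leLHS]/Num.Def.normr /= mx_normrE bigmax_le // => -[a b] _ /=.
    by rewrite mxE; case: (_ && _); rewrite ?normr1 ?normr0.
  have hD : r / 2 * K <= 'D_v w z.
    have -> : 'D_v w z = r * K + 'D_(y0 - z) w z.
      by rewrite /v (derive_linear _ _ _ dw) -sK /partial mulrA.
    have := grad _ yz; rewrite ler_norml => /andP[h _].
    exact: absorb_half h (ler_wpM2r Kp d1).
  have hD0 : - (c / 4) <= 'D_v w z.
    by rewrite (le_trans _ hD) // (@le_trans _ _ 0) // ?oppr_le0 ?mulr_ge0 ?divr_ge0 ?(ltW r0) ?(ltW c0).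
  have [_] := segment_extension c0 Uz wz (hr v vr) hD0.
  have -> : z + v = y0 + (r * s) *: e i by rewrite /v addrCA [z + _]addrC subrK addrC.
  move=> h.
  have h2 : r / 2 * K <= `|w (y0 + r *: e i)| + `|w (y0 + (- r) *: e i)|.
    have h3 : w (y0 + (r * s) *: e i) <= `|w (y0 + r *: e i)| + `|w (y0 + (- r) *: e i)|.
      rewrite /s; case: ifP => _; rewrite ?mulr1 ?mulrN1.
        by rewrite (le_trans (ler_norm _)) // lerDl.
      by rewrite (le_trans (ler_norm _)) // lerDr.
    exact: pos_part_bound c0 h hD h3.
  have h4 : r / 2 * K <= \sum_i (`|w (y0 + r *: e i)| + `|w (y0 + (- r) *: e i)|).
    rewrite (le_trans h2) // [leRHS](bigD1 i) //= lerDl.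
    by apply: sumr_ge0 => j _; rewrite addr_ge0.
  have -> : K = 2 / r * (r / 2 * K) by field; rewrite gt_eqF.
  by rewrite /K0 ler_wpM2l // divr_ge0 // ltW.
(* Now that the gradient is bounded by K0, the segment from z to y0 itself is admissible. *)
have hD : - (c / 4) <= 'D_(y0 - z) w z.
  have := grad _ yz; rewrite ler_norml => /andP[h _]; rewrite (le_trans _ h) // lerN2.
  by rewrite (le_trans _ d2) // ler_wpM2l // mulr_ge0 ?(ltW nR0) ?(ltW d0).
have vr : `|y0 - z| <= 2 * r by rewrite (le_trans yz) // (le_trans dr) // ler_peMl ?(ltW r0) // ler1n.
by have [] := segment_extension c0 Uz wz (hr _ vr) hD; rewrite addrC subrK.
Qed.

End SegmentLemma.

(** * Transfer of completeness *)

Section IntegralScale.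
Import HBNNSimple.

(* No measurability is needed: the integral of a nonnegative function is a
   supremum over the simple functions below it. *)
Lemma ge0_integral_scale_le d (T : measurableType d) (R : realType)
    (mu : {measure set T -> \bar R}) (D : set T) (f g : T -> \bar R) (K : R) :
  0 < K -> (forall x, D x -> (0 <= f x)%E) -> (forall x, D x -> (0 <= g x)%E) ->
  (forall x, D x -> (f x <= K%:E * g x)%E) ->
  (\int[mu]_(x in D) f x <= K%:E * \int[mu]_(x in D) g x)%E.
Proof.
move=> K0 f0 g0 fg; rewrite !ge0_integralE //.
apply: ge_ereal_sup => _ [h /= hf <-].
have Ki : 0 <= K^-1 by rewrite invr_ge0 ltW.
pose h' := scale_nnsfun h Ki.
have -> : sintegral mu h = (K%:E * sintegral mu h')%E.
  have -> : sintegral mu h' = (K^-1%:E * sintegral mu h)%E.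
    by rewrite -sintegralrM; congr sintegral; apply/funext => x.
  by rewrite muleA -EFinM divff ?gt_eqF // mul1e.
rewrite lee_pmul2l //; apply: ereal_sup_ubound; exists h' => // x.
have := hf x; rewrite !patchE; case: ifPn => [xD|_] hx.
  have Dx : D x by rewrite inE in xD.
  rewrite -(@lee_pmul2l _ K%:E) //; apply: le_trans (fg x Dx); apply: le_trans hx.
  by rewrite -EFinM lee_fin /h' /= mulrA divff ?gt_eqF // mul1r.
rewrite lee_fin in hx; rewrite /h' /=.
change ((K^-1 * h x)%:E <= 0%:E)%E.
by rewrite lee_fin mulr_ge0_le0.
Qed.

End IntegralScale.

Lemma speed_ge0 (R : realType) (T : Type) (g : pmetric R T) gam t : 0 <= speed g gam t.
Proof. exact: sqrtr_ge0. Qed.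

Section Transfer.
Context (R : realType) (n n' : nat) (T T' : Type) (A : set (lparam R n T))
  (A' : set (lparam R n' T')) (g : pmetric R T) (g' : pmetric R T') (F : T' -> T) (K : R).
Hypotheses (K0 : 0 < K)
  (HF : forall gam t, C1_at A' gam t -> C1_at A (F \o gam) t /\
     speed g (F \o gam) t <= K * speed g' gam t).

Let joins_map s p q : joins A' s p q ->
  joins A (map (fun gam => F \o gam) s) (F p) (F q) /\
  (curve_length g (map (fun gam => F \o gam) s) <= K%:E * curve_length g' s)%E.
Proof.
elim: s p => [|gam s IH] p /=; first by move=> ->; rewrite /curve_length !big_nil mule0.
move=> [hC h0 /IH[js ls]]; split.
  by split=> // [t /hC /HF[]|]; rewrite /= ?h0.
rewrite /curve_length !big_cons ge0_muleDr.
- apply: leeD; last exact: ls.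
  apply: ge0_integral_scale_le => //.
  - by move=> t _; rewrite lee_fin speed_ge0.
  - by move=> t _; rewrite lee_fin speed_ge0.
  - move=> t; rewrite /= in_itv /= => /hC /HF[_ h].
    by rewrite -EFinM lee_fin.
- by apply: integral_ge0 => t _; rewrite lee_fin speed_ge0.
- by apply: sume_ge0 => gam' _; apply: integral_ge0 => t _; rewrite lee_fin speed_ge0.
Qed.

Lemma riem_dist_transfer p q (e : R) :
  (riem_dist A' g' p q < e%:E)%E -> (riem_dist A g (F p) (F q) < (K * e)%:E)%E.
Proof.
move=> /ereal_inf_lt[_ [s js ->] le]; have [js' ls'] := joins_map js.
apply: (@le_lt_trans _ _ (curve_length g (map (fun gam => F \o gam) s))).
  by apply: ereal_inf_lbound; exists (map (fun gam => F \o gam) s).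
by apply: (le_lt_trans ls'); rewrite EFinM lte_pmul2l.
Qed.

End Transfer.

(** F maps curves to curves at most K times as long, hence Cauchy sequences to Cauchy sequences.
    Only F \o u is shown to converge; bringing the limit back to T' is left to the user, F being the
    identity in one application and the inverse Gauss map in the other. *)
Lemma complete_transfer (R : realType) n n' (T T' : topologicalType) (A : set (lparam R n T))
    (A' : set (lparam R n' T')) (g : pmetric R T) (g' : pmetric R T') (F : T' -> T) (K : R) :
  0 < K ->
  (forall gam t, C1_at A' gam t -> C1_at A (F \o gam) t /\
     speed g (F \o gam) t <= K * speed g' gam t) ->
  (forall p, points A' p -> points A (F p)) ->
  complete_metric A g ->
  forall u : nat -> T', (forall k, points A' (u k)) ->
    (forall e : R, 0 < e -> exists N : nat, forall i j : nat,
       (N <= i)%N -> (N <= j)%N -> (riem_dist A' g' (u i) (u j) < e%:E)%E) ->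
  exists2 p, points A p & (F \o u) @ \oo --> p.
Proof.
move=> K0 HF pF cA u pu cu; apply: cA => [k|e e0]; first exact: pF.
have [|N hN] := cu (e / K); first by rewrite divr_gt0.
exists N => i j Ni Nj; have := riem_dist_transfer K0 HF (hN i j Ni Nj).
by rewrite mulrC divfK ?gt_eqF.
Qed.

Lemma riem_dist_le (R : realType) n (T : Type) (A : set (lparam R n T)) (g : pmetric R T)
    (gam : R -> T) (c : R) : 0 <= c ->
  (forall t, 0 <= t <= 1 -> C1_at A gam t /\ speed g gam t <= c) ->
  (riem_dist A g (gam 0%R) (gam 1%R) <= c%:E)%E.
Proof.
move=> c0 h; apply: (@le_trans _ _ (curve_length g [:: gam])).
  by apply: ereal_inf_lbound; exists [:: gam] => //=; split=> // t /h[].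
rewrite /curve_length big_seq1.
have ic : (\int[@lebesgue_measure R]_(t in `[0%R, 1%R]) cst c%:E t = c%:E)%E.
  rewrite integral_cst //= lebesgue_measure_itv /= lte_fin ltr01.
  by rewrite -EFinB subr0 mule1.
rewrite -ic -[leRHS]mul1e; apply: ge0_integral_scale_le => //.
- by move=> t _; rewrite lee_fin speed_ge0.
- by move=> t; rewrite /= in_itv /= mul1e lee_fin => /h[].
Qed.

(** * Inverse stereographic charts and the atlas of an open subset of the sphere *)

Definition stereo_inv (R : realType) n (b : bool) (x : 'rV[R]_(1 + n)) : 'rV[R]_n :=
  (1 - chart_sign R b * time x)^-1 *: rsubmx x.

Lemma stereo_vec (R : realType) n b (y : 'rV[R]_n) :
  stereo b y = vec ((1 + dot y y)^-1 * (chart_sign R b * (dot y y - 1))) (lam y *: y).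
Proof. by rewrite /stereo vecZ scalerA /lam [2 / _]mulrC. Qed.

Lemma stereo_den (R : realType) n b (y : 'rV[R]_n) :
  1 - chart_sign R b * time (stereo b y) = lam y.
Proof.
rewrite stereo_vec vecE0 /lam mulrCA [_ * (_ * (_ - 1))]mulrA chart_sign2.
by field; rewrite gt_eqF // lam_den.
Qed.

Lemma stereoK (R : realType) n b : cancel (@stereo R n b) (@stereo_inv R n b).
Proof.
move=> y; rewrite /stereo_inv stereo_den [rsubmx _](_ : _ = lam y *: y).
  by rewrite scalerA mulVf ?scale1r // gt_eqF // lam_gt0.
by rewrite stereo_vec vecEr.
Qed.

Lemma stereo_invK (R : realType) n b (x : 'rV[R]_(1 + n)) :
  dot x x = 1 -> 1 - chart_sign R b * time x != 0 -> stereo b (stereo_inv b x) = x.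
Proof.
have xE := vec_eta x; rewrite xE /stereo_inv !vecE0 !vecEr dot_vec => {xE}.
move: (time x) (rsubmx x) => a y hx h0.
have s2 := chart_sign2 R b; set s := chart_sign R b in h0 s2 *.
have yy : dot y y = (1 - s * a) * (1 + s * a).
  have -> : (1 - s * a) * (1 + s * a) = 1 - s * s * (a * a) by ring.
  by rewrite s2 mul1r -hx [a * a + _]addrC addrK.
set k := (1 - s * a)^-1; have kE : k * (1 - s * a) = 1 by rewrite mulVf.
have dE : dot (k *: y) (k *: y) = k * (1 + s * a).
  by rewrite dotZl dotZr yy [k * ((1 - s * a) * _)]mulrA kE mul1r.
have d1 : 1 + dot (k *: y) (k *: y) = 2 * k.
  by rewrite dE -{1}kE; ring.
have k0 : k != 0 by rewrite invr_eq0.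
rewrite stereo_vec /lam d1 dE scalerA; congr vec.
  have -> : k * (1 + s * a) - 1 = 2 * k * (s * a) by rewrite -{2}kE; ring.
  transitivity (s * s * a); last by rewrite s2 mul1r.
  by rewrite -/s; field.
by rewrite -[RHS]scale1r; congr (_ *: _); field.
Qed.

Lemma smooth_stereo_inv (R : realType) n b :
  open [set x : 'rV[R]_(1 + n) | 1 - chart_sign R b * time x != 0] /\
  smooth_on [set x | 1 - chart_sign R b * time x != 0] (@stereo_inv R n b).
Proof.
have st (U : set 'rV[R]_(1 + n)) : open U -> smooth_on U (fun x => 1 - chart_sign R b * time x).
  move=> oU; have sx : smooth_on U (fun x : 'rV[R]_(1 + n) => time x) by exact: smooth_coord.
  apply: smoothD => //; first exact: smooth_cst.
  by apply: smoothN => //; apply: smoothM => //; exact: smooth_cst.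
have oU : open [set x : 'rV[R]_(1 + n) | 1 - chart_sign R b * time x != 0].
  have -> : [set x : 'rV[R]_(1 + n) | 1 - chart_sign R b * time x != 0] =
    (fun x => 1 - chart_sign R b * time x) @^-1` [set t | t != 0] by [].
  apply: open_comp; last exact: open_neq.
  by move=> x _; apply: (smooth_continuous (st setT openT)).
split=> //; apply: smooth_scale => //; first by apply: smooth_inv => //; exact: st.
by apply: smooth_rsubmx => //; exact: smooth_id.
Qed.

Lemma chart_exists (R : realType) n (x : 'rV[R]_(1 + n)) :
  exists b, 1 - chart_sign R b * time x != 0.
Proof.
have [h|h] := eqVneq (time x) 1.
  by exists true; rewrite /chart_sign h expr1 mulN1r opprK.
by exists false; rewrite /chart_sign expr0 mul1r subr_eq0 eq_sym.
Qed.

Lemma stereo_den_neq0 (R : realType) n b (y : 'rV[R]_n) :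
  1 - chart_sign R b * time (stereo b y) != 0.
Proof. by rewrite stereo_den gt_eqF // lam_gt0. Qed.

Section SphereAtlas.
Context (R : realType) (n : nat) (Om : set 'rV[R]_(1 + n)).
Hypothesis oOm : open_in_sphere Om.

Lemma Om_sphere x : Om x -> dot x x = 1.
Proof. by have [W _ ->] := oOm => -[]. Qed.

Lemma open_chart b : open (@stereo R n b @^-1` Om).
Proof.
have [W oW ->] := oOm.
have -> : @stereo R n b @^-1` (W `&` sphere R n) = @stereo R n b @^-1` W.
  by apply/seteqP; split=> y /= => [[]//|Wy]; split=> //; exact: stereo_sphere.
apply: open_comp => // y _; apply: (smooth_continuous (smooth_stereo b openT)) => //.
Qed.

Lemma points_sphere : points (sphere_atlas Om) = Om.
Proof.
apply/seteqP; split=> [x [_ [b ->] [y Oy <-]] //|x Ox].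
have [b hb] := chart_exists x.
exists (LParam (@stereo R n b @^-1` Om) (@stereo R n b)); first by exists b.
by exists (stereo_inv b x); rewrite /= stereo_invK //; exact: Om_sphere.
Qed.

Lemma chart_at x : Om x -> exists b, exists2 y, stereo b y = x & y = stereo_inv b x.
Proof.
move=> Ox; have [b hb] := chart_exists x; exists b, (stereo_inv b x) => //.
by rewrite stereo_invK //; exact: Om_sphere.
Qed.

Lemma C1_sphereP gam t0 : C1_at (sphere_atlas Om) gam t0 <->
  exists b, exists y : R -> 'rV[R]_n, \forall t \near t0,
    [/\ Om (stereo b (y t)), gam t = stereo b (y t), derivable y t 1 &
       {for t, continuous (derive1 y)}].
Proof.
split=> [[_ [b ->] [y h]]|[b [y h]]]; first by exists b, y.
by exists (LParam (@stereo R n b @^-1` Om) (@stereo R n b)); [exists b|exists y].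
Qed.

End SphereAtlas.

Lemma derive1_comp_diff (R : realType) (V W : normedModType R) (f : V -> W) (y : R -> V) t :
  differentiable f (y t) -> derivable y t 1 ->
  derivable (f \o y) t 1 /\ derive1 (f \o y) t = 'D_(derive1 y t) f (y t).
Proof.
move=> df /derivable1_diffP dy; split; first by apply/derivable1_diffP; exact: differentiable_comp.
by rewrite !derive1E (derive_comp _ dy df).
Qed.

(** The exponent f for which e^(2 rho) times the round metric reads e^(2f) |dy|^2 in the chart
    [stereo b]. *)
Definition conf_fun (R : realType) n (rho : 'rV[R]_(1 + n) -> R) b (y : 'rV[R]_n) : R :=
  rho (stereo b y) + ln (lam y).

Lemma exp_conf_fun (R : realType) n (rho : 'rV[R]_(1 + n) -> R) b (y : 'rV[R]_n) :
  expR (conf_fun rho b y) = expR (rho (stereo b y)) * lam y.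
Proof. by rewrite expRD lnK // posrE lam_gt0. Qed.

Lemma speed_conformal (R : realType) n (rho : 'rV[R]_(1 + n) -> R) b gam (y : R -> 'rV[R]_n) t :
  (\forall t \near t, gam t = stereo b (y t)) -> derivable y t 1 ->
  speed (conformal_metric rho) gam t =
  expR (conf_fun rho b (y t)) * Num.sqrt (dot (derive1 y t) (derive1 y t)).
Proof.
move=> gE dy; rewrite /speed /=.
have [_ e] := derive1_comp_diff (diff_stereo b (y t)) dy.
have -> : derive1 (id \o gam) t = 'D_(derive1 y t) (stereo b) (y t).
  by rewrite -e !derive1E; apply: near_eq_derive.
have dd := dot_derive_stereo b (y t) (derive1 y t) (derive1 y t).
rewrite dd (nbhs_singleton gE) exp_conf_fun expR2.
rewrite (_ : _ * _ = (expR (rho (stereo b (y t))) * lam (y t)) ^+ 2 * dot (derive1 y t) (derive1 y t)).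
  by rewrite sqrtrM ?sqr_ge0 // sqrtr_sqr ger0_norm // mulr_ge0 ?expR_ge0 // ltW // lam_gt0.
by ring.
Qed.

(** * Compactness of sublevel sets *)

Lemma derive1_line (R : realType) (V : normedModType R) (p u : V) :
  (forall t : R, derivable (fun s : R => p + s *: u) t 1) /\
  derive1 (fun s : R => p + s *: u) = fun _ => u.
Proof.
have h (t : R) : is_derive t (1 : R) (fun s : R => p + s *: u) u.
  have := @is_derive_line R V V id p u t; rewrite derive_id; apply.
  by [].
split=> [t|]; first by apply: ex_derive; exact: h.
by apply/funext => t; rewrite derive1E; case: (h t).
Qed.

Lemma sqrt_dotZ (R : realType) n (a : R) (v : 'rV[R]_n) :
  Num.sqrt (dot (a *: v) (a *: v)) = `|a| * Num.sqrt (dot v v).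
Proof. by rewrite dotZl dotZr mulrA -expr2 sqrtrM ?sqr_ge0 // sqrtr_sqr. Qed.

Lemma dot_self_ge1 (R : realType) n (x : 'rV[R]_n) : dot x x = 1 -> `|x| <= 1.
Proof.
move=> x1; rewrite [leLHS]/Num.Def.normr /= mx_normrE bigmax_le // => -[a b] _ /=.
by rewrite ord1 (le_trans (abs_coord_le x b)) // x1 sqrtr1.
Qed.

Section ConformalDomain.
Context (R : realType) (n : nat) (Om : set 'rV[R]_(1 + n)) (rho : 'rV[R]_(1 + n) -> R).
Hypotheses (oOm : open_in_sphere Om) (srho : smooth_map (sphere_atlas Om) (rho : _ -> R^o)).

Lemma smooth_rho b : smooth_on (@stereo R n b @^-1` Om) (fun y => rho (stereo b y)).
Proof.
by apply: (srho (c := LParam (@stereo R n b @^-1` Om) (@stereo R n b))); exists b.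
Qed.

Lemma smooth_conf b : smooth_on (@stereo R n b @^-1` Om) (conf_fun rho b).
Proof.
have oU := @open_chart _ _ _ oOm b.
apply: smoothD => //; first exact: smooth_rho.
by apply: smooth_ln => // [y _|]; [exact: lam_gt0|exact: smooth_lam].
Qed.

(** Where e^(-f) >= c, the conformal factor e^f is at most 1 / c, so the points with parameters 1 -
    1 / (k + 1) form a Cauchy sequence. Its limit in Om must be the end of the segment. This is the
    hypothesis [compl] of the segment lemmas. *)
Lemma segment_complete b : complete_metric (sphere_atlas Om) (conformal_metric rho) ->
  forall z v (c : R), 0 < c ->
  (forall t, 0 <= t < 1 -> Om (stereo b (z + t *: v)) /\ c <= expR (- conf_fun rho b (z + t *: v))) ->
  Om (stereo b (z + v)).
Proof.
move=> cg z v c c0 hseg; have oU := @open_chart _ _ _ oOm b.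
pose tau (k : nat) : R := 1 - k.+1%:R^-1.
have tau0 k : 0 <= tau k by rewrite subr_ge0 invf_le1 // ler1n.
have tau1 k : tau k < 1 by rewrite ltrBlDr ltrDl invr_gt0.
pose u k := stereo b (z + tau k *: v).
pose D := Num.sqrt (dot v v) / c + 1.
have D0 : 0 < D by rewrite ltr_wpDl // divr_ge0 ?sqrtr_ge0 // ltW.
have dist i j : (riem_dist (sphere_atlas Om) (conformal_metric rho) (u i) (u j) <=
    (`|tau j - tau i| * D)%:E)%E.
  pose w := (tau j - tau i) *: v.
  pose y (s : R) := (z + tau i *: v) + s *: w.
  pose gam s := stereo b (y s).
  have yE s : y s = z + (tau i + s * (tau j - tau i)) *: v.
    by rewrite /y /w scalerA [in RHS]scalerDl addrA.
  have -> : u i = gam 0 by rewrite /gam yE mul0r addr0.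
  have -> : u j = gam 1 by rewrite /gam yE mul1r [tau i + _]addrC subrK.
  have [dy dyE] : (forall t : R, derivable y t 1) /\ derive1 y = fun _ => w by exact: derive1_line.
  have ys s : 0 <= s <= 1 -> Om (gam s) /\ c <= expR (- conf_fun rho b (y s)).
    move=> /andP[s0 s1]; rewrite /gam yE; apply: hseg.
    (* A convex combination of two parameters in [0, 1[ stays there, so the hypothesis covers the
       whole arc between u i and u j. *)
    have e : tau i + s * (tau j - tau i) = (1 - s) * tau i + s * tau j by ring.
    have s1' : 0 <= 1 - s by rewrite subr_ge0.
    rewrite e; apply/andP; split.
      by apply: addr_ge0; apply: mulr_ge0 => //; exact: tau0.
    have [sz|sz] := eqVneq s 0.
      by rewrite sz subr0 mul1r mul0r addr0; exact: tau1.
    have s0' : 0 < s by rewrite lt0r sz.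
    have lt1 : (1 - s) * tau i + s * tau j < (1 - s) * 1 + s * 1.
      apply: ler_ltD; first exact: (ler_wpM2l s1' (ltW (tau1 i))).
      by rewrite ltr_pM2l //; exact: tau1.
    by apply: (lt_le_trans lt1); rewrite !mulr1 subrK.
  apply: riem_dist_le; first by rewrite mulr_ge0 // ltW.
  move=> s s01; have [Os cs] := ys s s01.
  have cy : {for s, continuous y}.
    by apply: differentiable_continuous; apply/derivable1_diffP; exact: dy.
  split.
    apply/C1_sphereP; exists b, y.
    near=> t; split=> //.
    - by near: t; apply: (cy (@stereo R n b @^-1` Om)); exact: open_nbhs_nbhs.
    - by rewrite dyE; exact: cst_continuous.
  rewrite (@speed_conformal R n rho b gam y s) //; last by near=> t.
  rewrite dyE sqrt_dotZ mulrCA ler_wpM2l //.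
  have ec : expR (conf_fun rho b (y s)) <= c^-1.
    by rewrite -[leLHS]invrK -expRN lef_pV2 ?posrE ?expR_gt0.
  rewrite (@le_trans _ _ (c^-1 * Num.sqrt (dot v v))) //.
    by rewrite ler_wpM2r // sqrtr_ge0.
  by rewrite mulrC lerDl.
have [||p pOm up] := cg u.
- move=> k; rewrite points_sphere //.
  by apply: (hseg (tau k) _).1; rewrite tau0 tau1.
- move=> e e0.
  have [N hN] : exists N : nat, N.+1%:R^-1 * D < e.
    have [N _ hN] := near_infty_natSinv_lt (PosNum (divr_gt0 e0 D0)).
    exists N; rewrite -ltr_pdivlMr //; exact: (hN N (leqnn N)).
  exists N => i j Ni Nj; apply: (le_lt_trans (dist i j)); rewrite lte_fin.
  apply: le_lt_trans hN; rewrite ler_wpM2r ?(ltW D0) //.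
  have lo k : (N <= k)%N -> 1 - N.+1%:R^-1 <= tau k.
    by move=> Nk; rewrite lerD2l lerN2 lef_pV2 ?posrE // ler_nat.
  have := lo _ Ni; have := lo _ Nj; have := ltW (tau1 i); have := ltW (tau1 j).
  move: (tau i) (tau j) (N.+1%:R^-1) => a a' q; clear => h1 h2 h3 h4.
  by rewrite ler_norml; apply/andP; split; lra.
have up' : u @ \oo --> stereo b (z + v).
  have ct : (fun k => z + tau k *: v) @ \oo --> z + v.
    apply: cvgD; first exact: cvg_cst.
    rewrite -[X in _ --> X]scale1r; apply: cvgZl.
    rewrite -[X in _ --> X]subr0; apply: cvgB; first exact: cvg_cst.
    exact: cvg_harmonic.
  have cs : stereo b @ (z + v) --> stereo b (z + v).
    by apply: (smooth_continuous (smooth_stereo b openT)).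
  exact: (cvg_comp _ _ ct cs).
have -> : stereo b (z + v) = p by exact: cvg_unique up' up.
by rewrite points_sphere in pOm.
Unshelve. all: by end_near. Qed.

Variable C : R.
Hypotheses (C0 : 0 < C)
  (hT : forall b y, Om (stereo b y) -> forall v,
     schouten (conf_fun rho b) y v <= C * (expR (2 * conf_fun rho b y) * dot v v)).

Let w b y := expR (- conf_fun rho b y).

(** One has w D_vD_v w = w^2 ((D_v f)^2 - D_vD_v f), which is w^2 times minus [schouten] plus the
    nonnegative term |df|^2 |v|^2 / 2. The upper bound of [schouten] by C e^(2f) |v|^2 cancels
    w^2. *)
Let hess_w b y v : Om (stereo b y) -> - (C * dot v v) <= w b y * 'D_v (fun z => 'D_v (w b) z) y.
Proof.
move=> Oy; have oU := @open_chart _ _ _ oOm b; have sf := smooth_conf (b := b).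
have df z : Om (stereo b z) -> differentiable (conf_fun rho b) z.
  by move=> Oz; exact: (smooth_differentiable sf).
have dw z : Om (stereo b z) -> differentiable (w b) z /\
    'D_v (w b) z = -1 * (w b z * 'D_v (conf_fun rho b) z).
  move=> Oz; have [d1 e1] := differentiable_lin (-1) 0 v (df z Oz).
  have [d2 e2] := derive_exp v d1.
  have -> : w b = fun z => expR (-1 * conf_fun rho b z + 0).
    by apply/funext => t; rewrite /w addr0 mulN1r.
  by split=> //; rewrite e2 e1; ring.
have ddf : differentiable (fun z => 'D_v (conf_fun rho b) z) y.
  exact: (smooth_differentiable (smooth_derive v sf)).
have [d3 e3] := derive_mulf v (dw y Oy).1 ddf.
have [d4 e4] := differentiable_lin (-1) 0 v d3.
have E : \forall z \near y, -1 * (w b z * 'D_v (conf_fun rho b) z) + 0 = 'D_v (w b) z.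
  near=> z; rewrite addr0; apply/esym; apply: (dw z _).2.
  by near: z; exact: (open_nbhs_nbhs (conj oU Oy)).
have -> : 'D_v (fun z => 'D_v (w b) z) y =
   w b y * (('D_v (conf_fun rho b) y) ^+ 2 - 'D_v (fun z => 'D_v (conf_fun rho b) z) y).
  rewrite -(near_eq_derive v E) e4 e3 (dw y Oy).2; ring.
have := hT Oy v; rewrite /schouten expR2.
have wE : w b y * expR (conf_fun rho b y) = 1.
  by rewrite /w expRN mulVf // gt_eqF // expR_gt0.
have w0 : 0 < w b y by exact: expR_gt0.
have S0 : 0 <= 2^-1 * (\sum_i partial i (conf_fun rho b) y ^+ 2) * dot v v.
  by rewrite !mulr_ge0 ?dot_ge0 ?invr_ge0 // sumr_ge0 // => i _; exact: sqr_ge0.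
set W := w b y in w0 wE *; set E' := expR (conf_fun rho b y) in wE *.
set d1 := 'D_v (conf_fun rho b) y; set S := 2^-1 * _ * _ in S0 *; set q := dot v v.
set dd := 'D_v _ y; clearbody W E' d1 S q dd => h.
have h2 : W * W * (dd - d1 ^+ 2 + S) <= W * W * (C * (E' * E' * q)).
  by rewrite ler_wpM2l // mulr_ge0 // ltW.
have e5 : W * W * (C * (E' * E' * q)) = C * q.
  have -> : W * W * (C * (E' * E' * q)) = (W * E') * (W * E') * (C * q) by ring.
  by rewrite wE !mul1r.
have h3 : 0 <= W * W * S by rewrite !mulr_ge0 // ltW.
rewrite e5 in h2; move: h2 h3; rewrite mulrDr => h2 h3.
rewrite lerNl; have -> : - (W * (W * (d1 ^+ 2 - dd))) = W * W * (dd - d1 ^+ 2) by ring.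
by rewrite (le_trans _ h2) // lerDl.
Unshelve. all: by end_near. Qed.

Lemma lam_le2 (y : 'rV[R]_n) : lam y <= 2.
Proof. by rewrite /lam ler_pdivrMr ?lam_den // ler_peMr // lerDl dot_ge0. Qed.

(** The sphere being bounded, closedness is the point. In a chart around a limit point, rho <= L and
    lam <= 2 give w >= e^(-(L + ln 2)) at points arbitrarily close to it, so [superlevel_closed]
    puts the limit in Om; continuity of rho then gives rho <= L. *)
Lemma sublevel_compact : (0 < n)%N ->
  complete_metric (sphere_atlas Om) (conformal_metric rho) ->
  forall L : R, compact [set x | Om x /\ rho x <= L].
Proof.
move=> n0 cg L; apply: bounded_closed_compact.
  exists 1; split; first exact: num_real.
  move=> M M1 x [Ox _] /=; rewrite (le_trans _ (ltW M1)) // dot_self_ge1 //.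
  exact: (Om_sphere oOm).
move=> x clx.
have x1 : dot x x = 1.
  have cd : continuous (fun x : 'rV[R]_(1 + n) => dot x x).
    move=> t; apply: (@smooth_continuous _ _ _ setT) => //.
    by apply: smooth_dot; [exact: openT|exact: smooth_id|exact: smooth_id].
  have cS : closed (sphere R n).
    have -> : sphere R n = (fun x => dot x x) @^-1` [set t | t = 1] by [].
    by apply: preimage_closed; [move=> t _; exact: cd|exact: closed_eq].
  apply: cS; apply: closure_subset clx => t [Ot _].
  exact: (Om_sphere oOm).
have [b hb] := chart_exists x; pose y0 := stereo_inv b x.
have [oP sP] := smooth_stereo_inv R n b.
have yx : stereo b y0 = x by rewrite stereo_invK.
have approx (d : R) : 0 < d -> exists z, [/\ Om (stereo b z), `|z - y0| < d & rho (stereo b z) <= L].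
  move=> d0; have cp : {for x, continuous (@stereo_inv R n b)} by exact: (smooth_continuous sP).
  have nb : \forall t \near x, `|stereo_inv b t - y0| < d.
    by move: cp => /cvgrPdist_lt /(_ d d0); apply: filterS => t; rewrite distrC.
  have nb2 : \forall t \near x, 1 - chart_sign R b * time t != 0 by exact: open_nbhs_nbhs.
  have [t [[Ot rt] [td tb]]] := clx _ (filterI nb nb2).
  have tE : stereo b (stereo_inv b t) = t by rewrite stereo_invK //; exact: (Om_sphere oOm).
  by exists (stereo_inv b t); rewrite tE.
have Oy0 : Om (stereo b y0).
  have oU := @open_chart _ _ _ oOm b.
  have sw : smooth_on (@stereo R n b @^-1` Om) (w b).
    apply: smooth_exp => //; apply: smoothN => //; exact: smooth_conf.
  have c0 : 0 < expR (- (L + ln 2)) by exact: expR_gt0.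
  apply: (@superlevel_closed R n _ (w b) C oU sw C0 _ _ (expR (- (L + ln 2))) y0 n0 c0).
  - by move=> y v; exact: hess_w.
  - by move=> z v c; exact: segment_complete.
  - move=> d /approx[z [Oz zd rz]]; exists z; split=> //.
    rewrite ler_expR lerN2 lerD // ler_ln ?posrE ?lam_gt0 //; exact: lam_le2.
have Ox : Om x by rewrite -yx.
split=> //; rewrite leNgt; apply/negP => Lx.
have cr : {for y0, continuous (fun y => rho (stereo b y))} by exact: (smooth_continuous (smooth_rho (b := b))).
have : \forall y \near y0, L < rho (stereo b y) by apply: (cvgr_gt _ cr); rewrite yx.
move=> /near_norm[d d0 hd]; have [z [_ zd rz]] := approx d d0.
by have := hd z zd; rewrite ltNge rz.
Unshelve. all: by end_near. Qed.

End ConformalDomain.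

(** * Boundary at infinity *)

Lemma norm_le_sqrt_dot (R : realType) n (x : 'rV[R]_n) : `|x| <= Num.sqrt (dot x x).
Proof.
rewrite [leLHS]/Num.Def.normr /= mx_normrE bigmax_le ?sqrtr_ge0 // => -[a b] _ /=.
by rewrite ord1 abs_coord_le.
Qed.

Lemma to_ball_norm (R : realType) m (u : 'rV[R]_(1 + m)) : hyperbolic u ->
  dot (to_ball u) (to_ball u) = 1 - 2 / (1 + time u).
Proof.
move=> [h0 t0]; rewrite /to_ball dotZl dotZr; move: h0; rewrite [u in lorentz u u]vec_eta lorentz_vec.
move: (time u) (dot _ _) t0 => p0 q p00 h.
have -> : q = p0 * p0 - 1 by move: h; lra.
by field; rewrite gt_eqF // addr_gt0.
Qed.

Lemma to_ball_dist (R : realType) m (u : 'rV[R]_(1 + m)) (x : 'rV[R]_m) (E : R) :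
  hyperbolic u -> dot x x = 1 -> lorentz u (vec 1 x) = - E ->
  dot (to_ball u - x) (to_ball u - x) = 2 * E / (1 + time u).
Proof.
move=> hu x1 hE; have hb := to_ball_norm hu; have [_ p00] := hu.
rewrite !(dotDl, dotNl) !(dotDr, dotNr) hb x1 (dotC x).
move: hE; rewrite [u in lorentz u _]vec_eta lorentz_vec mulr1 /to_ball dotZl.
move: (time u) (dot _ _) p00 => p0 q p00 h.
have -> : q = p0 - E by move: h; lra.
by field; rewrite gt_eqF // addr_gt0.
Qed.

(** With E = e^(-rho) this is time >= e^rho / 2. It follows from the Cauchy-Schwarz inequality
    between the spatial part of u and the unit vector x. *)
Lemma support_le_time (R : realType) m (u : 'rV[R]_(1 + m)) (x : 'rV[R]_m) (E : R) :
  hyperbolic u -> dot x x = 1 -> lorentz u (vec 1 x) = - E -> 1 <= 2 * time u * E.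
Proof.
move=> [h0 p00] x1 hE.
have := dot_ge0 (rsubmx u - dot (rsubmx u) x *: x).
rewrite !(dotDl, dotNl, dotZl) !(dotDr, dotNr, dotZr) x1 (dotC x).
move: h0 hE; rewrite [u in lorentz u u]vec_eta [u in lorentz u (vec 1 x)]vec_eta !lorentz_vec mulr1.
move: (time u) (dot _ x) (dot _ _) p00 => p0 q s p00 h1 h2 h3.
have qE : q = p0 - E by move: h2; lra.
have sE : s = p0 * p0 - 1 by move: h1; lra.
rewrite qE sE in h3; have := sqr_ge0 E; rewrite expr2; move: h3; lra.
Qed.

Section Boundary.
Context (R : realType) (n : nat) (Om : set 'rV[R]_(1 + n)) (rho : 'rV[R]_(1 + n) -> R)
  (Phi : 'rV[R]_(1 + n) -> 'rV[R]_(1 + (1 + n))).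
Hypotheses (oOm : open_in_sphere Om)
  (hyp : forall x, Om x -> hyperbolic (Phi x))
  (supp : forall x, Om x -> lorentz (Phi x) (vec 1 x) = - expR (- rho x))
  (crho : forall x, Om x -> rho t @[t --> within Om (nbhs x)] --> rho x)
  (ctime : forall x, Om x -> time (Phi t) @[t --> within Om (nbhs x)] --> time (Phi x))
  (cpt : forall L : R, compact [set x | Om x /\ rho x <= L]).

Let ball_approx (u : nat -> 'rV[R]_(1 + n)) : (forall k, Om (u k)) ->
  (forall L : R, \forall k \near \oo, L < rho (u k)) ->
  forall e : R, 0 < e -> \forall k \near \oo, `|to_ball (Phi (u k)) - u k| < e.
Proof.
move=> Ou hL e e0; have e2 : 0 < e ^+ 2 by rewrite exprn_gt0.
(* For rho > L the squared distance 2 e^(-rho) / (1 + time) is below e^2. *)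
pose L := - ln (e ^+ 2 / 2).
apply: filterS (hL L) => k hk.
have d := to_ball_dist (hyp (Ou k)) (Om_sphere oOm (Ou k)) (supp (Ou k)).
rewrite (le_lt_trans (norm_le_sqrt_dot _)) // d.
rewrite -[ltRHS]ger0_norm ?(ltW e0) // -sqrtr_sqr ltr_sqrt //.
have [_ t0] := hyp (Ou k).
have t1 : 0 < 1 + time (Phi (u k)) by rewrite addr_gt0.
rewrite ltr_pdivrMr //.
have E : expR (- rho (u k)) < e ^+ 2 / 2.
  rewrite -[ltRHS]lnK ?posrE ?divr_gt0 // ltr_expR ltrNl; exact: hk.
rewrite (@lt_le_trans _ _ (e ^+ 2)) //; last by rewrite ler_peMr ?(ltW e2) // lerDl ltW.
by rewrite -ltr_pdivlMl // mulrC.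
Qed.

Let time_bound (L : R) : exists M : R, forall x, Om x -> rho x <= L -> time (Phi x) <= M.
Proof.
have [K0|K0] := pselect ([set x | Om x /\ rho x <= L] !=set0); last first.
  by exists 0 => x Ox rx; case: K0; exists x.
have [|m _ hm] := @compact_EVT_max _ R (fun x => time (Phi x)) _ K0 (@cpt L).
  apply/subspace_continuousP => x [Ox _].
  by apply: cvg_trans (ctime Ox); apply: cvg_app; apply: within_subset => t [].
by exists (time (Phi m)) => x Ox rx; apply: hm; rewrite inE.
Qed.

Let harm (e : R) : 0 < e -> \forall k \near \oo, k.+1%:R^-1 < e.
Proof. by move=> e0; exact: (near_infty_natSinv_lt (PosNum e0)). Qed.

Let close_cvg (u v : nat -> 'rV[R]_(1 + n)) (x : 'rV[R]_(1 + n)) : u @ \oo --> x ->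
  (forall e : R, 0 < e -> \forall k \near \oo, `|v k - u k| < e) -> v @ \oo --> x.
Proof.
move=> ux uv; apply/cvgrPdist_lt => e e0.
have e2 : 0 < e / 2 by rewrite divr_gt0.
have /cvgrPdist_lt /(_ _ e2) h1 := ux.
apply: filterS2 h1 (uv _ e2) => k h1 h2.
rewrite -[x](subrK (u k)) -addrA (le_lt_trans (ler_normD _ _)) // [e]splitr ltrD //.
by rewrite distrC.
Qed.

(** A limit on the unit sphere forces time to tend to infinity; time is bounded on each compact set
    {rho <= L}, so rho tends to infinity and the base points share the limit, which continuity of
    rho keeps out of Om. Conversely, a boundary point lies outside every set {rho <= L}, so rho
    tends to infinity along base points converging to it, and their images in the ball follow. *)
Lemma boundary_at_infinityE : boundary_at_infinity (Phi @` Om) = sphere_boundary Om.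
Proof.
have [W oW WE] := oOm.
apply/seteqP; split=> x.
  move=> [Sx [v hv cv]].
  have /choice[u hu] : forall k, exists t, Om t /\ Phi t = v k.
    by move=> k; have [t Ot tE] := hv k; exists t.
  have Ou k : Om (u k) := (hu k).1.
  have vE : v = Phi \o u by apply/funext => k /=; rewrite (hu k).2.
  have tinf (M : R) : \forall k \near \oo, M < time (Phi (u k)).
    pose M' := Num.max M 0; have M'0 : 0 <= M' by rewrite le_max lexx orbT.
    have M1 : 0 < 1 + M' by rewrite ltr_pwDl.
    have cd : {for x, continuous (fun x : 'rV[R]_(1 + n) => dot x x)}.
      apply: (@smooth_continuous _ _ _ setT) => //.
      by apply: smooth_dot; [exact: openT|exact: smooth_id|exact: smooth_id].
    have cvd : dot (to_ball (v k)) (to_ball (v k)) @[k --> \oo] --> dot x x.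
      exact: (cvg_comp _ (fun x : 'rV[R]_(1 + n) => dot x x) cv cd).
    have lt1 : 1 - 2 / (1 + M') < dot x x by rewrite (Sx : dot x x = 1) ltrBlDr ltrDl divr_gt0.
    have h0 : \forall k \near \oo, 1 - 2 / (1 + M') < dot (to_ball (v k)) (to_ball (v k)).
      exact: (cvgr_gt _ cvd).
    apply: filterS h0 => k; rewrite vE /= (to_ball_norm (hyp (Ou k))) ltrD2l ltrN2.
    have [_ t0] := hyp (Ou k).
    have t1 : 0 < 1 + time (Phi (u k)) by rewrite addr_gt0.
    rewrite ltr_pM2l // ltf_pV2 ?posrE // ltrD2l => h.
    by rewrite (le_lt_trans _ h) // le_max lexx.
  have rinf (L : R) : \forall k \near \oo, L < rho (u k).
    have [M hM] := time_bound L; apply: filterS (tinf M) => k hk.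
    by rewrite ltNge; apply/negP => /(hM _ (Ou k)); rewrite leNgt hk.
  have ux : u @ \oo --> x.
    apply: (@close_cvg (fun k => to_ball (v k)) u x cv) => e e0.
    by apply: filterS (ball_approx Ou rinf e0) => k; rewrite vE /= distrC.
  have clx : closure Om x.
    move=> B Bx; have [N _ hN] := ux _ Bx.
    by exists (u N); split; [exact: Ou|exact: (hN N (leqnn N))].
  split=> //; apply: subset_closure; split=> // Ox.
  have uw : u @ \oo --> within Om (nbhs x).
    move=> B Bw; have h : \forall k \near \oo, Om (u k) -> B (u k) by exact: (ux _ Bw).
    suff : \forall k \near \oo, B (u k) by [].
    by apply: filterS h => k; apply; exact: Ou.
  have : (rho \o u) @ \oo --> rho x by exact: (cvg_comp _ _ uw (crho Ox)).
  move=> h; have lt1 : rho x < rho x + 1 by rewrite ltrDl.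
  have h1 : \forall k \near \oo, rho (u k) < rho x + 1 by exact: (cvgr_lt _ h).
  have h2 := rinf (rho x + 1).
  have [N _ hN] := filterI h1 h2; have [a b] := hN N (leqnn N).
  by have := lt_trans a b; rewrite ltxx.
move=> [clx clSx].
have cS : closed (sphere R n).
  have -> : sphere R n = (fun x => dot x x) @^-1` [set t | t = 1] by [].
  apply: preimage_closed; last exact: closed_eq.
  move=> t _; apply: (@smooth_continuous _ _ _ setT) => //.
  by apply: smooth_dot; [exact: openT|exact: smooth_id|exact: smooth_id].
have Sx : sphere R n x by apply: cS; apply: closure_subset clSx => t [].
split=> //.
have nOx : ~ Om x.
  rewrite WE => -[Wx _].
  have [t [[St nOt] Wt]] := clSx _ (open_nbhs_nbhs (conj oW Wx)).
  by apply: nOt; rewrite WE.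
have /choice[u hu] : forall k, exists t, Om t /\ `|t - x| < k.+1%:R^-1.
  move=> k; have [|t [Ot]] := clx (ball x k.+1%:R^-1).
    by apply: nbhsx_ballx; rewrite invr_gt0.
  by rewrite -ball_normE /= distrC => tk; exists t.
have Ou k : Om (u k) := (hu k).1.
have ux : u @ \oo --> x.
  apply/cvgrPdist_lt => e e0; apply: filterS (harm e0) => k; rewrite distrC.
  exact: lt_trans (hu k).2.
have rinf (L : R) : \forall k \near \oo, L < rho (u k).
  have cK : closed [set x | Om x /\ rho x <= L].
    by apply: compact_closed; [exact: norm_hausdorff|exact: cpt].
  have oK : open (~` [set x | Om x /\ rho x <= L]) by exact: closed_openC.
  have Kx : (~` [set x | Om x /\ rho x <= L]) x by move=> [].
  have nK : \forall k \near \oo, (~` [set x | Om x /\ rho x <= L]) (u k).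
    exact: (ux _ (open_nbhs_nbhs (conj oK Kx))).
  apply: filterS nK => k hk.
  by rewrite ltNge; apply/negP => h; apply: hk; split=> //; exact: Ou.
exists (fun k => Phi (u k)) => [k|]; first by exists (u k) => //; exact: Ou.
by apply: (@close_cvg u _ x ux) => e e0; exact: ball_approx.
Unshelve. all: by end_near. Qed.

End Boundary.

(** Values off Om are arbitrary, so continuity makes sense only along Om; near x it is read in a
    chart through the smooth extension [stereo_inv b]. *)
Lemma within_chart_cvg (R : realType) n (Om : set 'rV[R]_(1 + n)) (W : topologicalType)
    (h : 'rV[R]_(1 + n) -> W) : open_in_sphere Om ->
  (forall b y, Om (stereo b y) -> {for y, continuous (fun y => h (stereo b y))}) ->
  forall x, Om x -> h t @[t --> within Om (nbhs x)] --> h x.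
Proof.
move=> oOm ch x Ox; have [b hb] := chart_exists x.
have [oP sP] := smooth_stereo_inv R n b.
have yx : stereo b (stereo_inv b x) = x by rewrite stereo_invK //; exact: (Om_sphere oOm).
have c1 : {for x, continuous (@stereo_inv R n b)} by exact: (smooth_continuous sP).
have c2 : {for stereo_inv b x, continuous (fun y => h (stereo b y))} by apply: ch; rewrite yx.
have c3 : h (stereo b (stereo_inv b t)) @[t --> x] --> h x.
  by rewrite -[in X in _ --> X]yx; exact: (cvg_comp _ _ c1 c2).
have nb : \forall t \near x, 1 - chart_sign R b * time t != 0.
  exact: (open_nbhs_nbhs (conj oP hb)).
move=> B Bx; have cB : \forall t \near x, B (h (stereo b (stereo_inv b t))) by exact: (c3 _ Bx).
have h1 : \forall t \near x, Om t -> B (h t).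
  apply: filterS2 cB nb => t hB tb Ot; move: hB.
  by rewrite stereo_invK //; exact: (Om_sphere oOm).
exact: h1.
Qed.

(** * Hypersurfaces from conformal metrics *)

(** The difference quotients coincide, so the equality holds without differentiability. *)
Lemma derive_shift_cst (R : realType) (V W : normedModType R) (f : V -> W) (c : W) v :
  (fun x => 'D_v (fun z => f z + c) x) = fun x => 'D_v f x.
Proof.
apply/funext => x; rewrite /derive.
set F := (fun h : R => _); set F' := (fun h : R => h^-1 *: (f (h *: v + x) - f x)).
suff -> : F = F' by [].
by apply/funext => h; rewrite /F /F' /= opprD addrACA subrr addr0.
Qed.

Lemma schouten_shift (R : realType) n (f : 'rV[R]_n -> R) (c : R) y v :
  schouten (fun z => f z + c) y v = schouten f y v.
Proof.
rewrite /schouten /partial.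
have e u : (fun z => 'D_u (fun z => f z + c) z) = fun z => 'D_u f z by exact: derive_shift_cst.
have e' u z : 'D_u (fun z => f z + c) z = 'D_u f z by exact: (congr1 (fun g => g z) (e u)).
have es : \sum_i ('D_(delta_mx 0 i) (fun z => f z + c) y) ^+ 2 = \sum_i ('D_(delta_mx 0 i) f y) ^+ 2.
  by apply: eq_bigr => i _; apply: (congr1 (fun a => a ^+ 2)); exact: e'.
by rewrite (e v) e' es.
Qed.

(* The property that selects sphere_grad rho x. *)
Definition is_sphere_grad (R : realType) n (rho : 'rV[R]_(1 + n) -> R) (x V : 'rV[R]_(1 + n)) :=
  dot V x = 0 /\ forall (b : bool) (y : 'rV[R]_n), stereo b y = x ->
      forall v, 'D_v ((rho : _ -> R^o) \o stereo b) y = dot V ('D_v (@stereo R n b) y).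

(** The gradient in conformal coordinates, where the inverse metric is lam^-2 times the identity. *)
Definition chart_grad (R : realType) n (rho : 'rV[R]_(1 + n) -> R) b (y : 'rV[R]_n) :=
  \sum_i ((lam y ^+ 2)^-1 * partial i (fun z => rho (stereo b z)) y) *: partial i (stereo b) y.

Lemma dot_sum (R : realType) n (I : Type) (r : seq I) (a : I -> 'rV[R]_n) x :
  dot (\sum_(i <- r) a i) x = \sum_(i <- r) dot (a i) x.
Proof.
elim: r => [|i r IH]; first by rewrite !big_nil dot0l.
by rewrite !big_cons dotDl IH.
Qed.

(** The vector (0, d) is orthogonal to the null lift and to all tangents, so its norm vanishes by
    the null frame formula; this replaces a dimension count. *)
Lemma tangent_eq0 (R : realType) n b (y : 'rV[R]_n) (d : 'rV[R]_(1 + n)) :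
  dot d (stereo b y) = 0 -> (forall v, dot d ('D_v (stereo b) y) = 0) -> d = 0.
Proof.
move=> h0 h1; apply: dot_eq0.
pose u := vec 0 d.
have uz : lorentz u (null_lift b y) = 0.
  have : lorentz u (vec 1 (stereo b y)) = 0 by rewrite lorentz_vec mul0r oppr0 add0r.
  rewrite (stereo_lift b y) lorentzZr => /eqP; rewrite mulf_eq0 gt_eqF ?lam_gt0 //=.
  by move/eqP.
have ut v : lorentz u (null_tangent b y v) = 0.
  have : lorentz u (vec 0 ('D_v (stereo b) y)) = 0 by rewrite lorentz_vec mul0r oppr0 add0r.
  have -> := derive_stereo_lift b y v.
  rewrite lorentzDr !lorentzZr uz mulr0 add0r => /eqP; rewrite mulf_eq0 gt_eqF ?lam_gt0 //=.
  by move/eqP.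
have : lorentz u u = dot d d by rewrite lorentz_vec mul0r oppr0 add0r.
move=> <-; rewrite (lorentz_null_frame b y) uz mulr0 add0r big1 // => i _.
by rewrite ut expr0n.
Qed.

(** * The gradient on the sphere in charts *)

Section SphereGrad.
Context (R : realType) (n : nat) (Om : set 'rV[R]_(1 + n)) (rho : 'rV[R]_(1 + n) -> R).
Hypotheses (oOm : open_in_sphere Om) (srho : smooth_map (sphere_atlas Om) (rho : _ -> R^o)).

Let dr b y : Om (stereo b y) -> differentiable (fun z => rho (stereo b z)) y.
Proof. by move=> Oy; exact: (smooth_differentiable (smooth_rho srho (b := b))). Qed.

Let chart_gradE b y v : Om (stereo b y) ->
  dot (chart_grad rho b y) ('D_v (stereo b) y) = 'D_v (fun z => rho (stereo b z)) y.
Proof.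
move=> Oy; rewrite /chart_grad dot_sum (derive_coord v (dr Oy)).
have l0 : lam y ^+ 2 != 0 by rewrite expf_neq0 // gt_eqF // lam_gt0.
apply: eq_bigr => i _; rewrite dotZl dot_derive_stereo.
have -> : dot (delta_mx 0 i) v = v 0 i.
  rewrite /dot -(sum_delta i (fun j => v 0 j)); apply: eq_bigr => j _.
  by rewrite !mxE eqxx.
set p := partial i _ y; rewrite /GRing.scale /=; move: l0; set l := lam y ^+ 2 => l0.
by field.
Qed.

(** The defining property involves both charts. The derivatives of rho and of the parametrization in
    the chart b' are those in the chart b along the direction transformed by the transition map
    [stereo_inv b \o stereo b']. *)
Lemma chart_gradP b y : Om (stereo b y) -> is_sphere_grad rho (stereo b y) (chart_grad rho b y).
Proof.
move=> Oy; split.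
  rewrite /chart_grad dot_sum big1 // => i _.
  by rewrite dotZl dotC dot_stereo_derive mulr0.
move=> b' y' yE v.
have [oP sP] := smooth_stereo_inv R n b.
have hb' : 1 - chart_sign R b * time (stereo b' y') != 0 by rewrite yE stereo_den_neq0.
have dS := diff_stereo b' y'.
have dP : differentiable (@stereo_inv R n b) (stereo b' y') by exact: (smooth_differentiable sP).
have dtau : differentiable (@stereo_inv R n b \o stereo b') y' by exact: differentiable_comp.
have ty : stereo_inv b (stereo b' y') = y by rewrite yE stereoK.
have nb : \forall z \near y', stereo b (stereo_inv b (stereo b' z)) = stereo b' z.
  have cS : {for y', continuous (@stereo R n b')} by exact: differentiable_continuous.
  have h : \forall z \near y', 1 - chart_sign R b * time (stereo b' z) != 0.
    exact: (cS _ (open_nbhs_nbhs (conj oP hb'))).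
  by apply: filterS h => z hz; rewrite stereo_invK // stereo_sphere.
have e1 : 'D_v (@stereo R n b') y' = 'D_('D_v (stereo_inv b \o stereo b') y') (stereo b) y.
  have := derive_comp v dtau (diff_stereo b (stereo_inv b (stereo b' y'))).
  rewrite [(_ \o _) y']/= ty => <-; apply: near_eq_derive.
  by apply: filterS nb => z <-.
have e2 : 'D_v (fun z => rho (stereo b' z)) y' =
    'D_('D_v (stereo_inv b \o stereo b') y') (fun z => rho (stereo b z)) y.
  have dry : differentiable (fun z => rho (stereo b z)) (stereo_inv b (stereo b' y')).
    by rewrite ty; exact: dr.
  have := derive_comp v dtau dry.
  rewrite [(_ \o _) y']/= ty => <-; apply: near_eq_derive.
  by apply: filterS nb => z /= ->.
apply: (etrans e2); rewrite -(chart_gradE _ Oy).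
exact: (congr1 (dot _) (esym e1)).
Qed.

(** Uniqueness, by [tangent_eq0], identifies the vector chosen by [xget] with the explicit formula,
    from which smoothness can be read. *)
Lemma sphere_gradE b y : Om (stereo b y) -> sphere_grad rho (stereo b y) = chart_grad rho b y.
Proof.
move=> Oy; have [h1 h2] := chart_gradP Oy; rewrite /sphere_grad.
case: xgetP => [V _ [V1 V2]|/(_ (chart_grad rho b y)) []]; last by [].
apply/subr0_eq; apply: (@tangent_eq0 R n b y).
  by rewrite dotDl dotNl V1 h1 subr0.
move=> v; rewrite dotDl dotNl.
have e1 := V2 b y erefl v; have e2 := h2 b y erefl v.
by rewrite -[X in X - _]e1 -[X in _ - X]e2 subrr.
Qed.

Lemma smooth_sphere_grad b :
  smooth_on (@stereo R n b @^-1` Om) (fun y => sphere_grad rho (stereo b y)).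
Proof.
have oU := @open_chart _ _ _ oOm b.
apply: (@smooth_eq _ _ _ _ (chart_grad rho b)) => // [y Oy|]; first by rewrite sphere_gradE.
apply: smooth_sum => // i; apply: smooth_scale => //.
  apply: smoothM => //; last by exact: (smooth_derive _ (smooth_rho srho (b := b))).
  apply: smooth_inv => //; first by move=> y _; rewrite expf_neq0 // gt_eqF // lam_gt0.
  by apply: smoothM => //; exact: smooth_lam.
by apply: smooth_derive; exact: smooth_stereo.
Qed.

Lemma sphere_grad_tangent x : Om x -> dot (sphere_grad rho x) x = 0.
Proof.
move=> Ox; have [b [y yx _]] := chart_at oOm Ox; rewrite -yx in Ox *.
by rewrite sphere_gradE //; exact: (chart_gradP Ox).1.
Qed.

Lemma sphere_grad_derive b y v : Om (stereo b y) ->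
  dot (sphere_grad rho (stereo b y)) ('D_v (stereo b) y) = 'D_v (fun z => rho (stereo b z)) y.
Proof. by move=> Oy; rewrite sphere_gradE // chart_gradE. Qed.

End SphereGrad.

Lemma quarter_absorb (R : realType) (B I H : R) :
  0 <= H -> 4^-1 * H <= B -> 0 <= I -> B ^+ 2 <= I * H -> H <= 16 * I.
Proof.
move=> H0 h I0 cs; have [H1|H1] := eqVneq H 0; first by rewrite H1 mulr_ge0.
have Hp : 0 < H by rewrite lt0r H1.
have h2 : 4^-1 * H * (4^-1 * H) <= I * H.
  apply: le_trans cs; rewrite expr2; have q : 0 <= 4^-1 * H by rewrite mulr_ge0.
  exact: ler_pM.
rewrite -(ler_pM2r Hp); lra.
Qed.

Lemma lorentz_sub_null (R : realType) m (p q : 'rV[R]_(1 + m)) :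
  lorentz p p = -1 -> lorentz p q = -1 -> lorentz q q = 0 ->
  lorentz (q - p) (q - p) = 1 /\ lorentz (q - p) p = 0.
Proof.
move=> h1 h2 h3; have h4 : lorentz q p = -1 by rewrite lorentzC.
by rewrite !lorentzDl !lorentzDr !lorentzNl !lorentzNr h1 h2 h3 h4; split; ring.
Qed.

(** Dividing by 1 - k even gives k <= -1/3. *)
Lemma le0_of_quadratic (R : realType) (k : R) :
  0 < 1 - k -> 1 - k <= 3 / 4 * (1 - k) ^+ 2 -> k <= 0.
Proof.
by move=> kp h; rewrite leNgt; apply/negP => k0; nra.
Qed.

Lemma quarter_between (R : realType) (T H : R) : - (4^-1 * H) <= T -> T <= 4^-1 * H ->
  4^-1 * H <= 2^-1 * H + T <= 3 / 4 * H.
Proof. by move=> h1 h2; apply/andP; split; lra. Qed.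

(** * The hypersurfaces phi_t *)

Section PhiOf.
Context (R : realType) (n : nat) (Om : set 'rV[R]_(1 + n)) (rho : 'rV[R]_(1 + n) -> R) (t : R).
Hypotheses (oOm : open_in_sphere Om) (srho : smooth_map (sphere_atlas Om) (rho : _ -> R^o)).

Definition shift_rho (x : 'rV[R]_(1 + n)) := rho x + t.

Lemma phi_of_vec x : phi_of rho t x =
  (expR (rho x + t) / 2 * (1 + expR (- 2 * rho x - 2 * t) * (1 + dot (sphere_grad rho x) (sphere_grad rho x))))
    *: vec 1 x + expR (- rho x - t) *: vec 0 (- x + sphere_grad rho x).
Proof. by []. Qed.

Lemma smooth_phi_of b : smooth_on (@stereo R n b @^-1` Om) (fun y => phi_of rho t (stereo b y)).
Proof.
have oU := @open_chart _ _ _ oOm b.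
have sr := smooth_rho srho (b := b); have sg := smooth_sphere_grad oOm srho (b := b).
have ss : smooth_on (@stereo R n b @^-1` Om) (stereo b) by exact: smooth_stereo.
have cst (V W : normedModType R) (U : set V) (a : W) : smooth_on U (fun=> a) by exact: smooth_cst.
apply: smoothD => //.
  apply: smooth_scale => //; last by apply: smooth_vec.
  apply: smoothM => //.
    by apply: smoothM => //; apply: smooth_exp => //; apply: smoothD.
  apply: smoothD => //; apply: smoothM => //.
    by apply: smooth_exp => //; apply: smoothD => //; apply: smoothM.
  by apply: smoothD => //; apply: smooth_dot.
apply: smooth_scale => //.
  by apply: smooth_exp => //; apply: smoothD => //; apply: smoothN.
apply: smooth_vec => //; apply: smoothD => //.
apply: (@smooth_eq _ _ _ _ (fun y => (-1) *: stereo b y)) => // [y _|]; first by rewrite scaleN1r.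
exact: smooth_scale.
Qed.

Lemma horo_lift_shift b y :
  horo_lift b (conf_fun shift_rho b) y = expR (rho (stereo b y) + t) *: vec 1 (stereo b y).
Proof. by rewrite (stereo_lift b y) scalerA /horo_lift exp_conf_fun. Qed.

Lemma phi_of_algebra x (w : 'rV[R]_(1 + n)) : Om x -> dot x w = 0 ->
  [/\ hyperbolic (phi_of rho t x),
      lorentz (phi_of rho t x) (vec 1 x) = - expR (- shift_rho x) &
      lorentz (phi_of rho t x) (vec 0 w) = expR (- shift_rho x) * dot (sphere_grad rho x) w].
Proof.
move=> Ox xw; have x1 := Om_sphere oOm Ox.
have gx := sphere_grad_tangent oOm srho Ox.
rewrite /hyperbolic /= phi_of_vec /shift_rho.
set g := sphere_grad rho x in gx *; set q := dot g g.
have q0 : 0 <= q by exact: dot_ge0.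
set E := expR (rho x + t).
have -> : expR (- rho x - t) = E^-1 by rewrite -opprD expRN.
have -> : expR (- (rho x + t)) = E^-1 by rewrite expRN.
have -> : expR (- 2 * rho x - 2 * t) = E^-1 * E^-1.
  by rewrite -!expRN -expRD; congr expR; ring.
have E0 : 0 < E by exact: expR_gt0.
set a := E / 2 * _; rewrite !vecZ vecD mulr1 mulr0 addr0.
clearbody g E.
have a0 : 0 < a.
  rewrite /a mulr_gt0 ?divr_gt0 // ltr_wpDr // !mulr_ge0 ?invr_ge0 ?(ltW E0) //.
  by rewrite addr_ge0.
(* The equation of the hyperboloid, - a^2 + (a - 1/E)^2 + q / E^2 = -1, is this relation after
   expansion. *)
have aE : 2 * a * E^-1 = 1 + E^-1 * E^-1 * (1 + q) by rewrite /a; field; rewrite gt_eqF.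
rewrite vecE0 !lorentz_vec !mulr1 !mulr0 oppr0 add0r.
rewrite !(dotDl, dotZl, dotNl) !(dotDr, dotZr, dotNr) x1 xw gx (dotC x g) gx -/q.
have Ei0 : 0 < E^-1 by rewrite invr_gt0.
clearbody q; move: (E^-1) Ei0 aE => i i0 aE.
split=> //; [split=> //| |]; last by ring.
  by move: aE; lra.
by ring.
Qed.

Hypothesis bT : forall b y v, Om (stereo b y) ->
  `|schouten (conf_fun rho b) y v| <= 4^-1 * (expR (2 * conf_fun shift_rho b y) * dot v v).

Let Psi b := horo_lift b (conf_fun shift_rho b).
Let Phi b (y : 'rV[R]_n) := phi_of rho t (stereo b y).

Lemma smooth_shift : smooth_map (sphere_atlas Om) (shift_rho : _ -> R^o).
Proof.
move=> _ [b ->] /=; apply: smoothD; [exact: open_chart|exact: smooth_rho|exact: smooth_cst].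
Qed.

Let sf b : smooth_on (@stereo R n b @^-1` Om) (conf_fun shift_rho b).
Proof. exact: (smooth_conf oOm smooth_shift). Qed.

Let df b y : Om (stereo b y) -> differentiable (conf_fun shift_rho b) y.
Proof. by move=> Oy; exact: (smooth_differentiable (sf (b := b))). Qed.

Let dPhi b y : Om (stereo b y) -> differentiable (Phi b) y.
Proof. by move=> Oy; exact: (smooth_differentiable (smooth_phi_of (b := b))). Qed.

Let Phi1 b y : Om (stereo b y) -> lorentz (Phi b y) (Phi b y) = -1.
Proof. by move=> Oy; have [[]] := phi_of_algebra Oy (dot0r _). Qed.

Let Phi2 b y : Om (stereo b y) -> lorentz (Phi b y) (Psi b y) = -1.
Proof.
move=> Oy; have [_ h _] := phi_of_algebra Oy (dot0r _).
rewrite /Psi horo_lift_shift lorentzZr h /shift_rho expRN mulrN divff //.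
by rewrite gt_eqF // expR_gt0.
Qed.

Let Phi3 b y v : Om (stereo b y) -> lorentz (Phi b y) ('D_v (Psi b) y) = 0.
Proof.
move=> Oy; have xw := dot_stereo_derive b y v.
have [_ h2 h3] := phi_of_algebra Oy xw.
have drho : differentiable (fun z => rho (stereo b z)) y.
  exact: (smooth_differentiable (smooth_rho srho (b := b))).
have c0 : differentiable (fun _ : 'rV[R]_n => t) y by exact: differentiable_cst.
have [d1 e1] := derive_addf v drho c0.
have [d2 e2] := derive_exp v d1.
have c1 : differentiable (fun _ : 'rV[R]_n => 1 : R) y by exact: differentiable_cst.
have [d3 e3] := derive_vec v c1 (diff_stereo b y).
have [d4 e4] := derive_scale v d2 d3.
have E : Psi b = fun y => expR (rho (stereo b y) + t) *: vec 1 (stereo b y).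
  by apply/funext => z; exact: horo_lift_shift.
apply: (etrans (congr1 (fun g => lorentz (Phi b y) ('D_v g y)) E)).
apply: (etrans (congr1 (lorentz (Phi b y)) e4)).
rewrite lorentzDr !lorentzZr h2.
have -> := congr1 (lorentz (Phi b y)) e3.
have c0' : 'D_v (fun _ : 'rV[R]_n => t) y = 0 by exact: derive_cst.
have c1' : 'D_v (fun _ : 'rV[R]_n => 1 : R) y = 0 by exact: derive_cst.
rewrite c1' h3 e2 e1 c0' (sphere_grad_derive srho v Oy); ring.
Qed.

Lemma phi_B b y v : Om (stereo b y) ->
  4^-1 * (expR (2 * conf_fun shift_rho b y) * dot v v) <= lorentz ('D_v (Phi b) y) ('D_v (Psi b) y)
    <= 3 / 4 * (expR (2 * conf_fun shift_rho b y) * dot v v).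
Proof.
move=> Oy; set H := expR _ * dot v v.
have -> : lorentz ('D_v (Phi b) y) ('D_v (Psi b) y) = 2^-1 * H + schouten (conf_fun rho b) y v.
  have e : conf_fun shift_rho b = fun z => conf_fun rho b z + t.
    by apply/funext => z; rewrite /conf_fun /shift_rho addrAC.
  have := fundamental_identity (@open_chart _ _ _ oOm b) (sf (b := b)) (dPhi (b := b))
    (Phi1 (b := b)) (Phi2 (b := b)) (Phi3 (b := b)) (y := y) v Oy.
  move=> E; apply: (etrans E); apply: (congr1 (fun a => 2^-1 * H + a)).
  apply: (etrans (congr1 (fun g => schouten g y v) e)); exact: schouten_shift.
have := bT v Oy; rewrite -/H ler_norml; move: (schouten _ _ _) H => T H /andP[h1 h2].
exact: quarter_between.
Qed.

Lemma phi_tangent b y v : Om (stereo b y) -> lorentz ('D_v (Phi b) y) (Phi b y) = 0.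
Proof.
move=> Oy; have dy := dPhi Oy; have [_ e] := derive_lorentz v dy dy.
have : 'D_v (fun x => lorentz (Phi b x) (Phi b x)) y = 0.
  rewrite -[RHS](derive_cst (-1 : R) y v); apply: near_eq_derive.
  have h : \forall z \near y, Om (stereo b z) by exact: (open_nbhs_nbhs (conj (@open_chart _ _ _ oOm b) Oy)).
  by apply: filterS h => z; exact: Phi1.
rewrite e (lorentzC (Phi b y)) => /eqP; rewrite -mulr2n mulrn_eq0 /= => /eqP; exact.
Qed.

Lemma phi_I b y v : Om (stereo b y) ->
  expR (2 * conf_fun shift_rho b y) * dot v v <= 16 * lorentz ('D_v (Phi b) y) ('D_v (Phi b) y).
Proof.
move=> Oy; have := phi_B v Oy; set H := _ * dot v v => /= /andP[h _].
have HE : lorentz ('D_v (Psi b) y) ('D_v (Psi b) y) = H by exact: lorentz_horo_lift (df Oy).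
have p3 : lorentz ('D_v (Psi b) y) (Phi b y) = 0 by rewrite lorentzC Phi3.
have := lorentz_cauchy_schwarz (Phi1 Oy) (phi_tangent v Oy) p3; rewrite HE.
have H0 : 0 <= H by rewrite mulr_ge0 ?expR_ge0 ?dot_ge0.
have I0 := lorentz_tangent_ge0 (Phi1 Oy) (phi_tangent v Oy).
exact: quarter_absorb.
Qed.

Lemma phi_hypersurface : hypersurface (sphere_atlas Om) (phi_of rho t) (eta_of rho t).
Proof.
have eE : forall x, eta_of rho t x = expR (rho x + t) *: vec 1 x - phi_of rho t x by [].
have eE' b y : eta_of rho t (stereo b y) = Psi b y - Phi b y by rewrite eE /Psi horo_lift_shift.
split.
- split; first by move=> _ [b ->]; exact: smooth_phi_of.
  move=> _ [b ->] y /= Oy v h.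
  have := phi_B v Oy; rewrite /= -/(Phi b); have -> : 'D_v (Phi b) y = 0 by exact: h.
  rewrite lorentz0l => /andP[h1 _].
  apply: dot_eq0; apply/eqP; rewrite eq_le dot_ge0 andbT.
  by move: h1; rewrite pmulr_rle0 ?invr_gt0 // pmulr_rle0 ?expR_gt0.
- move=> _ [b ->] /=; have oU := @open_chart _ _ _ oOm b.
  apply: (@smooth_eq _ _ _ _ (fun y => Psi b y + (-1) *: Phi b y)) => //.
    by move=> y _ /=; rewrite scaleN1r eE'.
  apply: smoothD => //.
    by apply: smooth_scale => //; [exact: smooth_exp|exact: smooth_null_lift].
  by apply: smooth_scale => //; [exact: smooth_cst|exact: smooth_phi_of].
- move=> x; rewrite points_sphere // => Ox; have [h1 h2 _] := phi_of_algebra Ox (dot0r _).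
  have [b [y yx _]] := chart_at oOm Ox; rewrite -yx in Ox h1 *; rewrite eE'.
  have a1 := Phi1 Ox; have a2 := Phi2 Ox.
  have a3 : lorentz (Psi b y) (Psi b y) = 0.
    by rewrite /Psi /horo_lift lorentzZl lorentzZr lorentz_lift !mulr0.
  rewrite -/(Phi b y).
  by have [] := lorentz_sub_null a1 a2 a3; split.
- move=> _ [b ->] y /= Oy v; rewrite eE'.
  have a1 := phi_tangent v Oy.
  (* Differentiating <Phi, Psi> = -1 leaves this pairing opposite to <Phi, D_v Psi>, which
     vanishes. *)
  have a2 : lorentz (Psi b y) ('D_v (Phi b) y) = 0.
    have dps := (derive_horo_lift b v (df Oy)).1.
    have [_ e] := derive_lorentz v (dPhi Oy) dps.
    have : 'D_v (fun x => lorentz (Phi b x) (horo_lift b (conf_fun shift_rho b) x)) y = 0.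
      rewrite -[RHS](derive_cst (-1 : R) y v); apply: near_eq_derive.
      have h : \forall z \near y, Om (stereo b z) by exact: (open_nbhs_nbhs (conj (@open_chart _ _ _ oOm b) Oy)).
      by apply: filterS h => z; exact: Phi2.
    by rewrite e (Phi3 v Oy) addr0 lorentzC.
  have -> : 'D_v (phi_of rho t \o stereo b) y = 'D_v (Phi b) y by [].
  by rewrite lorentzDl lorentzNl a2 (lorentzC (Phi b y)) a1 subr0.
Qed.

(** On a principal direction of unit length dPsi = (1 - kappa) dPhi, so the bounds [phi_B] read (1 -
    kappa)^2 / 4 <= 1 - kappa <= 3 (1 - kappa)^2 / 4. *)
Lemma phi_convex : unif_horo_convex (sphere_atlas Om) (phi_of rho t) (eta_of rho t).
Proof.
exists 0 => // _ [b ->] y /= Oy e kappa [fr1 fr2] i.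
have := phi_B (e i) Oy; rewrite /=.
have HE := lorentz_horo_lift b (e i) (e i) (df Oy); rewrite -/(Psi b) in HE.
have dps : differentiable (Psi b) y := (derive_horo_lift b (e i) (df Oy)).1.
have ePsi : 'D_(e i) (Psi b) y = (1 - kappa i) *: 'D_(e i) (Phi b) y.
  have eta_E : (eta_of rho t \o stereo b) = fun y => Psi b y - Phi b y.
    by apply/funext => z /=; rewrite /Psi horo_lift_shift.
  have := fr2 i; rewrite [LHS](congr1 (fun g => 'D_(e i) g y) eta_E).
  rewrite deriveB; [|exact: diff_derivable|exact: diff_derivable (dPhi Oy)].
  rewrite -/(Phi b) scalerBl scale1r => /eqP.
  rewrite subr_eq => /eqP ->.
  by rewrite scaleNr addrC.
have f1 : lorentz ('D_(e i) (Phi b) y) ('D_(e i) (Phi b) y) = 1 by have := fr1 i i; rewrite eqxx.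
rewrite -HE ePsi lorentzZl !lorentzZr f1 !mulr1.
rewrite -expr2 => /andP[h1 h2].
have k1 : 0 <= 1 - kappa i by rewrite (le_trans _ h1) // mulr_ge0 ?sqr_ge0.
(* If 1 - kappa = 0 then dPsi vanishes on e_i; the horospherical metric being definite, e_i = 0,
   against its unit length. *)
have [k2|k2] := eqVneq (1 - kappa i) 0.
  have : lorentz ('D_(e i) (Psi b) y) ('D_(e i) (Psi b) y) = 0 by rewrite ePsi k2 scale0r lorentz0l.
  rewrite HE => /eqP; rewrite mulf_eq0 gt_eqF ?expR_gt0 //= => /eqP /dot_eq0 e0.
  by move: f1; rewrite e0 derive0 lorentz0l => /eqP; rewrite eq_sym oner_eq0.
clear HE ePsi; move: (kappa i) h1 h2 k1 k2 => k h1 h2 k1 k2.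
have kp : 0 < 1 - k by rewrite lt0r k2.
exact: le0_of_quadratic.
Qed.

Lemma phi_complete : complete_metric (sphere_atlas Om) (conformal_metric rho) ->
  complete_metric (sphere_atlas Om) (induced_metric (phi_of rho t)).
Proof.
move=> cg u pu cu.
(* The 4 is the square root of the 16 in [phi_I], and e^(-t) undoes the shift of rho by t. *)
pose K := 4 * expR (- t); have K0 : 0 < K by rewrite mulr_gt0 ?expR_gt0.
apply: (@complete_transfer R n n _ _ _ _ (conformal_metric rho) _ id K K0 _ _ cg u pu cu) => //.
move=> gam s hC; split=> //.
have [b [y hy]] := (C1_sphereP _ _ _).1 hC.
have [Oy gs dy _] := nbhs_singleton hy.
have gE : \forall s \near s, gam s = stereo b (y s) by apply: filterS hy => z [].
rewrite (speed_conformal rho gE dy) /speed /=.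
have -> : derive1 (phi_of rho t \o gam) s = 'D_(derive1 y s) (Phi b) (y s).
  rewrite -(derive1_comp_diff (dPhi Oy) dy).2 !derive1E; apply: near_eq_derive.
  by apply: filterS gE => z zE /=; rewrite zE.
have h := phi_I (derive1 y s) Oy.
set I := lorentz _ _ in h *; set q := dot _ _ in h *.
have I0 : 0 <= I.
  by rewrite -(@pmulr_rge0 _ 16) // (le_trans _ h) // mulr_ge0 ?expR_ge0 ?dot_ge0.
have q0 : 0 <= q by exact: dot_ge0.
have -> : expR (conf_fun rho b (y s)) = expR (- t) * expR (conf_fun shift_rho b (y s)).
  by rewrite -expRD; congr expR; rewrite /conf_fun /shift_rho; ring.
rewrite /K [4 * _]mulrC -!mulrA ler_pM2l ?expR_gt0 //.
set F := expR _; have -> : F * Num.sqrt q = Num.sqrt (F ^+ 2 * q).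
  by rewrite sqrtrM ?sqr_ge0 // sqrtr_sqr ger0_norm // expR_ge0.
have -> : 4 * Num.sqrt I = Num.sqrt (4 ^+ 2 * I).
  by rewrite sqrtrM ?sqr_ge0 // sqrtr_sqr ger0_norm.
apply: ler_wsqrtr; rewrite expr2 -expR2 (le_trans h) // ler_wpM2r //; lra.
Qed.

Lemma phi_within x : Om x ->
  phi_of rho t z @[z --> within Om (nbhs x)] --> phi_of rho t x.
Proof.
apply: (within_chart_cvg oOm) => b y Oy.
exact: (differentiable_continuous (dPhi Oy)).
Qed.

Lemma shift_within x : Om x -> shift_rho z @[z --> within Om (nbhs x)] --> shift_rho x.
Proof.
apply: (within_chart_cvg oOm) => b y Oy.
exact: (smooth_continuous (smooth_rho smooth_shift (b := b))).
Qed.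

Lemma time_continuous m : continuous (fun u : 'rV[R]_(1 + m) => time u).
Proof.
move=> x; apply: (@smooth_continuous _ _ _ setT) => //; exact: smooth_coord.
Qed.

Hypothesis cpt : forall L : R, compact [set x | Om x /\ rho x <= L].

Lemma phi_boundary : boundary_at_infinity (phi_of rho t @` Om) = sphere_boundary Om.
Proof.
apply: (@boundary_at_infinityE R n Om shift_rho) => //.
- by move=> x Ox; have [] := phi_of_algebra Ox (dot0r _).
- by move=> x Ox; have [] := phi_of_algebra Ox (dot0r _).
- exact: shift_within.
- move=> x Ox; exact: (cvg_comp _ _ (phi_within Ox) (@time_continuous _ _)).
- move=> L; have -> : [set x | Om x /\ shift_rho x <= L] = [set x | Om x /\ rho x <= L - t].
    by apply/seteqP; split=> x [Ox h]; split=> //; move: h; rewrite /shift_rho /= lerBrDr.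
  exact: cpt.
Qed.

(** Time is bounded on K, and e^(rho + t) <= 2 time, so the preimage lies in a compact sublevel set
    of rho. It is closed because the limits stay in Om, where phi_t is continuous. *)
Lemma phi_proper : proper_map (sphere_atlas Om) (phi_of rho t).
Proof.
move=> K cK Khyp; rewrite points_sphere //.
have [M hM] : exists M : R, forall u, K u -> time u <= M.
  have [K0|K0] := pselect (K !=set0); last by exists 0 => u Ku; case: K0; exists u.
  have [|m _ hm] := @compact_EVT_max _ R (fun u => time u) _ K0 cK.
    by apply: continuous_subspaceT => u; exact: time_continuous.
  by exists (time m) => u Ku; apply: hm; rewrite inE.
(* The maximum with 1 keeps the argument of the logarithm positive when K is empty. *)
pose L := ln (2 * Num.max M 1) - t.
have M1 : 0 < 2 * Num.max M 1 by rewrite mulr_gt0 // lt_max ltr01 orbT.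
have sub : Om `&` phi_of rho t @^-1` K `<=` [set x | Om x /\ rho x <= L].
  move=> x [Ox Kx]; split=> //; rewrite /L lerBrDr -/(shift_rho x).
  have [h1 h2 _] := phi_of_algebra Ox (dot0r _).
  have := support_le_time h1 (Om_sphere oOm Ox) h2.
  rewrite -[in X in _ -> X]ler_expR lnK ?posrE // expRN ler_pdivlMr ?expR_gt0 // mul1r => h.
  rewrite (le_trans h) // ler_pM2l // (le_trans (hM _ Kx)) //.
  by rewrite le_max lexx.
apply: (@subclosed_compact _ _ _ _ (cpt (L := L))) => // x clx.
have cL : closed [set x | Om x /\ rho x <= L].
  by apply: compact_closed; [exact: norm_hausdorff|exact: cpt].
have [Ox _] : [set x | Om x /\ rho x <= L] x by apply: cL; apply: closure_subset clx.
split=> //.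
have clK : closed K by apply: compact_closed => //; exact: norm_hausdorff.
apply: clK => B Bx; have h : \forall z \near x, Om z -> B (phi_of rho t z) by exact: (phi_within Ox Bx).
by have [z [[Oz Kz] hz]] := clx _ h; exists (phi_of rho t z); split=> //; exact: hz.
Qed.

End PhiOf.

(** * Curvature bounds and Schouten bounds on the sphere *)

Lemma gram_conf_mx (R : realType) n (Om : set 'rV[R]_(1 + n)) (rho : 'rV[R]_(1 + n) -> R) b :
  gram (conformal_metric rho) (LParam (@stereo R n b @^-1` Om) (stereo b)) = conf_mx (conf_fun rho b).
Proof. by apply/funext => y; exact: gram_conformal. Qed.

Lemma schouten_of_curvature (R : realType) n (Om : set 'rV[R]_(1 + n)) (rho : 'rV[R]_(1 + n) -> R) :
  (2 < n)%N -> open_in_sphere Om -> smooth_map (sphere_atlas Om) (rho : _ -> R^o) ->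
  bounded_curvature (sphere_atlas Om) (conformal_metric rho) ->
  exists2 C : R, 0 < C & forall b y v, Om (stereo b y) ->
    `|schouten (conf_fun rho b) y v| <= C * (expR (2 * conf_fun rho b y) * dot v v).
Proof.
(* The absolute value and the added 1 make the constant positive, as the compactness argument
   requires. *)
move=> hn oOm srho [C hC]; exists (`|n%:R * (3 / 2 * C)| + 1).
  by rewrite ltr_wpDl.
move=> b y v Oy.
have h := @schouten_bound R n hn _ (conf_fun rho b) C y (@open_chart _ _ _ oOm b)
  (smooth_conf oOm srho (b := b)) Oy.
apply: (le_trans (h _ v)); last first.
  apply: ler_wpM2r; first by rewrite mulr_ge0 ?expR_ge0 ?dot_ge0.
  by rewrite (le_trans (ler_norm _)) // lerDl.
move=> u v' w z; have := hC _ (ex_intro _ b erefl) y Oy u v' w z.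
by rewrite gram_conf_mx.
Qed.

Lemma curvature_of_schouten (R : realType) n (Om : set 'rV[R]_(1 + n)) (rho : 'rV[R]_(1 + n) -> R) (C : R) :
  open_in_sphere Om -> smooth_map (sphere_atlas Om) (rho : _ -> R^o) ->
  (forall b y v, Om (stereo b y) ->
    `|schouten (conf_fun rho b) y v| <= C * (expR (2 * conf_fun rho b y) * dot v v)) ->
  bounded_curvature (sphere_atlas Om) (conformal_metric rho).
Proof.
move=> oOm srho hC; exists (4 * n%:R ^+ 4 * C) => _ [b ->] y /= Oy u v w z.
rewrite gram_conf_mx.
apply: (riem4_bound (@open_chart _ _ _ oOm b) (smooth_conf oOm srho (b := b)) Oy) => v'.
exact: hC.
Qed.

Lemma horospherical_hypersurfaces (R : realType) n (hn : (3 <= n)%N) (Omega : set 'rV[R]_(1 + n))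
    (rho : 'rV[R]_(1 + n) -> R) :
    sphere_domain Omega ->
    smooth_map (sphere_atlas Omega) (rho : _ -> R^o) ->
    complete_metric (sphere_atlas Omega) (conformal_metric rho) ->
    bounded_curvature (sphere_atlas Omega) (conformal_metric rho) ->
    exists t0 : R, forall t : R, t0 <= t ->
    [/\ hypersurface (sphere_atlas Omega) (phi_of rho t) (eta_of rho t),
        proper_map (sphere_atlas Omega) (phi_of rho t),
        complete_metric (sphere_atlas Omega) (induced_metric (phi_of rho t)),
        unif_horo_convex (sphere_atlas Omega) (phi_of rho t) (eta_of rho t) &
        boundary_at_infinity (phi_of rho t @` Omega) = sphere_boundary Omega].
Proof.
move=> [oOm _ _] srho cg bc.
have [C C0 hC] := schouten_of_curvature hn oOm srho bc.
have cpt (L : R) : compact [set x | Omega x /\ rho x <= L].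
  apply: (sublevel_compact oOm srho C0) => //; last by exact: ltn_trans hn.
  by move=> b y Oy v; rewrite (le_trans (ler_norm _)) // hC.
(* For t >= 2 C one has e^(2t) >= 1 + 2 t >= 4 C, so the bound C H becomes a quarter of e^(2t) H. *)
exists (2 * C) => t ht.
have bT b (y v : 'rV[R]_n) : Omega (stereo b y) ->
    `|schouten (conf_fun rho b) y v| <= 4^-1 * (expR (2 * conf_fun (shift_rho rho t) b y) * dot v v).
  move=> Oy; apply: (le_trans (hC b y v Oy)).
  have -> : expR (2 * conf_fun (shift_rho rho t) b y) = expR (2 * t) * expR (2 * conf_fun rho b y).
    by rewrite -expRD; congr expR; rewrite /conf_fun /shift_rho; ring.
  rewrite -mulrA [4^-1 * _]mulrA; apply: ler_wpM2r.
    by rewrite mulr_ge0 ?expR_ge0 ?dot_ge0.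
  have := expR_ge1Dx (2 * t); move: (expR _) => E hE; lra.
split.
- exact: phi_hypersurface.
- exact: phi_proper.
- exact: phi_complete.
- exact: phi_convex.
- exact: phi_boundary.
Qed.

(** * Simultaneous diagonalization *)

Definition sym_bilinear (R : realType) n (B : 'rV[R]_n -> 'rV[R]_n -> R) :=
  (forall a u v w, B (a *: u + v) w = a * B u w + B v w) /\ forall u v, B u v = B v u.

(** The first-variation argument: at t = - a / (d + 1) the quadratic equals - a^2 (d + 2) / (d +
    1)^2. The denominator d + 1 also covers d = 0. *)
Lemma linear_coef_eq0 (R : realType) (a d : R) : 0 <= d ->
  (forall t, 0 <= 2 * t * a + t ^+ 2 * d) -> a = 0.
Proof.
move=> d0 /(_ (- a / (d + 1))) h; have d1 : 0 < d + 1 by rewrite ltr_wpDl.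
have E : 2 * (- a / (d + 1)) * a + (- a / (d + 1)) ^+ 2 * d = - (a ^+ 2 * ((d + 2) / (d + 1) ^+ 2)).
  by field; rewrite gt_eqF.
move: h; rewrite E oppr_ge0 pmulr_lle0 => [h|].
  by apply/eqP; rewrite -sqrf_eq0 eq_le h sqr_ge0.
by rewrite divr_gt0 ?exprn_gt0 // ltr_wpDl.
Qed.

Section SymBilinear.
Context (R : realType) (n : nat) (B : 'rV[R]_n -> 'rV[R]_n -> R).
Hypothesis hB : sym_bilinear B.

Lemma bilinC u v : B u v = B v u. Proof. exact: hB.2. Qed.

Lemma bilin0l w : B 0 w = 0.
Proof. by have := hB.1 (-1) 0 0 w; rewrite scaler0 addr0 mulN1r addNr. Qed.

Lemma bilinZl a u w : B (a *: u) w = a * B u w.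
Proof. by have := hB.1 a u 0 w; rewrite !addr0 bilin0l addr0. Qed.

Lemma bilinDl u v w : B (u + v) w = B u w + B v w.
Proof. by have := hB.1 1 u v w; rewrite scale1r mul1r. Qed.

Lemma bilinZr a u w : B w (a *: u) = a * B w u.
Proof. by rewrite bilinC bilinZl bilinC. Qed.

Lemma bilinDr u v w : B w (u + v) = B w u + B w v.
Proof. by rewrite bilinC bilinDl !(bilinC w). Qed.

Lemma bilin_sum (I : Type) (r : seq I) (F : I -> 'rV[R]_n) w :
  B (\sum_(i <- r) F i) w = \sum_(i <- r) B (F i) w.
Proof.
elim: r => [|i r IH]; first by rewrite !big_nil bilin0l.
by rewrite !big_cons bilinDl IH.
Qed.

Lemma bilin_delta u w : B u w = \sum_i u 0 i * B (delta_mx 0 i) w.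
Proof.
by rewrite {1}(row_sum_delta u) bilin_sum; apply: eq_bigr => i _; rewrite bilinZl.
Qed.

Lemma bilin_continuous : continuous (fun u => B u u).
Proof.
pose P := \matrix_(i, j) B (delta_mx 0 i) (delta_mx 0 j).
have E : (fun u => B u u) = fun u : 'rV[R]_n => dot (u *m P) u.
  apply/funext => u; rewrite bilin_delta /dot.
  under eq_bigr => i _ do rewrite bilinC bilin_delta mulr_sumr.
  rewrite exchange_big /=; apply: eq_bigr => j _; rewrite mxE mulr_suml.
  by apply: eq_bigr => i _; rewrite mxE bilinC mulrA mulrAC.
rewrite E => u; apply: (@smooth_continuous _ _ _ setT) => //.
by apply: smooth_dot; [exact: openT|apply: smooth_mulmxr; [exact: openT|exact: smooth_id]|exact: smooth_id].
Qed.

End SymBilinear.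

Lemma kernel_closed (R : realType) n k (W : 'M[R]_(n, k)) : closed [set v : 'rV[R]_n | v *m W = 0].
Proof.
rewrite (_ : [set _ | _] = (fun v : 'rV[R]_n => v *m W) @^-1` [set 0]) //.
apply: closed_comp => [v _|].
  apply: (@smooth_continuous _ _ _ setT) => //.
  by apply: smooth_mulmxr; [exact: openT|exact: smooth_id].
by apply: compact_closed; [exact: norm_hausdorff|exact: compact_set1].
Qed.

Section Rayleigh.
Context (R : realType) (n : nat) (B C : 'rV[R]_n -> 'rV[R]_n -> R).
Hypotheses (hB : sym_bilinear B) (hC : sym_bilinear C) (pB : forall v, v != 0 -> 0 < B v v).

(** At a maximizer e0 of C / B on the unit sphere of the kernel of W, the form l B - C is
    nonnegative on that kernel and vanishes at e0, so its first variation at e0 vanishes. The kernel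
    constraint serves to impose B-orthogonality to vectors already found. *)
Lemma rayleigh k (W : 'M[R]_(n, k)) (v0 : 'rV[R]_n) : v0 != 0 -> v0 *m W = 0 ->
  exists (e : 'rV[R]_n) (l : R), [/\ e *m W = 0, B e e = 1 &
    forall w, w *m W = 0 -> C e w = l * B e w].
Proof.
move=> v00 v0W.
pose K := [set x : 'rV[R]_n | `|x - 0| = 1] `&` [set v | v *m W = 0].
have cK : compact K by apply: compact_closedI; [exact: compact_normsphere|exact: kernel_closed].
have unit_in (v : 'rV[R]_n) : v != 0 -> v *m W = 0 -> K (`|v|^-1 *: v).
  move=> vn vW; split=> /=; last by rewrite -scalemxAl vW scaler0.
  by rewrite subr0 normrZ normfV normr_id mulVf // normr_eq0.
have K0 : K !=set0 by exists (`|v0|^-1 *: v0); exact: unit_in.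
have Kn0 v : K v -> v != 0.
  by case=> /= v1 _; apply/eqP => v2; move: v1; rewrite v2 subr0 normr0 => /eqP; rewrite eq_sym oner_eq0.
have [|e0 e0K hmax] := EVT_max_rV K0 cK (f := fun v => C v v / B v v).
  apply: continuous_in_subspaceT => v; rewrite inE => Kv.
  have Bv : B v v != 0 by rewrite gt_eqF // pB // Kn0.
  exact: (cvgM (bilin_continuous hC (x := v)) (cvgV Bv (bilin_continuous hB (x := v)))).
move: e0K; rewrite inE => e0K; have e0n := Kn0 _ e0K.
have Be0 := pB e0n; set l := C e0 e0 / B e0 e0 in hmax.
have le v : v *m W = 0 -> 0 <= l * B v v - C v v.
  move=> vW; have [->|vn] := eqVneq v 0; first by rewrite !bilin0l // mulr0 subr0.
  have := hmax (`|v|^-1 *: v); rewrite inE => /(_ (unit_in _ vn vW)) /=.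
  rewrite !bilinZl // !bilinZr // -/l.
  have n0 : 0 < `|v|^-1 by rewrite invr_gt0 normr_gt0.
  move: (`|v|^-1) n0 => a a0; have Bv := pB vn.
  have -> : a * (a * C v v) / (a * (a * B v v)) = C v v / B v v.
    by field; rewrite !gt_eqF.
  by rewrite ler_pdivrMr // subr_ge0.
have stat w : w *m W = 0 -> C e0 w = l * B e0 w.
  move=> wW; apply/esym/subr0_eq; apply: (linear_coef_eq0 (le _ wW)) => t.
  have : 0 <= l * B (e0 + t *: w) (e0 + t *: w) - C (e0 + t *: w) (e0 + t *: w).
    by apply: le; rewrite mulmxDl -scalemxAl wW e0K.2 scaler0 addr0.
  rewrite !(bilinDl hB) !(bilinDl hC) !(bilinDr hB) !(bilinDr hC).
  rewrite !(bilinZl hB) !(bilinZl hC) !(bilinZr hB) !(bilinZr hC) (bilinC hB w e0) (bilinC hC w e0).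
  have E : l * B e0 e0 = C e0 e0 by rewrite /l divfK // gt_eqF.
  move: E; move: (l) (B e0 e0) (C e0 e0) (B e0 w) (C e0 w) (B w w) (C w w) => l' a b c d f g E.
  by move=> h; apply: le_trans h _; rewrite le_eqVlt -E; apply/orP; left; apply/eqP; ring.
have s0 : 0 < Num.sqrt (B e0 e0) by rewrite sqrtr_gt0.
exists ((Num.sqrt (B e0 e0))^-1 *: e0), l; split.
- by rewrite -scalemxAl e0K.2 scaler0.
- rewrite bilinZl // bilinZr // -[in X in _ * (_ * X)](sqr_sqrtr (ltW Be0)) expr2.
  by field; rewrite gt_eqF.
- by move=> w wW; rewrite !bilinZl // stat // mulrCA.
Qed.

(** Successive constrained maxima: for k < n the B-orthogonal complement of the first k vectors is
    nonzero by rank. Indexing by [nat] lets the family grow without casts between ordinals. *)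
Lemma partial_diagonalization k : (k <= n)%N ->
  exists (e : nat -> 'rV[R]_n) (l : nat -> R),
    (forall i j, (i < k)%N -> (j < k)%N -> B (e i) (e j) = (i == j)%:R) /\
    forall i v, (i < k)%N -> C (e i) v = l i * B (e i) v.
Proof.
elim: k => [_|k IH kn]; first by exists (fun=> 0), (fun=> 0).
have [e [l [on pr]]] := IH (ltnW kn).
pose W := \matrix_(i < n, j < k) B (delta_mx 0 i) (e j).
have WE v : v *m W = 0 <-> forall j, (j < k)%N -> B v (e j) = 0.
  have E (j : 'I_k) : (v *m W) 0 j = B v (e j).
    by rewrite mxE (bilin_delta hB); apply: eq_bigr => i _; rewrite mxE.
  split=> [h j jk|h]; first by rewrite -(E (Ordinal jk)) h mxE.
  by apply/rowP => j; rewrite E h // mxE.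
have [v0 v0n v0W] : exists2 v0 : 'rV[R]_n, v0 != 0 & v0 *m W = 0.
  have : kermx W != 0 by rewrite -mxrank_eq0 mxrank_ker subn_eq0 -ltnNge (leq_ltn_trans (rank_leq_col _)).
  by move/rowV0Pn => [v /sub_kermxP vW vn]; exists v.
have [f [m [fW f1 fC]]] := rayleigh v0n v0W.
have fe := (WE f).1 fW.
exists (fun i => if i == k then f else e i), (fun i => if i == k then m else l i); split.
  move=> i j; rewrite !ltnS => ik jk.
  case: eqVneq => [ik'|ik'] /=; case: eqVneq => [jk'|jk'] //=; rewrite ?ik' ?jk'.
  - by rewrite eqxx.
  - by rewrite fe ?(eq_sym k) ?(negbTE jk') // ltn_neqAle jk'.
  - by rewrite (bilinC hB) fe ?(negbTE ik') // ltn_neqAle ik'.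
  - by rewrite on // ltn_neqAle ?ik' ?jk'.
move=> i v; rewrite ltnS => ik; case: eqVneq => [_|ik']; last by rewrite pr // ltn_neqAle ik'.
(* [rayleigh] gives the eigenvector relation on the complement only. It extends to v = w + p, with p
   the projection of v to the earlier span, because f is orthogonal to p for B and, the earlier
   vectors being eigenvectors, for C as well. *)
pose p := \sum_(j < k) B v (e j) *: e j; pose w := v - p.
have pe (j : nat) : (j < k)%N -> B p (e j) = B v (e j).
  move=> jk; rewrite (bilin_sum hB) (bigD1 (Ordinal jk)) //= (bilinZl hB) on // eqxx mulr1.
  rewrite big1 ?addr0 // => i' i'j; rewrite (bilinZl hB) on //.
  by rewrite (_ : (i' == j :> nat) = false) ?mulr0 //; apply/negbTE.
have wW : w *m W = 0.
  by apply/WE => j jk; rewrite (bilinDl hB) -scaleN1r (bilinZl hB) pe // mulN1r subrr.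
have vE : v = w + p by rewrite subrK.
have fp : B f p = 0.
  rewrite (bilinC hB) (bilin_sum hB) big1 // => j _.
  by rewrite (bilinZl hB) (bilinC hB (e j) f) fe // mulr0.
have Cfp : C f p = 0.
  rewrite (bilinC hC) (bilin_sum hC) big1 // => j _.
  by rewrite (bilinZl hC) pr // (bilinC hB (e j) f) fe // !mulr0.
by rewrite vE (bilinDr hC) (bilinDr hB) fp Cfp !addr0 fC.
Qed.

(** The matrix P sends u to its coefficients B u (e j). A left inverse of a square matrix makes it
    invertible, so a vector with zero coefficients vanishes. *)
Lemma orthonormal_expansion (e : 'I_n -> 'rV[R]_n) :
  (forall i j, B (e i) (e j) = (i == j)%:R) -> forall v, v = \sum_i B v (e i) *: e i.
Proof.
move=> on v; pose P := \matrix_(i, j) B (delta_mx 0 i) (e j).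
pose E := \matrix_(i, j) e i 0 j.
have PE (u : 'rV[R]_n) j : (u *m P) 0 j = B u (e j).
  by rewrite mxE (bilin_delta hB); apply: eq_bigr => i _; rewrite mxE.
have EP : E *m P = 1%:M.
  apply/matrixP => i j; have -> : (E *m P) i j = (row i E *m P) 0 j.
    by rewrite -row_mul [RHS]mxE.
  have -> : row i E = e i by apply/rowP => m; rewrite !mxE.
  by rewrite PE on mxE.
have [_ uP] := mulmx1_unit EP.
apply/subr0_eq; rewrite -[LHS](mulmxK uP); set w := v - _.
suff -> : w *m P = 0 by rewrite mul0mx.
apply/rowP => j; rewrite PE /w (bilinDl hB) -scaleN1r (bilinZl hB) (bilin_sum hB) mxE.
rewrite (bigD1 j) //= (bilinZl hB) on eqxx mulr1 big1 ?addr0 ?mulN1r ?subrr // => i ij.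
by rewrite (bilinZl hB) on (negbTE ij) mulr0.
Qed.

Lemma simultaneous_diagonalization : exists (e : 'I_n -> 'rV[R]_n) (l : 'I_n -> R),
  [/\ forall i j, B (e i) (e j) = (i == j)%:R,
      forall i v, C (e i) v = l i * B (e i) v &
      forall v, v = \sum_i B v (e i) *: e i].
Proof.
have [e [l [on pr]]] := partial_diagonalization (leqnn n).
have on' (i j : 'I_n) : B (e i) (e j) = (i == j)%:R by exact: on.
exists (fun i => e i), (fun i => l i); split=> //.
- by move=> i v; exact: pr.
- exact: orthonormal_expansion.
Qed.

End Rayleigh.

(** * Horospherical convexity *)

Lemma lorentz0r (R : realType) m (w : 'rV[R]_(1 + m)) : lorentz w 0 = 0.
Proof. by rewrite lorentzC lorentz0l. Qed.

Lemma lorentz_sumr (R : realType) m (I : Type) (r : seq I) (a : I -> 'rV[R]_(1 + m)) x :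
  lorentz x (\sum_(i <- r) a i) = \sum_(i <- r) lorentz x (a i).
Proof.
elim: r => [|i r IH]; first by rewrite !big_nil lorentz0r.
by rewrite !big_cons lorentzDr IH.
Qed.

(** The n + 2 vectors p, q, f_i are Lorentz-orthonormal, hence a basis, so x is orthogonal to
    everything. *)
Lemma lorentz_frame_eq0 (R : realType) n (p q : 'rV[R]_(1 + (1 + n))) (f : 'I_n -> 'rV[R]_(1 + (1 + n))) x :
  lorentz p p = -1 -> lorentz q q = 1 -> lorentz q p = 0 ->
  (forall i, lorentz p (f i) = 0) -> (forall i, lorentz q (f i) = 0) ->
  (forall i j, lorentz (f i) (f j) = (i == j)%:R) ->
  lorentz x p = 0 -> lorentz x q = 0 -> (forall i, lorentz x (f i) = 0) -> x = 0.
Proof.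
move=> pp qq qp pf qf ff xp xq xf.
have pq : lorentz p q = 0 by rewrite lorentzC.
pose P := col_mx p (col_mx q (\matrix_i f i)).
pose a (v : 'rV[R]_(1 + (1 + n))) := v 0 (lshift _ 0).
pose b (v : 'rV[R]_(1 + (1 + n))) := rsubmx v 0 (lshift _ 0).
pose c (v : 'rV[R]_(1 + (1 + n))) i := rsubmx (rsubmx v) 0 i.
have vP v : v *m P = a v *: p + (b v *: q + \sum_i c v i *: f i).
  rewrite -[in LHS](hsubmxK v) mul_row_col -[in LHS](hsubmxK (rsubmx v)) mul_row_col.
  congr (_ + (_ + _)).
  - by rewrite [lsubmx v]mx11_scalar mul_scalar_mx mxE.
  - by rewrite [lsubmx (rsubmx v)]mx11_scalar mul_scalar_mx mxE.
  - by rewrite mulmx_sum_row; apply: eq_bigr => i _; rewrite rowK.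
have uP : P \in unitmx.
  rewrite -row_free_unit; apply: inj_row_free => v; rewrite vP => v0.
  have sum0 y : (forall i, lorentz y (f i) = 0) -> lorentz y (\sum_i c v i *: f i) = 0.
    by move=> yf; rewrite lorentz_sumr big1 // => i _; rewrite lorentzZr yf mulr0.
  have a0 : a v = 0.
    have := congr1 (lorentz p) v0; rewrite !(lorentzDr, lorentzZr) pp pq sum0 // lorentz0r.
    by rewrite mulr0 !addr0 mulrN1 => /eqP; rewrite oppr_eq0 => /eqP.
  have b0 : b v = 0.
    have := congr1 (lorentz q) v0; rewrite !(lorentzDr, lorentzZr) qq qp sum0 // lorentz0r.
    by rewrite mulr0 add0r addr0 mulr1.
  have c0 i : c v i = 0.
    have := congr1 (lorentz (f i)) v0; rewrite !(lorentzDr, lorentzZr) lorentz0r a0 b0 !mul0r !add0r.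
    rewrite lorentz_sumr (bigD1 i) //= lorentzZr ff eqxx mulr1 big1 ?addr0 // => j ji.
    by rewrite lorentzZr ff eq_sym (negbTE ji) mulr0.
  rewrite -(hsubmxK v) -(hsubmxK (rsubmx v)).
  have -> : lsubmx v = 0 by rewrite [lsubmx v]mx11_scalar mxE -/(a v) a0 raddf0.
  have -> : lsubmx (rsubmx v) = 0 by rewrite [lsubmx (rsubmx v)]mx11_scalar mxE -/(b v) b0 raddf0.
  have -> : rsubmx (rsubmx v) = 0 by apply/rowP => i; rewrite [RHS]mxE; exact: c0.
  by rewrite !row_mx0.
have all0 u : lorentz x u = 0.
  rewrite -(mulmxKV uP u) vP !lorentzDr !lorentzZr xp xq !mulr0 !add0r lorentz_sumr big1 // => i _.
  by rewrite lorentzZr xf mulr0.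
(* Pairing x with its time reversal gives the Euclidean square of x. *)
have := all0 (vec (- time x) (rsubmx x)); rewrite [x in lorentz x _]vec_eta lorentz_vec mulrN opprK.
move/eqP; rewrite -expr2 paddr_eq0 ?sqr_ge0 ?dot_ge0 // sqrf_eq0 => /andP[/eqP t0 /eqP /dot_eq0 r0].
by rewrite (vec_eta x) t0 r0 vec00.
Qed.

Lemma derive_sym_mx (R : realType) (V : normedModType R) m k (U : set V) (f : V -> 'M[R]_(m, k)) x u v :
  open U -> smooth_on U f -> U x -> 'D_v ('D_u f) x = 'D_u ('D_v f) x.
Proof.
move=> oU sf Ux; apply/matrixP => i j.
have sd w := smooth_differentiable (smooth_derive w sf) Ux.
have nU : \forall z \near x, U z by exact: open_nbhs_nbhs.
have e w : \forall z \near x, ('D_w f z) i j = 'D_w (fun z => f z i j) z.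
  by apply: filterS nU => z Uz; rewrite derive_entry //; exact: (smooth_differentiable sf).
have s1 : Ck 1 U (fun z => f z i j) by exact: (smooth_onP _ _).1 (smooth_entry i j oU sf) 1%N.
apply: (etrans (esym (derive_entry i j v (sd u)))).
apply: (etrans (near_eq_derive _ (e u))); apply: (etrans (derive_sym u v oU s1 Ux)).
apply: (etrans (esym (near_eq_derive _ (e v)))); exact: derive_entry.
Qed.

Section HorosphericalConvexity.
Context (R : realType) (n : nat) (U : set 'rV[R]_n) (p q : 'rV[R]_n -> 'rV[R]_(1 + (1 + n))).
Hypotheses (oU : open U) (sp : smooth_on U p) (sq : smooth_on U q).
Hypotheses (imm : forall y v, U y -> 'D_v p y = 0 -> v = 0).
Hypotheses (pp : forall y, U y -> lorentz (p y) (p y) = -1)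
  (qq : forall y, U y -> lorentz (q y) (q y) = 1)
  (qp : forall y, U y -> lorentz (q y) (p y) = 0)
  (qdp : forall y v, U y -> lorentz (q y) ('D_v p y) = 0).

Lemma derive_const_on (f : 'rV[R]_n -> R) (a : R) y v :
  (forall z, U z -> f z = a) -> U y -> 'D_v f y = 0.
Proof.
move=> h Uy; rewrite -[RHS](derive_cst a y v); apply: near_eq_derive.
have nU : \forall z \near y, U z by exact: open_nbhs_nbhs.
by apply: filterS nU => z /h.
Qed.

Let dp y : U y -> differentiable p y. Proof. exact: smooth_differentiable. Qed.
Let dq y : U y -> differentiable q y. Proof. exact: smooth_differentiable. Qed.

Lemma tangent_position y v : U y -> lorentz ('D_v p y) (p y) = 0.
Proof.
move=> Uy; have := derive_const_on v pp Uy.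
rewrite (derive_lorentz v (dp Uy) (dp Uy)).2 (lorentzC (p y)) => /eqP.
by rewrite -mulr2n mulrn_eq0 /= => /eqP.
Qed.

Lemma normal_derive_normal y v : U y -> lorentz ('D_v q y) (q y) = 0.
Proof.
move=> Uy; have := derive_const_on v qq Uy.
rewrite (derive_lorentz v (dq Uy) (dq Uy)).2 (lorentzC (q y)) => /eqP.
by rewrite -mulr2n mulrn_eq0 /= => /eqP.
Qed.

Lemma normal_derive_position y v : U y -> lorentz ('D_v q y) (p y) = 0.
Proof.
move=> Uy; have := derive_const_on v qp Uy.
by rewrite (derive_lorentz v (dq Uy) (dp Uy)).2 qdp // addr0.
Qed.

Lemma second_form y u v : U y ->
  lorentz ('D_u q y) ('D_v p y) = - lorentz (q y) ('D_u ('D_v p) y).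
Proof.
move=> Uy; have dv := smooth_differentiable (smooth_derive v sp) Uy.
have := derive_const_on u (fun z Uz => qdp v Uz) Uy.
by rewrite (derive_lorentz u (dq Uy) dv).2 => /eqP; rewrite addr_eq0 => /eqP.
Qed.

Lemma first_form_bilinear y : U y -> sym_bilinear (fun u v => lorentz ('D_u p y) ('D_v p y)).
Proof.
move=> Uy; split=> [a u v w|u v]; last exact: lorentzC.
have E := derive_linear a u v (dp Uy).
apply: (etrans (congr1 (fun X => lorentz X ('D_w p y)) E)).
by move: ('D_u p y) ('D_v p y) ('D_w p y) => x1 x2 x3; rewrite lorentzDl lorentzZl.
Qed.

Lemma second_form_bilinear y : U y -> sym_bilinear (fun u v => - lorentz ('D_u q y) ('D_v p y)).
Proof.
move=> Uy; split=> [a u v w|u v].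
  have E := derive_linear a u v (dq Uy).
  apply: (etrans (congr1 (fun X => - lorentz X ('D_w p y)) E)).
  by move: ('D_u q y) ('D_v q y) ('D_w p y) => x1 x2 x3; rewrite lorentzDl lorentzZl opprD mulrN.
apply: congr1; apply: (etrans (second_form u v Uy)); apply: (etrans _ (esym (second_form v u Uy))).
by apply: (congr1 (fun X => - lorentz (q y) X)); exact: (derive_sym_mx _ _ oU sp Uy).
Qed.

Lemma first_form_pos y v : U y -> v != 0 -> 0 < lorentz ('D_v p y) ('D_v p y).
Proof.
move=> Uy v0; have h := tangent_position v Uy.
rewrite lt0r (lorentz_tangent_ge0 (pp Uy) h) andbT; apply: contra v0 => /eqP h0.
by apply/eqP/(imm Uy)/(lorentz_tangent_eq0 (pp Uy) h h0).
Qed.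

Variables (k0 : R) (y : 'rV[R]_n).
Hypotheses (k01 : k0 < 1) (Uy : U y) (hk : forall (e : 'I_n -> 'rV[R]_n) (k : 'I_n -> R),
  (forall i j, lorentz ('D_(e i) p y) ('D_(e j) p y) = (i == j)%:R) ->
  (forall i, 'D_(e i) q y = - k i *: 'D_(e i) p y) -> forall i, k i <= k0).

(** The convexity hypothesis speaks about principal frames, so one is first produced by
    diagonalizing the second form against the first. With c_i the coefficients of v in it, the
    pairings are the sums of c_i^2 weighted by 1, 1 - k_i and (1 - k_i)^2, and they are compared
    termwise through 0 < 1 - k0 <= 1 - k_i. *)
Lemma horo_convex_bounds v : let psi := fun z => p z + q z in
  [/\ 0 <= lorentz ('D_v p y) ('D_v psi y),
      (1 - k0) * lorentz ('D_v p y) ('D_v psi y) <= lorentz ('D_v psi y) ('D_v psi y) &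
      (1 - k0) ^+ 2 * lorentz ('D_v p y) ('D_v p y) <= lorentz ('D_v psi y) ('D_v psi y)].
Proof.
move=> psi; have hB := first_form_bilinear Uy; have hC := second_form_bilinear Uy.
have [e [k [on pr ex]]] := simultaneous_diagonalization hB hC (fun v => first_form_pos (v := v) Uy).
(* Diagonalization only determines pairings with tangent vectors; as dq is also orthogonal to p and
   q, [lorentz_frame_eq0] turns them into an equality of vectors. *)
have frame i : 'D_(e i) q y = - k i *: 'D_(e i) p y.
  apply/eqP; rewrite -subr_eq0 scaleNr opprK; apply/eqP.
  apply: (@lorentz_frame_eq0 R n (p y) (q y) (fun i => 'D_(e i) p y)) => //.
  - exact: pp.
  - exact: qq.
  - exact: qp.
  - by move=> j; rewrite lorentzC tangent_position.
  - by move=> j; exact: qdp.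
  - by rewrite lorentzDl lorentzZl tangent_position // normal_derive_position // mulr0 addr0.
  - by rewrite lorentzDl lorentzZl normal_derive_normal // (lorentzC _ (q y)) qdp // mulr0 addr0.
  - move=> j; rewrite lorentzDl lorentzZl; have /= := pr i (e j); move/eqP; rewrite eqr_oppLR => /eqP ->.
    by rewrite addNr.
have hki := hk on frame.
have [_ ePsi] := derive_addf v (dp Uy) (dq Uy).
pose c i := lorentz ('D_v p y) ('D_(e i) p y).
have vE := ex v; rewrite /= in vE.
have DvE (g : 'rV[R]_n -> 'rV[R]_(1 + (1 + n))) : differentiable g y -> 'D_v g y = \sum_i c i *: 'D_(e i) g y.
  move=> dg; have E w := derive_mulmx_jacobian w dg.
  rewrite (E v) {1}vE mulmx_suml; apply: eq_bigr => i _.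
  by rewrite -scalemxAl -(E (e i)).
have psiE : 'D_v psi y = \sum_i (c i * (1 - k i)) *: 'D_(e i) p y.
  rewrite [LHS]ePsi (DvE p (dp Uy)) (DvE q (dq Uy)) -big_split /=; apply: eq_bigr => i _.
  by rewrite frame scalerA -scalerDl; congr (_ *: _); ring.
have qi i : lorentz ('D_v q y) ('D_(e i) p y) = - (k i * c i).
  have /= := pr i v; rewrite (bilinC hC) (lorentzC ('D_(e i) p y)) -/(c i) => /eqP.
  by rewrite eqr_oppLR => /eqP.
have H1 : lorentz ('D_v p y) ('D_v p y) = \sum_i c i ^+ 2.
  by rewrite {2}(DvE p (dp Uy)) lorentz_sumr; apply: eq_bigr => i _; rewrite lorentzZr -expr2.
have H2 : lorentz ('D_v p y) ('D_v psi y) = \sum_i c i ^+ 2 * (1 - k i).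
  by rewrite psiE lorentz_sumr; apply: eq_bigr => i _; rewrite lorentzZr -/(c i) expr2 mulrAC.
have H3 : lorentz ('D_v psi y) ('D_v psi y) = \sum_i c i ^+ 2 * (1 - k i) ^+ 2.
  rewrite {2}psiE lorentz_sumr; apply: eq_bigr => i _.
  rewrite lorentzZr [in X in _ * X]ePsi lorentzDl qi -/(c i); ring.
have m i : 0 < 1 - k0 <= 1 - k i.
  by have := hki i; rewrite subr_gt0 k01 /= lerD2l lerN2.
split.
- rewrite H2; apply: sumr_ge0 => i _; have /andP[a b] := m i.
  by rewrite mulr_ge0 ?sqr_ge0 // (le_trans (ltW a)).
- rewrite H2 H3 mulr_sumr; apply: ler_sum => i _; have /andP[a b] := m i.
  by rewrite mulrCA ler_wpM2l ?sqr_ge0 // expr2 ler_wpM2r // (le_trans (ltW a) b).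
- rewrite H1 H3 mulr_sumr; apply: ler_sum => i _; have /andP[a b] := m i.
  by rewrite mulrC ler_wpM2l ?sqr_ge0 // !expr2 ler_pM // (ltW a).
Qed.

End HorosphericalConvexity.

(** * The Gauss map *)

Lemma sum_continuous (R : realType) (T : topologicalType) (W : normedModType R) (I : Type) (r : seq I)
    (f : I -> T -> W) (x : T) :
  (forall i, {for x, continuous (f i)}) -> {for x, continuous (fun z => \sum_(i <- r) f i z)}.
Proof.
move=> cf; elim: r => [|i r IH].
  rewrite (_ : (fun z => _) = fun=> 0); first exact: cvg_cst.
  by apply/funext => z; rewrite big_nil.
rewrite (_ : (fun z => _) = fun z => f i z + \sum_(j <- r) f j z); first exact: (cvgD (cf i) IH).
by apply/funext => z; rewrite big_cons.
Qed.

Lemma near_eq_continuous (T U : topologicalType) (f g : T -> U) (x : T) :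
  (\forall z \near x, f z = g z) -> {for x, continuous g} -> {for x, continuous f}.
Proof.
move=> fg cg; rewrite /prop_for /continuous_at (nbhs_singleton fg).
apply: cvg_trans cg; apply: near_eq_cvg.
by apply: filterS fg => z ->.
Qed.

Lemma C1_smooth_comp (R : realType) n m (V : set 'rV[R]_n) (K : 'rV[R]_n -> 'rV[R]_m) (y : R -> 'rV[R]_n) (t : R) :
  open V -> smooth_on V K -> V (y t) ->
  (\forall s \near t, derivable y s 1 /\ {for s, continuous (derive1 y)}) ->
  \forall s \near t, [/\ V (y s), derivable (K \o y) s 1 & {for s, continuous (derive1 (K \o y))}].
Proof.
move=> oV sK Vt hy; have [dt _] := nbhs_singleton hy.
have cy (s : R) : derivable y s 1 -> {for s, continuous y}.
  by move=> ds; apply: differentiable_continuous; exact/derivable1_diffP.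
have ct := cy t dt.
have nV : \forall s \near t, V (y s) by exact: (ct _ (open_nbhs_nbhs (conj oV Vt))).
have hall : \forall s \near t, V (y s) /\ (derivable y s 1 /\ {for s, continuous (derive1 y)}).
  by apply: filterI.
(* Continuity of the derivative at s needs the chain rule on a neighbourhood of s, not only at s. *)
apply: filterS (near_join hall) => s hs; have [Vs [ds cs]] := nbhs_singleton hs.
have dK z : V z -> differentiable K z by exact: smooth_differentiable.
split=> //; first by have [] := derive1_comp_diff (dK _ Vs) ds.
have css := cy s ds.
apply: (@near_eq_continuous _ _ _ (fun r => \sum_i (derive1 y r) 0 i *: partial i K (y r))).
  apply: filterS hs => r [Vr [dr _]].
  by rewrite (derive1_comp_diff (dK _ Vr) dr).2; exact: derive_coord (dK _ Vr).
apply: sum_continuous => i; apply: cvgZ.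
  exact: (cvg_comp _ (fun N : 'rV[R]_n => N 0 i) cs (@coord_continuous R 1 n 0 i _)).
exact: (cvg_comp _ (partial i K) css (smooth_continuous (smooth_derive (delta_mx 0 i) sK) Vs)).
Qed.

Section GaussMap.
Context (R : realType) (n : nat) (M : topologicalType) (A : set (lparam R n M))
  (phi eta : M -> 'rV[R]_(1 + (1 + n))) (G : M -> 'rV[R]_(1 + n)) (rhot : M -> R) (k0 : R).
Hypotheses (mA : smooth_manifold A) (hyp : hypersurface A phi eta) (k01 : k0 < 1)
  (hk : forall c, A c -> forall y, lp_dom c y -> forall e kappa,
     principal_frame phi eta c y e kappa -> forall i, kappa i <= k0)
  (gs : gauss_support A phi eta G rhot) (injG : injective G).

Let psi p := phi p + eta p.

Lemma in_points p : points A p. Proof. by have [_ _ -> _ _] := mA. Qed.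

Lemma dom_open c : A c -> open (lp_dom c).
Proof. by move=> Ac; have [_ _ _ /(_ c Ac)[]] := mA. Qed.

Lemma chart_inj c : A c -> {in lp_dom c &, injective c}.
Proof. by move=> Ac; have [_ _ _ /(_ c Ac)[]] := mA. Qed.

Lemma psiE p : psi p = expR (rhot p) *: vec 1 (G p).
Proof. exact: gs (in_points p). Qed.

Lemma lorentz_phi p : lorentz (phi p) (phi p) = -1.
Proof. by have [_ _ /(_ p (in_points p))[[]]] := hyp. Qed.

Lemma lorentz_eta p : lorentz (eta p) (eta p) = 1.
Proof. by have [_ _ /(_ p (in_points p))[]] := hyp. Qed.

Lemma lorentz_eta_phi p : lorentz (eta p) (phi p) = 0.
Proof. by have [_ _ /(_ p (in_points p))[]] := hyp. Qed.

Lemma lorentz_phi_psi p : lorentz (phi p) (psi p) = -1.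
Proof. by rewrite lorentzDr lorentz_phi lorentzC lorentz_eta_phi addr0. Qed.

Lemma gauss_sphere p : dot (G p) (G p) = 1.
Proof.
have : lorentz (psi p) (psi p) = 0.
  rewrite lorentzDl !lorentzDr lorentz_phi lorentz_eta lorentz_eta_phi lorentzC lorentz_eta_phi.
  by rewrite addr0 add0r addNr.
rewrite psiE lorentzZl lorentzZr lorentz_vec mulr1 => /eqP.
have e0 : (expR (rhot p) == 0) = false by rewrite gt_eqF // expR_gt0.
by rewrite !mulf_eq0 e0 /= addrC subr_eq0 => /eqP.
Qed.

Lemma smooth_phi c : A c -> smooth_on (lp_dom c) (phi \o c).
Proof. by move=> Ac; have [[/(_ c Ac)]] := hyp. Qed.

Lemma smooth_eta c : A c -> smooth_on (lp_dom c) (eta \o c).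
Proof. by move=> Ac; have [_ /(_ c Ac)] := hyp. Qed.

Lemma smooth_psi c : A c -> smooth_on (lp_dom c) (psi \o c).
Proof. by move=> Ac; exact: (smoothD (dom_open Ac) (smooth_phi Ac) (smooth_eta Ac)). Qed.

Lemma time_psi p : time (psi p) = expR (rhot p).
Proof. by rewrite psiE timeZ vecE0 mulr1. Qed.

Lemma smooth_support c : A c -> smooth_on (lp_dom c) (rhot \o c).
Proof.
move=> Ac; have oc := dom_open Ac.
apply: (@smooth_eq _ _ _ _ (fun y => ln (time ((psi \o c) y)))) => //.
  by move=> y _ /=; rewrite time_psi expRK.
apply: smooth_ln => //; first by move=> y _ /=; rewrite time_psi expR_gt0.
by apply: smooth_time => //; exact: smooth_psi.
Qed.

Lemma smooth_gauss c : A c -> smooth_on (lp_dom c) (G \o c).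
Proof.
move=> Ac; have oc := dom_open Ac.
apply: (@smooth_eq _ _ _ _ (fun y => expR (- (rhot \o c) y) *: rsubmx ((psi \o c) y))) => //.
  move=> y _ /=; rewrite psiE vecZ vecEr scalerA -expRD addNr expR0 scale1r //.
apply: smooth_scale => //; last by apply: smooth_rsubmx => //; exact: smooth_psi.
by apply: smooth_exp => //; apply: smoothN => //; exact: smooth_support.
Qed.

Let imm c : A c -> forall y v, lp_dom c y -> 'D_v (phi \o c) y = 0 -> v = 0.
Proof. by move=> Ac y v Dy; have [[_ h] _ _ _] := hyp; exact: h. Qed.

Let bounds c y v : A c -> lp_dom c y ->
  [/\ 0 <= lorentz ('D_v (phi \o c) y) ('D_v (psi \o c) y),
      (1 - k0) * lorentz ('D_v (phi \o c) y) ('D_v (psi \o c) y) <= lorentz ('D_v (psi \o c) y) ('D_v (psi \o c) y) &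
      (1 - k0) ^+ 2 * lorentz ('D_v (phi \o c) y) ('D_v (phi \o c) y) <= lorentz ('D_v (psi \o c) y) ('D_v (psi \o c) y)].
Proof.
move=> Ac Dy; apply: (horo_convex_bounds (dom_open Ac) (smooth_phi Ac) (smooth_eta Ac) (imm Ac)) => //.
- by move=> z _; exact: lorentz_phi.
- by move=> z _; exact: lorentz_eta.
- by move=> z _; exact: lorentz_eta_phi.
- by move=> z w Dz; have [_ _ _ h] := hyp; exact: h.
- by move=> e k on fr i; apply: (hk Ac Dy (e := e) (kappa := k)).
Qed.

(** If dG(v) = 0 then dpsi(v) is a multiple of the null vector (1, G), so <dpsi, dpsi> vanishes on
    v. The last of the [bounds] then contradicts positivity of the induced metric. *)
Lemma gauss_immersion : immersion A G.
Proof.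
split; first by move=> c Ac; exact: smooth_gauss.
move=> c Ac y Dy v h.
have dr := smooth_differentiable (smooth_support Ac) Dy.
have dG := smooth_differentiable (smooth_gauss Ac) Dy.
have [d1 e1] := derive_exp v dr.
have c0 : differentiable (fun _ : 'rV[R]_n => 1 : R) y by exact: differentiable_cst.
have c0' : 'D_v (fun _ : 'rV[R]_n => 1 : R) y = 0 by exact: derive_cst.
have [d2 e2] := derive_vec v c0 dG.
have [d3 e3] := derive_scale v d1 d2.
have E : psi \o c = fun z => expR ((rhot \o c) z) *: vec 1 ((G \o c) z).
  by apply/funext => z; exact: psiE.
have D0 : 'D_v (psi \o c) y = 'D_v (fun z => expR ((rhot \o c) z)) y *: vec 1 (G (c y)).
  apply: (etrans (congr1 (fun g => 'D_v g y) E)); apply: (etrans e3).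
  have -> := e2; rewrite c0' h vec00 scaler0 addr0; exact: erefl.
have H0 : lorentz ('D_v (psi \o c) y) ('D_v (psi \o c) y) = 0.
  by rewrite D0 lorentzZl lorentzZr lorentz_vec gauss_sphere mulr1 addNr !mulr0.
have [_ _] := bounds v Ac Dy; rewrite H0 => h3.
apply/eqP/negPn/negP => v0.
have := first_form_pos (dom_open Ac) (smooth_phi Ac) (imm Ac) (fun z _ => lorentz_phi (c z)) Dy v0.
have k1 : 0 < (1 - k0) ^+ 2 by rewrite exprn_gt0 // subr_gt0.
by rewrite ltNge -(pmulr_rle0 _ k1) h3.
Qed.

(** [c \o K] is the inverse of G read in the chart [stereo b]: G followed by [stereo_inv b] is an
    injective immersion between open sets of R^n, to which [inverse_function] applies. Regularity of
    everything transported to the image of G rests on this. *)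
Lemma gauss_chart b (y : 'rV[R]_n) : range G (stereo b y) ->
  exists (c : lparam R n M) (V : set 'rV[R]_n) (K : 'rV[R]_n -> 'rV[R]_n),
    [/\ A c, open V, V y, smooth_on V K &
        forall z, V z -> lp_dom c (K z) /\ G (c (K z)) = stereo b z].
Proof.
move=> [p _ pE]; have [c Ac [y0 Dy0 cy0]] := in_points p.
have [oP sP] := smooth_stereo_inv R n b.
set P := [set x | 1 - chart_sign R b * time x != 0] in oP sP.
pose U := lp_dom c `&` (G \o c) @^-1` P.
have oc := dom_open Ac; have sG := smooth_gauss Ac.
have oU : open U.
  rewrite openE => z [Dz Pz]; apply: filterI; first exact: open_nbhs_nbhs.
  exact: (smooth_continuous sG Dz (open_nbhs_nbhs (conj oP Pz))).
have UD : U `<=` lp_dom c by move=> z [].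
have UP z : U z -> P (G (c z)) by case.
pose F := @stereo_inv R n b \o (G \o c).
have sF : smooth_on U F by apply: (smooth_comp_mx oU oP) => //; exact: smooth_subset sG.
have FK z : U z -> stereo b (F z) = G (c z).
  by move=> Uz; apply: stereo_invK; [exact: gauss_sphere|exact: UP].
have injF : {in U &, injective F}.
  move=> z1 z2; rewrite !inE => U1 U2 e.
  apply: (chart_inj Ac); rewrite ?inE; [exact: UD|exact: UD|].
  by apply: injG; rewrite -!FK // e.
have dF z v : U z -> 'D_v F z = 0 -> v = 0.
  move=> Uz Fv; have [_ h] := gauss_immersion; apply: (h c Ac z (UD _ Uz)).
  have nU : \forall x \near z, U x by exact: open_nbhs_nbhs.
  have e : \forall x \near z, (G \o c) x = (stereo b \o F) x.
    by apply: filterS nU => x Ux /=; rewrite FK.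
  apply: (etrans (near_eq_derive _ e)).
  have dFz := smooth_differentiable sF Uz.
  apply: (etrans (derive_comp v dFz (diff_stereo b (F z)))).
  by apply: (etrans (congr1 (fun w => 'D_w (stereo b) (F z)) Fv)); exact: derive0.
have [oV [K KF sK]] := inverse_function oU sF injF dF.
exists c, (F @` U), K; split=> //.
  exists y0; last by rewrite /F /= cy0 pE stereoK.
  by split=> //=; rewrite cy0 pE; exact: stereo_den_neq0.
by move=> _ [z Uz <-]; rewrite KF // FK //; split=> //; exact: UD.
Qed.

Lemma gauss_image_open : open_in_sphere (range G).
Proof.
pose Y b := @stereo R n b @^-1` range G.
have oY b : open (Y b).
  rewrite openE => y /gauss_chart[c [V [K [Ac oV Vy _ h]]]].
  apply: filterS (open_nbhs_nbhs (conj oV Vy)) => z /h[_ e].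
  by exists (c (K z)).
pose P b := [set x : 'rV[R]_(1 + n) | 1 - chart_sign R b * time x != 0].
pose W b := P b `&` @stereo_inv R n b @^-1` Y b.
have oW b : open (W b).
  have [oP sP] := smooth_stereo_inv R n b.
  rewrite openE => x [Px Yx]; apply: filterI; first exact: open_nbhs_nbhs.
  exact: (smooth_continuous sP Px (open_nbhs_nbhs (conj (oY b) Yx))).
exists (W true `|` W false); first exact: openU.
apply/seteqP; split=> x.
  move=> [p _ <-]; split; last exact: gauss_sphere.
  have [b hb] := chart_exists (G p).
  have : W b (G p) by split=> //; rewrite /Y /= stereo_invK ?gauss_sphere //; exists p.
  by case: b hb => _; [left|right].
by move=> [[[Px Yx]|[Px Yx]] Sx]; rewrite /Y /= stereo_invK // in Yx.
Qed.

Variable rho : 'rV[R]_(1 + n) -> R.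
Hypothesis rhoG : forall p, rho (G p) = rhot p.

Lemma smooth_horospherical : smooth_map (sphere_atlas (range G)) (rho : _ -> R^o).
Proof.
move=> _ [b ->] /=; apply: smooth_local => y /gauss_chart[c [V [K [Ac oV Vy sK h]]]].
exists V, ((rhot \o c) \o K); split=> //.
  apply: (@smooth_comp _ _ _ _ (lp_dom c)) => //; first by move=> z /h[].
  exact: smooth_support.
by move=> z /h[_ e] /=; rewrite -rhoG e.
Qed.

Lemma horo_lift_gauss b (z : 'rV[R]_n) p : G p = stereo b z ->
  horo_lift b (conf_fun rho b) z = psi p.
Proof.
move=> e; rewrite psiE -rhoG e /horo_lift exp_conf_fun (stereo_lift b z).
by rewrite scalerA.
Qed.

Lemma derive_horo_gauss b y (c : lparam R n M) (V : set 'rV[R]_n) (K : 'rV[R]_n -> 'rV[R]_n) v :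
  A c -> open V -> smooth_on V K ->
  (forall z, V z -> lp_dom c (K z) /\ G (c (K z)) = stereo b z) -> V y ->
  'D_v (horo_lift b (conf_fun rho b)) y = 'D_('D_v K y) (psi \o c) (K y).
Proof.
move=> Ac oV sK h Vy; have nV : \forall z \near y, V z by exact: open_nbhs_nbhs.
have e : \forall z \near y, horo_lift b (conf_fun rho b) z = ((psi \o c) \o K) z.
  by apply: filterS nV => z /h[_ e] /=; exact: horo_lift_gauss.
apply: (etrans (near_eq_derive _ e)); apply: derive_comp.
  exact: smooth_differentiable sK Vy.
by have [Dy _] := h _ Vy; exact: smooth_differentiable (smooth_psi Ac) Dy.
Qed.

(* phi \o G^-1, avoiding G^-1 itself: M may be empty. *)
Definition gauss_lift (x : 'rV[R]_(1 + n)) : 'rV[R]_(1 + (1 + n)) :=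
  xget 0 [set w | exists2 p, G p = x & w = phi p].

Lemma gauss_liftE p : gauss_lift (G p) = phi p.
Proof.
rewrite /gauss_lift; case: xgetP => [w _ [q /injG -> ->]|/(_ (phi p))] //.
by case; exists p.
Qed.

Lemma smooth_gauss_lift b : smooth_on (@stereo R n b @^-1` range G) (gauss_lift \o stereo b).
Proof.
apply: smooth_local => y /gauss_chart[c [V [K [Ac oV Vy sK h]]]].
exists V, ((phi \o c) \o K); split=> //.
  apply: (@smooth_comp_mx _ _ _ _ _ _ (lp_dom c)) => //; first exact: dom_open.
    by move=> z /h[].
  exact: smooth_phi.
by move=> z /h[_ e] /=; rewrite -e gauss_liftE.
Qed.

Lemma gauss_transfer b y : range G (stereo b y) ->
  exists (c : lparam R n M) (z : 'rV[R]_n) (L : 'rV[R]_n -> 'rV[R]_n),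
  [/\ A c, lp_dom c z & forall v,
    'D_v (gauss_lift \o stereo b) y = 'D_(L v) (phi \o c) z /\
    'D_v (horo_lift b (conf_fun rho b)) y = 'D_(L v) (psi \o c) z] /\
    gauss_lift (stereo b y) = phi (c z).
Proof.
move=> /gauss_chart[c [V [K [Ac oV Vy sK h]]]].
have [Dy ey] := h _ Vy.
exists c, (K y), (fun v => 'D_v K y); split; last by rewrite -ey gauss_liftE.
split=> // v; split; last exact: derive_horo_gauss oV sK h Vy.
have nV : \forall z \near y, V z by exact: open_nbhs_nbhs.
have e : \forall z \near y, (gauss_lift \o stereo b) z = ((phi \o c) \o K) z.
  by apply: filterS nV => z /h[_ e] /=; rewrite -e gauss_liftE.
apply: (etrans (near_eq_derive _ e)); apply: derive_comp.
  exact: smooth_differentiable sK Vy.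
exact: smooth_differentiable (smooth_phi Ac) Dy.
Qed.

(** With Q the horospherical metric on v and T the value of [schouten], horospherical convexity
    gives 0 <= Q / 2 + T <= Q / (1 - k0); the constant covers both sides. *)
Lemma schouten_le b y v : range G (stereo b y) ->
  `|schouten (conf_fun rho b) y v| <= ((1 - k0)^-1 + 2^-1) * (expR (2 * conf_fun rho b y) * dot v v).
Proof.
move=> Oy; have oOm := gauss_image_open; have srho := smooth_horospherical.
have sf := smooth_conf oOm srho (b := b).
have df := smooth_differentiable sf Oy.
have B : lorentz ('D_v (gauss_lift \o stereo b) y) ('D_v (horo_lift b (conf_fun rho b)) y)
    = 2^-1 * (expR (2 * conf_fun rho b y) * dot v v) + schouten (conf_fun rho b) y v.
  apply: (fundamental_identity (@open_chart _ _ _ oOm b) sf) Oy.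
  - by move=> z Oz; exact: (smooth_differentiable (smooth_gauss_lift (b := b)) Oz).
  - by move=> z [p _ /= e]; rewrite -e gauss_liftE lorentz_phi.
  - by move=> z [p _ /= e]; rewrite (horo_lift_gauss e) -e gauss_liftE lorentz_phi_psi.
  (* <phi, dpsi> = - <dphi, psi> by differentiating <phi, psi> = -1, and dphi is orthogonal to both
     phi and eta, hence to psi. *)
  - move=> z w Oz; have [c [z' [L [[Ac Dz /(_ w)[_ e2]] e1]]]] := gauss_transfer Oz.
    apply: (etrans (congr1 (fun X => lorentz X ('D_w (horo_lift b (conf_fun rho b)) z)) e1)).
    apply: (etrans (congr1 (lorentz (phi (c z'))) e2)).
    have := derive_const_on (dom_open Ac) (L w) (fun z _ => lorentz_phi_psi (c z)) Dz.
    have dphi := smooth_differentiable (smooth_phi Ac) Dz.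
    have dpsi := smooth_differentiable (smooth_psi Ac) Dz.
    have [_ E] := derive_lorentz (L w) dphi dpsi.
    move=> E0; have := etrans (esym E) E0.
    have tp := tangent_position (dom_open Ac) (smooth_phi Ac) (fun z _ => lorentz_phi (c z)) (L w) Dz.
    have td : lorentz ('D_(L w) (phi \o c) z') (eta (c z')) = 0.
      by have [_ _ _ hh] := hyp; rewrite lorentzC; exact: hh.
    have -> : (psi \o c) z' = (phi \o c) z' + eta (c z') by [].
    by rewrite lorentzDr tp td !add0r.
have H := lorentz_horo_lift b v v df.
have [c [z' [L [[Ac Dz /(_ v)[e1 e2]] _]]]] := gauss_transfer Oy.
have [b1 b2 _] := bounds (L v) Ac Dz; rewrite -e2 -e1 H B in b1 b2.
have H0 : 0 <= expR (2 * conf_fun rho b y) * dot v v by rewrite mulr_ge0 ?expR_ge0 ?dot_ge0.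
move: b1 b2 H0; move: (_ * dot v v) (schouten _ _ _) => Q T b1 b2 H0.
have k1 : 0 < 1 - k0 by rewrite subr_gt0.
rewrite -ler_pdivlMl // in b2; have i1 : 0 <= (1 - k0)^-1 * Q by rewrite mulr_ge0 // invr_ge0 ltW.
rewrite mulrDl; move: b1 b2 i1; move: ((1 - k0)^-1 * Q) => S b1 b2 i1.
by rewrite ler_norml; apply/andP; split; lra.
Qed.

(** Charts are open maps, so continuity of G passes from [G \o c] to M. *)
Lemma gauss_continuous p : {for p, continuous G}.
Proof.
have [c Ac [y Dy <-]] := in_points p; move=> N hN.
have [_ _ _ /(_ c Ac)[_ _ _ hopen] _] := mA.
have h : nbhs y ((G \o c) @^-1` N) by exact: (smooth_continuous (smooth_gauss Ac) Dy hN).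
pose V := interior ((G \o c) @^-1` N) `&` lp_dom c.
have oV : open V by apply: openI; [exact: open_interior|exact: dom_open].
have Vy : V y by split=> //; exact: h.
have := hopen V oV (@subIsetr _ _ _) => oc.
have : nbhs (c y) (c @` V) by apply: open_nbhs_nbhs; split=> //; exists y.
by apply: filterS => _ [z [Vz _] <-]; exact: (interior_subset Vz).
Qed.

(** The inverse Gauss map is Lipschitz with constant 1 / (1 - k0) from the horospherical to the
    induced metric, and it lifts C^1 curves to C^1 curves because it is locally [c \o K] in charts.
    Completeness of M gives a limit there, which continuity of G sends back to the sphere. *)
Lemma conformal_complete : complete_metric A (induced_metric phi) ->
  complete_metric (sphere_atlas (range G)) (conformal_metric rho).
Proof.
move=> cA u pu cu; have oOm := gauss_image_open.
have ru k : range G (u k) by have := pu k; rewrite points_sphere.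
(* The sequence itself shows that M is inhabited, which supplies the default value of the
   inverse. *)
have [p0 _ _] := ru 0%N.
pose Gi x := xget p0 [set p | G p = x].
have GiK p : Gi (G p) = p.
  by rewrite /Gi; case: xgetP => [q _ /injG|/(_ p)] //; case.
have Gi_range x : range G x -> G (Gi x) = x by case=> p _ <-; rewrite GiK.
have k1 : 0 < 1 - k0 by rewrite subr_gt0.
have K0 : 0 < (1 - k0)^-1 by rewrite invr_gt0.
have [||p _ up] := @complete_transfer R n n _ _ A (sphere_atlas (range G)) (induced_metric phi)
  (conformal_metric rho) Gi _ K0 _ _ cA u pu cu.
- move=> gam t /C1_sphereP[b [y hy]].
  have [Oy gy dy _] := nbhs_singleton hy.
  have [c [V [K [Ac oV Vy sK h]]]] := gauss_chart Oy.
  have hy' : \forall s \near t, derivable y s 1 /\ {for s, continuous (derive1 y)}.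
    by apply: filterS hy => s [].
  have hK := C1_smooth_comp oV sK Vy hy'.
  have hG : \forall s \near t, Gi (gam s) = c (K (y s)).
    near=> s; have [Vs _ _] : [/\ V (y s), derivable (K \o y) s 1 & {for s, continuous (derive1 (K \o y))}].
      by near: s.
    have [_ -> _ _] : [/\ range G (stereo b (y s)), gam s = stereo b (y s), derivable y s 1
      & {for s, continuous (derive1 y)}] by near: s.
    by have [_ <-] := h _ Vs; rewrite GiK.
  split.
    exists c => //; exists (K \o y); near=> s.
    have [Vs d1 d2] : [/\ V (y s), derivable (K \o y) s 1 & {for s, continuous (derive1 (K \o y))}].
      by near: s.
    by split=> //; [exact: (h _ Vs).1|near: s].
  have gE : \forall s \near t, gam s = stereo b (y s) by apply: filterS hy => s [].
  rewrite (speed_conformal rho gE dy) /speed /=.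
  have [Dz _] := h _ Vy; have [_ dKy _] := nbhs_singleton hK.
  have dK := smooth_differentiable sK Vy.
  have -> : derive1 (phi \o (Gi \o gam)) t = 'D_('D_(derive1 y t) K (y t)) (phi \o c) (K (y t)).
    have dphi := smooth_differentiable (smooth_phi Ac) Dz.
    rewrite -(derive1_comp_diff dK dy).2.
    apply: etrans (derive1_comp_diff (y := K \o y) dphi dKy).2.
    rewrite !derive1E; apply: near_eq_derive.
    by apply: filterS hG => s /= ->.
  have [_ _] := bounds ('D_(derive1 y t) K (y t)) Ac Dz.
  rewrite -(derive_horo_gauss (derive1 y t) Ac oV sK h Vy).
  have df := smooth_differentiable (smooth_conf oOm smooth_horospherical (b := b)) Oy.
  rewrite (lorentz_horo_lift b _ _ df).
  set I := lorentz _ _; set q := dot _ _ => hI.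
  rewrite -ler_pdivrMl ?invr_gt0 // invrK.
  have -> : (1 - k0) * Num.sqrt I = Num.sqrt ((1 - k0) ^+ 2 * I).
    by rewrite sqrtrM ?sqr_ge0 // sqrtr_sqr ger0_norm // ltW.
  have -> : expR (conf_fun rho b (y t)) * Num.sqrt q = Num.sqrt (expR (2 * conf_fun rho b (y t)) * q).
    by rewrite expR2 -expr2 sqrtrM ?sqr_ge0 // sqrtr_sqr ger0_norm // expR_ge0.
  exact: ler_wsqrtr.
- by move=> q _; exact: in_points.
exists (G p); first by rewrite points_sphere //; exists p.
have -> : u = G \o (Gi \o u) by apply/funext => k /=; rewrite Gi_range.
exact: (cvg_comp _ _ up (@gauss_continuous p)).
Unshelve. all: by end_near.
Qed.

(** The hypersurface is reparametrized by the image of G through [gauss_lift], so that the argument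
    for conformal domains applies; <phi, psi> = -1 supplies its support condition. *)
Lemma gauss_boundary : (0 < n)%N -> complete_metric A (induced_metric phi) ->
  boundary_at_infinity (range phi) = sphere_boundary (range G).
Proof.
move=> n0 cA; have oOm := gauss_image_open; have srho := smooth_horospherical.
have -> : range phi = gauss_lift @` range G.
  apply/seteqP; split=> [_ [p _ <-]|_ [_ [p _ <-] <-]]; last by rewrite gauss_liftE; exists p.
  by exists (G p); [exists p|exact: gauss_liftE].
have C0 : 0 < (1 - k0)^-1 + 2^-1 by rewrite addr_gt0 ?invr_gt0 // subr_gt0.
have cl b y : range G (stereo b y) -> {for y, continuous (fun z => gauss_lift (stereo b z))}.
  by move=> Oy; exact: (smooth_continuous (smooth_gauss_lift (b := b)) Oy).
apply: (@boundary_at_infinityE R n (range G) rho gauss_lift) => //.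
- by move=> _ [p _ <-]; rewrite gauss_liftE; have [_ _ /(_ p (in_points p))[]] := hyp.
- move=> _ [p _ <-]; rewrite gauss_liftE rhoG; have := lorentz_phi_psi p.
  rewrite psiE lorentzZr expRN => e; apply: (mulfI (lt0r_neq0 (expR_gt0 (rhot p)))).
  by rewrite e mulrN divff // gt_eqF // expR_gt0.
- move=> x Ox; apply: (within_chart_cvg oOm) Ox => b y Oy.
  exact: (smooth_continuous (smooth_rho srho (b := b)) Oy).
- move=> x Ox; apply: (cvg_comp _ _ (within_chart_cvg oOm cl Ox)).
  exact: time_continuous.
- move=> L; apply: (sublevel_compact oOm srho C0) => //; last exact: conformal_complete.
  by move=> b y Oy v; rewrite (le_trans (ler_norm _)) // schouten_le.
Qed.

Lemma conformal_bounded_curvature :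
  bounded_curvature (sphere_atlas (range G)) (conformal_metric rho).
Proof.
apply: curvature_of_schouten; [exact: gauss_image_open|exact: smooth_horospherical|].
by move=> b y v Oy; exact: schouten_le.
Qed.

End GaussMap.

Theorem theorem1p5 (R : realType) (n : nat) (hn : (3 <= n)%N) :
  (forall (M : topologicalType) (A : set (lparam R n M))
      (phi eta : M -> 'rV[R]_(1 + (1 + n)))
      (G : M -> 'rV[R]_(1 + n)) (rhot : M -> R),
    smooth_manifold A ->
    hypersurface A phi eta ->
    complete_metric A (induced_metric phi) ->
    unif_horo_convex A phi eta ->
    gauss_support A phi eta G rhot ->
    injective G ->
    forall rho : 'rV[R]_(1 + n) -> R, (forall p, rho (G p) = rhot p) ->
    [/\ immersion A G,
        open_in_sphere (range G),
        smooth_map (sphere_atlas (range G)) (rho : _ -> R^o),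
        complete_metric (sphere_atlas (range G)) (conformal_metric rho) /\
        bounded_curvature (sphere_atlas (range G)) (conformal_metric rho) &
        boundary_at_infinity (range phi) = sphere_boundary (range G)])
  /\
  (forall (Omega : set 'rV[R]_(1 + n)) (rho : 'rV[R]_(1 + n) -> R),
    sphere_domain Omega ->
    smooth_map (sphere_atlas Omega) (rho : _ -> R^o) ->
    complete_metric (sphere_atlas Omega) (conformal_metric rho) ->
    bounded_curvature (sphere_atlas Omega) (conformal_metric rho) ->
    exists t0 : R, forall t : R, t0 <= t ->
    [/\ hypersurface (sphere_atlas Omega) (phi_of rho t) (eta_of rho t),
        proper_map (sphere_atlas Omega) (phi_of rho t),
        complete_metric (sphere_atlas Omega) (induced_metric (phi_of rho t)),
        unif_horo_convex (sphere_atlas Omega) (phi_of rho t) (eta_of rho t) &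
        boundary_at_infinity (phi_of rho t @` Omega) = sphere_boundary Omega]).

Proof.
split=> [M A phi eta G rhot mA hyp cA [k0 k01 hk] gs injG rho rhoG|Omega rho].
  have n0 : (0 < n)%N by exact: ltn_trans hn.
  split.
  - exact: (gauss_immersion mA hyp k01 hk gs).
  - exact: (gauss_image_open mA hyp k01 hk gs injG).
  - exact: (smooth_horospherical mA hyp k01 hk gs injG rhoG).
  - split; first exact: (conformal_complete mA hyp k01 hk gs injG rhoG cA).
    exact: (conformal_bounded_curvature mA hyp k01 hk gs injG rhoG).
  - exact: (gauss_boundary mA hyp k01 hk gs injG rhoG n0 cA).
exact: horospherical_hypersurfaces.
Qed.
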